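(* Let $\Lambda=\Lambda_0\oplus\Lambda_1$ be a finite-dimensional commutative superalgebra satisfying condition $(A_0)$ and the positivity condition $(\mathcal{P})$. Let $n\ge1$, let $D$ be a domain of $\Lambda_0^n$, and let $f:D\to\Lambda$ be a function (with no other regularity assumed) that is separately S-differentiable in the variables $y_1,\dots,y_n$. Then $f$ is of class $C^1$ in the sense of Fréchet on $D$, and consequently $f$ is S-differentiable at every point $y=(y_1,\dots,y_n)$ of $D$.
   Context: A commutative superalgebra (CSA) is a real associative unital algebra $\Lambda=\Lambda_0\oplus\Lambda_1$ (direct sum of real vector subspaces), here always of finite dimension, such that $\Lambda_0$ is a subalgebra, $\Lambda_1\Lambda_1\subset\Lambda_0$, $\Lambda_0\Lambda_1\subset\Lambda_1$, elements of $\Lambda_0$ commute with all elements of $\Lambda$, and any two elements of $\Lambda_1$ anticommute. The unit is $e_0=1\in\Lambda_0$; $\dim\Lambda_0=p+1$, $\dim\Lambda_1=q$. Condition $(A_0)$: there is a basis $(e_0=1,e_1,\dots,e_p)$ of $\Lambda_0$ with $\sum_{k=0}^p e_k^2=0$. Fix such a basis of $\Lambda_0$ and a basis $(e_{p+1},\dots,e_{p+q})$ of $\Lambda_1$; the structure coefficients $\Gamma_{i,j}^k\in\mathbb{R}$ are defined by $e_ie_j=\sum_{k=0}^{p+q}\Gamma_{i,j}^k e_k$, $0\le i,j\le p+q$. Condition $(\mathcal{P})$: for all $X=(X_0,\dots,X_{p+q})$ and $Y=(Y_0,\dots,Y_{p+q})$ in $\mathbb{R}^{p+q+1}$, $$\Big(\sum_{j=0}^{p+q}X_j^2\Big)\sum_{k=0}^{p}\sum_{j=0}^{p+q}\Big(\sum_{m=0}^{p+q}Y_m\Gamma_{m,k}^j\Big)^2-2\sum_{k=0}^{p}\Big(\sum_{j=0}^{p+q}X_j\sum_{m=0}^{p+q}Y_m\Gamma_{m,k}^j\Big)^2\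 \ge 0.$$ A map $F:U\to\Lambda$ on an open set $U\subset\Lambda_0^n$ is S-differentiable (superdifferentiable on the right) at $x\in U$ if there exist $\frac{\partial F}{\partial x_j}(x)\in\Lambda$, $j=1,\dots,n$, such that for all $h=(h_1,\dots,h_n)\in\Lambda_0^n$ with $x+h\in U$, $F(x+h)=F(x)+\sum_{j=1}^n\frac{\partial F}{\partial x_j}(x)h_j+o(h)$, where $\|o(h)\|/\|h\|\to0$ as $\|h\|\to0$ (products in $\Lambda$; $\|\cdot\|$ any norms). The function $f$ on $D\subset\Lambda_0^n$ is separately S-differentiable in $y_1,\dots,y_n$ if, for each $j$ and each choice of the other variables held fixed, the function $y_j\mapsto f(y_1,\dots,y_n)$ is S-differentiable at every point of the corresponding open slice of $D$ in $\Lambda_0$. A domain is a connected open set. *)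

(* Defs.v *)
From HB Require Import structures.
From mathcomp Require Import all_boot all_order all_algebra falgebra.
From mathcomp Require Import all_classical all_reals all_analysis.

Set Implicit Arguments.
Unset Strict Implicit.
Unset Printing Implicit Defensive.

Import Order.TTheory GRing.Theory Num.Theory.
Import numFieldNormedType.Exports.

Local Open Scope classical_set_scope.
Local Open Scope ring_scope.

(* [normed_vect V] is the finite-dimensional space V with the sup norm of its
   coordinates in the basis [vbasis fullv]. All norms on V are equivalent, so
   openness, connectedness, o(h) and Frechet differentiability do not depend on
   this choice. *)
Definition normed_vect (R : realType) (V : vectType R) : Type := V.

Section NormedVect.
Context {R : realType} (V : vectType R).

HB.instance Definition _ := Vector.on (normed_vect V).

Definition vect_norm (v : normed_vect V) : R :=
  `|\row_i coord (vbasis (fullv : {vspace V})) i (v : V)|.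

Lemma vect_normD (u v : normed_vect V) :
  vect_norm (u + v) <= vect_norm u + vect_norm v.
Proof.
rewrite /vect_norm (le_trans _ (ler_normD _ _))// le_eqVlt; apply/orP; left.
by apply/eqP; congr `|_|; apply/rowP => i; rewrite !mxE linearD.
Qed.

Lemma vect_normZ (a : R) (v : normed_vect V) :
  vect_norm (a *: v) = `|a| * vect_norm v.
Proof.
rewrite /vect_norm -normrZ; congr `|_|.
by apply/rowP => i; rewrite !mxE linearZ.
Qed.

Lemma vect_norm0_eq0 (v : normed_vect V) : vect_norm v = 0 -> v = 0.
Proof.
move=> /eqP; rewrite /vect_norm normr_eq0 => /eqP/rowP v0.
rewrite (coord_vbasis (memvf (v : V))) big1// => i _.
by have := v0 i; rewrite !mxE => ->; rewrite scale0r.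
Qed.

HB.instance Definition _ := Lmodule_isNormed.Build R (normed_vect V)
  vect_normD vect_normZ vect_norm0_eq0.

End NormedVect.

(* A [falgType R] is a nonzero finite-dimensional associative unital algebra;
   products of subspaces are the spans of the products of their elements. *)
Record csa (R : realType) (L : falgType R) (L0 L1 : {vspace L}) : Prop := Csa {
  csa_full : (L0 + L1)%VS = fullv;
  csa_direct : (L0 :&: L1)%VS = 0%VS;
  csa_one : 1 \in L0;
  csa_mul00 : (L0 * L0 <= L0)%VS;
  csa_mul11 : (L1 * L1 <= L0)%VS;
  csa_mul01 : (L0 * L1 <= L1)%VS;
  csa_comm : forall a b, a \in L0 -> a * b = b * a;
  csa_anticomm : forall a b, a \in L1 -> b \in L1 -> a * b = - (b * a)
}.

Definition A0_basis (R : realType) (L : falgType R) (L0 : {vspace L}) (p : nat)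
    (e : p.+1.-tuple L) : Prop :=
  [/\ basis_of L0 e, tnth e ord0 = 1 & \sum_(k < p.+1) tnth e k ^+ 2 = 0].

(* [structure_coef b i j k] is the coordinate Gamma_{i,j}^k. *)
Definition structure_coef (R : realType) (L : falgType R) (N : nat)
    (b : N.-tuple L) (i j k : 'I_N) : R :=
  coord b k (tnth b i * tnth b j).

(* The indices k <= p of the even basis vectors are the [lshift q k]. *)
Definition condP (R : realType) (L : falgType R) (p q : nat)
    (e : p.+1.-tuple L) (s : q.-tuple L) : Prop :=
  let G := structure_coef (cat_tuple e s) in
  forall X Y : 'I_(p.+1 + q) -> R,
    0 <= (\sum_j X j ^+ 2) *
           (\sum_(k < p.+1) \sum_j (\sum_m Y m * G m (lshift q k) j) ^+ 2)
         - 2 * \sum_(k < p.+1)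
                 (\sum_j X j * \sum_m Y m * G m (lshift q k) j) ^+ 2.

Notation even_space L0 n := (normed_vect {ffun 'I_n -> subvs_of L0}).

Section Superdifferentiability.
Context {R : realType} {L : falgType R} {L0 : {vspace L}}.

Definition even_coord n (x : even_space L0 n) (j : 'I_n) : subvs_of L0 :=
  (x : {ffun 'I_n -> subvs_of L0}) j.

Definition replace_coord n (y : even_space L0 n) (j : 'I_n) (t : subvs_of L0) :
    even_space L0 n :=
  [ffun i => if i == j then t else even_coord y i].

(* Functions on an open set U are total functions whose values off U are
   irrelevant: at a point of U, x + h is in U for h near 0. *)
Definition S_differentiable n (F : even_space L0 n -> normed_vect L)
    (x : even_space L0 n) : Prop :=
  exists dF : 'I_n -> L, forall h : even_space L0 n,
    F (x + h) = F x + (\sum_j dF j * vsval (even_coord h j) : normed_vect L)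
                +o_(h \near 0) h.

(* The one-variable function y_j |-> f(y_1,...,y_n) is a function on
   Lambda_0 = Lambda_0^1. *)
Definition separately_S_differentiable n (D : set (even_space L0 n))
    (f : even_space L0 n -> normed_vect L) : Prop :=
  forall (j : 'I_n) (y : even_space L0 n) (t : even_space L0 1),
    D (replace_coord y j (even_coord t ord0)) ->
    S_differentiable
      (fun u : even_space L0 1 => f (replace_coord y j (even_coord u ord0))) t.

End Superdifferentiability.

(* For D open; the differential is continuous for the operator norm. *)
Definition frechet_C1 (R : realType) (V W : normedModType R) (D : set V)
    (f : V -> W) : Prop :=
  (forall x, D x -> differentiable f x) /\
  (forall x, D x -> forall eps : R, 0 < eps ->
     \forall y \near x, forall v : V, `|'d f y v - 'd f x v| <= eps * `|v|).

(* Main.v *)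
Require Import Defs.
From HB Require Import structures.
From mathcomp Require Import all_boot all_order all_algebra falgebra.
From mathcomp Require Import all_classical all_reals all_analysis.
From mathcomp Require Import complex ring lra.

Set Implicit Arguments.
Unset Strict Implicit.
Unset Printing Implicit Defensive.

Import Order.TTheory GRing.Theory Num.Theory.
Import numFieldNormedType.Exports.

Local Open Scope classical_set_scope.
Local Open Scope ring_scope.

(** Condition (A0) writes -1 as a sum of squares in the even part. The even part
    is a finite product of local real algebras; a residue field equal to R would
    make that sum of squares a sum of squares of reals, so all residue fields
    are C, and Newton's iteration lifts i to an element J with J^2 = -1. Hence
    Lambda is a complex vector space, the variables y_j are tuples of complex
    variables, and S-differentiability implies complex differentiability: f is
    separately holomorphic and Hartogs' theorem makes it locally bounded. Cauchy
    estimates then bound the second order remainders, which gives C^1; the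
    differential is the sum of the partial ones, which gives S-differentiability.

    Hartogs' theorem is proved by induction on the variables: Baire's argument
    bounds f on a product with a small disc in the last variable, and Hartogs'
    lemma on the Taylor coefficients in that variable enlarges the disc. Contour
    integrals are replaced by trapezoidal sums on triangles and by averages over
    roots of unity, and subharmonicity of log |a_k| by the maximum principle for
    a product of rotated copies of a_k. *)

(** What has to be won is a bound in several variables; once [hartogs_bounded] gives it, all later
    estimates are one-variable Cauchy estimates with constants that depend on the bound alone. Means
    over a circle are linear and bounded on all bounded functions, but not countably additive: every
    series is therefore a finite sum with an explicit remainder. In Hartogs' lemma the exceptional
    sets are open and decrease to the empty set; their areas tend to 0, and this limits the
    proportion of bad points on a grid. No complex basis of the even part is chosen: each pair of a
    variable and a basis vector e_k receives its own complex parameter. The resulting chart is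
    redundant, but real parameters already reach every point, and the estimates return to f by
    substituting real coordinates. *)

Ltac nonneg := by repeat first
  [ assumption | exact: ltW | exact: ler0n | apply: exprn_ge0
  | apply: mulr_ge0 | apply: addr_ge0 | rewrite invr_ge0 | done ].

(** * A real-valued modulus on the complex numbers *)

Section ComplexModulus.
Context {R : realType}.
Local Notation C := R[i].
Local Notation Re := (@complex.Re R).
Local Notation Im := (@complex.Im R).
Implicit Types (z w : C) (x : R).

(** The norm of [R[i]] takes values in [R[i]]; with values in [R] all estimates are real
    inequalities. *)
Definition cabs z : R := Normc.normc z.

Lemma cabsM z w : cabs (z * w) = cabs z * cabs w.
Proof. exact: Normc.normcM. Qed.

Lemma cabsV z : cabs z^-1 = (cabs z)^-1.
Proof. exact: Normc.normcV. Qed.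

Lemma cabsD z w : cabs (z + w) <= cabs z + cabs w.
Proof. exact: le_normcD. Qed.

Lemma cabsN z : cabs (- z) = cabs z.
Proof. exact: normcN. Qed.

Lemma cabs_ge0 z : 0 <= cabs z.
Proof. by case: z => a b; rewrite sqrtr_ge0. Qed.

Lemma cabs0 : cabs 0 = 0.
Proof. exact: Normc.normc0. Qed.

Lemma cabs1 : cabs 1 = 1.
Proof. exact: Normc.normc1. Qed.

Lemma cabs_eq0 z : (cabs z == 0) = (z == 0).
Proof.
by apply/eqP/eqP => [/Normc.eq0_normc //|->]; exact: cabs0.
Qed.

Lemma cabs_gt0 z : (0 < cabs z) = (z != 0).
Proof. by rewrite lt_neqAle cabs_ge0 andbT eq_sym cabs_eq0. Qed.

Lemma cabsB z w : cabs (z - w) <= cabs z + cabs w.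
Proof. by rewrite -(cabsN w) cabsD. Qed.

Lemma cabsC z w : cabs (z - w) = cabs (w - z).
Proof. by rewrite -cabsN opprB. Qed.

Lemma cabs_tri z w t : cabs (z - t) <= cabs (z - w) + cabs (w - t).
Proof. by rewrite (le_trans _ (cabsD _ _))// addrA subrK. Qed.

Lemma cabsBr z w : cabs z - cabs w <= cabs (z - w).
Proof. by rewrite lerBlDr (le_trans _ (cabsD _ _))// subrK. Qed.

Lemma cabsX z n : cabs (z ^+ n) = cabs z ^+ n.
Proof. by elim: n => [|n IH]; rewrite ?cabs1// !exprS cabsM IH. Qed.

Lemma cabs_real x : cabs x%:C%C = `|x|.
Proof. by rewrite /cabs /= expr0n /= addr0 sqrtr_sqr. Qed.

Lemma cabs_nat n : cabs n%:R = n%:R.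
Proof. by rewrite -(rmorph_nat (real_complex R)) cabs_real normr_nat. Qed.

Lemma cabs_sum (I : Type) (r : seq I) (P : pred I) (F : I -> C) :
  cabs (\sum_(i <- r | P i) F i) <= \sum_(i <- r | P i) cabs (F i).
Proof.
elim/big_ind2 : _ => [|x1 x2 y1 y2 h1 h2|//]; first by rewrite cabs0.
exact: (le_trans (cabsD _ _) (lerD h1 h2)).
Qed.

Lemma cabs_prod (I : Type) (r : seq I) (P : pred I) (F : I -> C) :
  cabs (\prod_(i <- r | P i) F i) = \prod_(i <- r | P i) cabs (F i).
Proof. by apply: big_morph; [exact: cabsM|exact: cabs1]. Qed.

Lemma Re_le_cabs z : `|Re z| <= cabs z.
Proof. by case: z => a b /=; rewrite -sqrtr_sqr ler_wsqrtr// lerDl sqr_ge0. Qed.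

Lemma Im_le_cabs z : `|Im z| <= cabs z.
Proof. by case: z => a b /=; rewrite -sqrtr_sqr ler_wsqrtr// lerDr sqr_ge0. Qed.

Lemma cabs_le_ReIm z : cabs z <= `|Re z| + `|Im z|.
Proof.
rewrite [z in cabs z]complexE (le_trans (cabsD _ _))// cabsM !cabs_real.
by rewrite /cabs /= expr0n expr1n add0r sqrtr1 mul1r.
Qed.

End ComplexModulus.

#[global] Hint Extern 0 (is_true (0 <= cabs _)) => exact: cabs_ge0 : core.

(** * Limits of geometrically convergent sequences *)

Section GeometricLimit.
Context {R : realType}.

(** The intervals with center [x k] and radius 2 * 2^-k are nested, since the radius lost from k to
    k + 1 is exactly the allowed step 2^-k. The limit is the supremum of their left ends. *)
Lemma geometric_cauchy_limit (x : nat -> R) :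
  (forall k, `|x k.+1 - x k| <= 2^-1 ^+ k) ->
  exists l, forall k, `|x k - l| <= 2 * 2^-1 ^+ k.
Proof.
move=> hx.
pose lo k := x k - 2 * 2^-1 ^+ k; pose hi k := x k + 2 * 2^-1 ^+ k.
have e2 k : 2^-1 ^+ k.+1 = 2^-1 ^+ k / 2 :> R by rewrite exprSr.
have loS k : lo k <= lo k.+1.
  by have := hx k; rewrite /lo e2 ler_norml => /andP[]; lra.
have hiS k : hi k.+1 <= hi k.
  by have := hx k; rewrite /hi e2 ler_norml => /andP[]; lra.
have lo_mono m n : (m <= n)%N -> lo m <= lo n.
  move=> /subnK <-; elim: (n - m)%N => [|i IH]; first by rewrite add0n.
  by rewrite addSn (le_trans IH).
have hi_mono m n : (m <= n)%N -> hi n <= hi m.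
  move=> /subnK <-; elim: (n - m)%N => [|i IH]; first by rewrite add0n.
  by rewrite addSn (le_trans _ IH).
have lohi m n : lo m <= hi n.
  apply: (le_trans (lo_mono _ _ (leq_maxl m n))).
  apply: (le_trans _ (hi_mono _ _ (leq_maxr m n))).
  have : 0 <= 2^-1 ^+ maxn m n :> R by rewrite exprn_ge0.
  by rewrite /lo /hi; lra.
have hs : has_sup (range lo).
  by split; [exists (lo 0%N), 0%N|exists (hi 0%N) => _ [m _ <-]].
exists (sup (range lo)) => k; rewrite ler_norml.
have : sup (range lo) <= hi k by apply: ge_sup => [|_ [m _ <-]//]; exact: hs.1.
have : lo k <= sup (range lo) by apply: ub_le_sup; [exact: hs.2|exists k].
by rewrite /lo /hi => h1 h2; apply/andP; split; lra.
Qed.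

Lemma half_exp_lt (e : R) : 0 < e -> exists k, 2^-1 ^+ k < e.
Proof.
move=> e0; exists (Num.truncn e^-1).+1.
rewrite -[ltRHS]invrK exprVn ltf_pV2 ?posrE ?exprn_gt0 ?invr_gt0//.
apply: (lt_trans (truncnS_gt _)).
by rewrite -natrX ltr_nat ltn_expl.
Qed.

Lemma eps_le (x y : R) : (forall e, 0 < e -> x <= y + e) -> x <= y.
Proof. by move=> h; apply/ler_addgt0Pr. Qed.

End GeometricLimit.

Definition complex_derivative {R : realType} (g : R[i] -> R[i]) (z d : R[i]) :=
  forall e : R, 0 < e -> exists2 del : R, 0 < del &
    forall h, cabs h < del -> cabs (g (z + h) - g z - d * h) <= e * cabs h.

Definition complex_diff {R : realType} (g : R[i] -> R[i]) (z : R[i]) :=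
  exists d, complex_derivative g z d.

(** * Goursat's theorem *)

Section Goursat.
Context {R : realType}.
Local Notation C := R[i].
Variable h : C -> C.

(* Trapezoidal sums for the integral of h on [a, b] with 2^n steps. *)
Fixpoint trapezoid n (a b : C) : C :=
  if n is m.+1 then trapezoid m a ((a + b) / 2) + trapezoid m ((a + b) / 2) b
  else (h a + h b) / 2 * (b - a).

Definition triangle n (a b c : C) :=
  trapezoid n a b + trapezoid n b c + trapezoid n c a.

Lemma trapezoid_sym n a b : trapezoid n b a = - trapezoid n a b.
Proof.
elim: n a b => [|n IH] a b /=; first by ring.
by rewrite [b + a]addrC (IH ((a + b) / 2) b) (IH a); ring.
Qed.

(** The trapezoidal rule is exact for [al + be * (z - z0)], whose primitive gives the subtracted
    term. The error is thus at most [e] times the length, uniformly in [n]; midpoints stay in the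
    disc by convexity. *)
Lemma trapezoid_affine n (a b z0 al be : C) (r e : R) :
  (forall z, cabs (z - z0) <= r -> cabs (h z - (al + be * (z - z0))) <= e) ->
  cabs (a - z0) <= r -> cabs (b - z0) <= r ->
  cabs (trapezoid n a b -
     (al * (b - a) + be * ((b - z0) ^+ 2 - (a - z0) ^+ 2) / 2))
    <= e * cabs (b - a).
Proof.
move=> he; elim: n a b => [|n IH] a b ha hb /=.
  have -> : (h a + h b) / 2 * (b - a) -
     (al * (b - a) + be * ((b - z0) ^+ 2 - (a - z0) ^+ 2) / 2) =
     ((h a - (al + be * (a - z0))) + (h b - (al + be * (b - z0)))) / 2 * (b - a).
    by field.
  rewrite cabsM ler_wpM2r ?cabs_ge0// cabsM cabsV (cabs_nat 2).
  rewrite ler_pdivrMr// (le_trans (cabsD _ _))//.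
  by have := he _ ha; have := he _ hb; lra.
set m := (a + b) / 2.
have hm : cabs (m - z0) <= r.
  have -> : m - z0 = ((a - z0) + (b - z0)) / 2 by rewrite /m; field.
  rewrite cabsM cabsV (cabs_nat 2) ler_pdivrMr// (le_trans (cabsD _ _))//; lra.
have -> : trapezoid n a m + trapezoid n m b -
     (al * (b - a) + be * ((b - z0) ^+ 2 - (a - z0) ^+ 2) / 2) =
   (trapezoid n a m - (al * (m - a) + be * ((m - z0) ^+ 2 - (a - z0) ^+ 2) / 2)) +
   (trapezoid n m b - (al * (b - m) + be * ((b - z0) ^+ 2 - (m - z0) ^+ 2) / 2)).
  by field.
apply: (le_trans (cabsD _ _)).
have e1 : cabs (m - a) = cabs (b - a) / 2.
  by rewrite -[2 in RHS](cabs_nat 2) -cabsV -cabsM; congr cabs; rewrite /m; field.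
have e2 : cabs (b - m) = cabs (b - a) / 2.
  by rewrite -[2 in RHS](cabs_nat 2) -cabsV -cabsM; congr cabs; rewrite /m; field.
have := IH a m ha hm; have := IH m b hm hb; rewrite e1 e2; lra.
Qed.

(** The primitive of the affine part contributes 0 around a closed triangle. *)
Lemma triangle_affine n (a b c z0 al be : C) (r e : R) :
  (forall z, cabs (z - z0) <= r -> cabs (h z - (al + be * (z - z0))) <= e) ->
  cabs (a - z0) <= r -> cabs (b - z0) <= r -> cabs (c - z0) <= r ->
  cabs (triangle n a b c) <= e * (cabs (b - a) + cabs (c - b) + cabs (a - c)).
Proof.
move=> he ha hb hc.
have := trapezoid_affine n he ha hb; have := trapezoid_affine n he hb hc.
have := trapezoid_affine n he hc ha.
set X := trapezoid n c a - _; set Y := trapezoid n b c - _.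
set Z := trapezoid n a b - _ => hX hY hZ.
have -> : triangle n a b c = Z + Y + X by rewrite /triangle /X /Y /Z; field.
rewrite (le_trans (cabsD _ _))// !mulrDr lerD//.
by rewrite (le_trans (cabsD _ _))// lerD.
Qed.

(** Each inner side is run twice in opposite directions and cancels exactly at every finite stage,
    by [trapezoid_sym]. The middle triangle is inverted. *)
Lemma triangleS n (p u v : C) :
  triangle n.+1 p (p + u) (p + v) =
    triangle n p (p + u / 2) (p + v / 2) +
    triangle n (p + u / 2) (p + u / 2 + u / 2) (p + u / 2 + v / 2) +
    triangle n (p + v / 2) (p + v / 2 + u / 2) (p + v / 2 + v / 2) +
    triangle n (p + u / 2 + v / 2) (p + u / 2 + v / 2 + - u / 2)
               (p + u / 2 + v / 2 + - v / 2).
Proof.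
rewrite /triangle /=.
have -> : (p + (p + u)) / 2 = p + u / 2 by field.
have -> : (p + u + (p + v)) / 2 = p + u / 2 + v / 2 by field.
have -> : (p + v + p) / 2 = p + v / 2 by field.
have -> : p + u / 2 + u / 2 = p + u by field.
have -> : p + v / 2 + v / 2 = p + v by field.
have -> : p + v / 2 + u / 2 = p + u / 2 + v / 2 by field.
have -> : p + u / 2 + v / 2 + - u / 2 = p + v / 2 by field.
have -> : p + u / 2 + v / 2 + - v / 2 = p + u / 2 by field.
rewrite (trapezoid_sym n (p + u / 2) (p + v / 2)).
rewrite (trapezoid_sym n (p + v / 2) (p + u / 2 + v / 2)).
rewrite (trapezoid_sym n (p + u / 2) (p + u / 2 + v / 2)).
by ring.
Qed.

(** Stands for an integral along the triangle of modulus at most [e], without knowing that the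
    trapezoidal sums converge. *)
Definition eventually_small (e : R) a b c :=
  exists n0, forall n, (n0 <= n)%N -> cabs (triangle n a b c) <= e.

Lemma eventually_small_split (p u v : C) (e1 e2 e3 e4 : R) :
  eventually_small e1 p (p + u / 2) (p + v / 2) ->
  eventually_small e2 (p + u / 2) (p + u / 2 + u / 2) (p + u / 2 + v / 2) ->
  eventually_small e3 (p + v / 2) (p + v / 2 + u / 2) (p + v / 2 + v / 2) ->
  eventually_small e4 (p + u / 2 + v / 2) (p + u / 2 + v / 2 + - u / 2)
               (p + u / 2 + v / 2 + - v / 2) ->
  eventually_small (e1 + e2 + e3 + e4) p (p + u) (p + v).
Proof.
move=> [n1 h1] [n2 h2] [n3 h3] [n4 h4].
exists (maxn (maxn n1 n2) (maxn n3 n4)).+1 => -[//|n]; rewrite ltnS !geq_max.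
move=> /andP[/andP[k1 k2] /andP[k3 k4]]; rewrite triangleS.
rewrite (le_trans (cabsD _ _))// lerD ?h4// (le_trans (cabsD _ _))// lerD ?h3//.
by rewrite (le_trans (cabsD _ _))// lerD ?h1 ?h2.
Qed.

Definition in_triangle (p u v z : C) :=
  exists x y : R, [/\ 0 <= x, 0 <= y, x + y <= 1 & z = p + x%:C%C * u + y%:C%C * v].

Section Bisection.
Variables (p u v : C).

(* The state (x, y, sg, e) stands for the triangle with vertex [corner x y] and
   sides sg * u, sg * v, and for the bound e on its trapezoidal sums; sg < 0 for
   the inverted middle triangle of a subdivision. *)
Let state := (R * R * R * R)%type.
Let corner (x y : R) : C := p + x%:C%C * u + y%:C%C * v.
Let good (s : state) :=
  let: (x, y, sg, e) := s in
  eventually_small e (corner x y) (corner (x + sg) y) (corner x (y + sg)).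
Let child0 (s : state) : state := let: (x, y, sg, e) := s in (x, y, sg / 2, e / 4).
Let child1 (s : state) : state :=
  let: (x, y, sg, e) := s in (x + sg / 2, y, sg / 2, e / 4).
Let child2 (s : state) : state :=
  let: (x, y, sg, e) := s in (x, y + sg / 2, sg / 2, e / 4).
Let child3 (s : state) : state :=
  let: (x, y, sg, e) := s in (x + sg / 2, y + sg / 2, - sg / 2, e / 4).
Let next (s : state) : state :=
  if ~~ `[< good (child0 s) >] then child0 s else
  if ~~ `[< good (child1 s) >] then child1 s else
  if ~~ `[< good (child2 s) >] then child2 s else child3 s.
Let nextP (s : state) : [\/ next s = child0 s, next s = child1 s,
  next s = child2 s | next s = child3 s].
Proof.
rewrite /next; case: ifP => _; first by constructor 1.
case: ifP => _; first by constructor 2.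
by case: ifP => _; [constructor 3|constructor 4].
Qed.

(** Were all four quarters good for [e / 4], the sum of the bounds would make the whole good for
    [e]; so [child3], the default of [next], is bad when the other three are good. *)
Let bad_next s : ~ good s -> ~ good (next s).
Proof.
move=> bs; rewrite /next.
case: asboolP => // b0; case: asboolP => // b1.
case: asboolP => // b2 /= b3; apply: bs.
case: s b0 b1 b2 b3 => [[[x y] sg] e].
rewrite /child0 /child1 /child2 /child3 /good => b0 b1 b2 b3.
move: b0 b1 b2 b3.
set q := corner x y; set u' := sg%:C%C * u; set v' := sg%:C%C * v.
have cE t : corner (x + t) y = q + t%:C%C * u.
  by rewrite /q /corner rmorphD /=; ring.
have cE' t : corner x (y + t) = q + t%:C%C * v.
  by rewrite /q /corner rmorphD /=; ring.
have cE2 t t' : corner (x + t) (y + t') = q + t%:C%C * u + t'%:C%C * v.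
  by rewrite /q /corner !rmorphD /=; ring.
have h2 : (sg / 2)%:C%C = sg%:C%C / 2 by rewrite rmorphM fmorphV rmorph_nat.
have h2N : (- sg / 2)%:C%C = - sg%:C%C / 2 by rewrite rmorphM fmorphV rmorph_nat rmorphN.
have eu : (sg / 2)%:C%C * u = u' / 2 by rewrite h2 /u'; ring.
have ev : (sg / 2)%:C%C * v = v' / 2 by rewrite h2 /v'; ring.
have euN : (- sg / 2)%:C%C * u = - u' / 2 by rewrite h2N /u'; ring.
have evN : (- sg / 2)%:C%C * v = - v' / 2 by rewrite h2N /v'; ring.
have b1E : corner (x + sg / 2 + sg / 2) y = q + u' / 2 + u' / 2.
  by rewrite -addrA cE rmorphD mulrDl eu addrA.
have b2E : corner x (y + sg / 2 + sg / 2) = q + v' / 2 + v' / 2.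
  by rewrite -addrA cE' rmorphD mulrDl ev addrA.
have b3E : corner (x + sg / 2 + - sg / 2) (y + sg / 2) = q + u' / 2 + v' / 2 + - u' / 2.
  by rewrite -addrA cE2 rmorphD mulrDl eu ev euN; ring.
have b4E : corner (x + sg / 2) (y + sg / 2 + - sg / 2) = q + u' / 2 + v' / 2 + - v' / 2.
  by rewrite -addrA cE2 rmorphD mulrDl eu ev evN; ring.
have b5E : corner (x + sg / 2) (y + sg / 2) = q + u' / 2 + v' / 2 by rewrite cE2 eu ev.
have b6E : corner (x + sg / 2) y = q + u' / 2 by rewrite cE eu.
have b7E : corner x (y + sg / 2) = q + v' / 2 by rewrite cE' ev.
rewrite b1E b2E b3E b4E b5E b6E b7E => b0 b1 b2 b3.
rewrite cE cE' (_ : e = e / 4 + e / 4 + e / 4 + e / 4); last by lra.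
apply: eventually_small_split => //.
by rewrite (_ : q + v' / 2 + u' / 2 = q + u' / 2 + v' / 2)//; ring.
Qed.

Lemma goursat : (forall z, in_triangle p u v z -> complex_diff h z) ->
  forall e, 0 < e -> eventually_small e p (p + u) (p + v).
Proof.
move=> hd e e0; apply: contrapT => b0.
pose st k := iter k next ((0, 0, 1, e) : state).
have st_bad k : ~ good (st k).
  elim: k => [|k IH] /=; last exact: bad_next.
  rewrite /good /= /corner !add0r !(rmorph0, rmorph1) !mul0r !mul1r !addr0.
  exact: b0.
pose X k := (st k).1.1.1; pose Y k := (st k).1.1.2; pose S k := (st k).1.2.
have eS k : (st k).2 = e / 4 ^+ k.
  elim: k => [|k IH] /=; first by rewrite expr0 divr1.
  rewrite exprSr invfM mulrA -IH; by case: (nextP (st k)) => ->; case: (st k) => [[[? ?] ?] ?].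
have sS k : `|S k| = 2^-1 ^+ k.
  rewrite /S; elim: k => [|k IH] /=; first by rewrite expr0 normr1.
  by rewrite exprSr -IH; case: (nextP (st k)) => ->;
    case: (st k) => [[[? ?] sg] ?] /=; rewrite normrM ?normrN [`|2^-1|]gtr0_norm.
(* All three vertices keep their coordinates in the unit simplex, whatever the sign of [S k]. *)
have inv k : [/\ 0 <= X k, 0 <= Y k, X k + Y k <= 1 &
    [/\ 0 <= X k + S k, 0 <= Y k + S k & X k + Y k + S k <= 1] ].
  rewrite /X /Y /S; elim: k => [|k] /=; [by split; [lra|lra|lra|split; lra]|].
  case: (nextP (st k)) => ->; case: (st k) => [[[x y] sg] e'] /= [? ? ? [? ? ?]];
    (split; [lra|lra|lra|split; lra]).
have half_le k : 2^-1 ^+ k / 2 <= 2^-1 ^+ k :> R.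
  by rewrite ler_pdivrMr// ler_peMr ?exprn_ge0//; lra.
have h0 k : 0 <= 2^-1 ^+ k :> R by rewrite exprn_ge0.
have cX k : `|X k.+1 - X k| <= 2^-1 ^+ k.
  rewrite (le_trans _ (half_le k))// -sS /X /S /=.
  case: (nextP (st k)) => ->; case: (st k) => [[[x y] sg] e'] /=;
    rewrite ?subrr ?normr0 ?divr_ge0 ?normr_ge0// [x + _]addrC addrK normrM;
    by rewrite [`|2^-1|]gtr0_norm.
have cY k : `|Y k.+1 - Y k| <= 2^-1 ^+ k.
  rewrite (le_trans _ (half_le k))// -sS /Y /S /=.
  case: (nextP (st k)) => ->; case: (st k) => [[[x y] sg] e'] /=;
    rewrite ?subrr ?normr0 ?divr_ge0 ?normr_ge0// [y + _]addrC addrK normrM;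
    by rewrite [`|2^-1|]gtr0_norm.
have [x hx] := geometric_cauchy_limit cX.
have [y hy] := geometric_cauchy_limit cY.
have appr (d : R) : 0 < d -> exists k, 2 * 2^-1 ^+ k <= d.
  move=> d0; have [k hk] : exists k, 2^-1 ^+ k < d / 2 by apply: half_exp_lt; lra.
  by exists k; lra.
have x0 : 0 <= x.
  apply: eps_le => d /appr[k hk]; have [? _ _ _] := inv k.
  by have := hx k; rewrite ler_norml => /andP[]; lra.
have y0 : 0 <= y.
  apply: eps_le => d /appr[k hk]; have [_ ? _ _] := inv k.
  by have := hy k; rewrite ler_norml => /andP[]; lra.
have xy1 : x + y <= 1.
  apply: eps_le => d d0; have /appr[k hk] : 0 < d / 2 by lra.
  have [_ _ ? _] := inv k.
  have := hx k; have := hy k; rewrite !ler_norml => /andP[? ?] /andP[? ?]; lra.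
pose z := corner x y.
have [|d zd] := hd z; first by exists x, y.
pose A := cabs u + cabs v + 1.
have A0 : 0 < A by rewrite /A; have := cabs_ge0 u; have := cabs_ge0 v; lra.
(* The size 2^-k of the triangle and the distance 2 * 2^-k from its corner to the limit give the
   factor 3. *)
have near k x' y' : `|x' - X k| <= `|S k| -> `|y' - Y k| <= `|S k| ->
    cabs (corner x' y' - z) <= 3 * A * 2^-1 ^+ k.
  rewrite sS => hx' hy'.
  have -> : corner x' y' - z = (x' - x)%:C%C * u + (y' - y)%:C%C * v.
    by rewrite /z /corner !rmorphB /=; ring.
  rewrite (le_trans (cabsD _ _))// !cabsM !cabs_real.
  have bx : `|x' - x| <= 3 * 2^-1 ^+ k.
    by rewrite (le_trans (ler_distD (X k) _ _))//; have := hx k; lra.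
  have by' : `|y' - y| <= 3 * 2^-1 ^+ k.
    by rewrite (le_trans (ler_distD (Y k) _ _))//; have := hy k; lra.
  have := ler_wpM2r (cabs_ge0 u) bx; have := ler_wpM2r (cabs_ge0 v) by'.
  by have := h0 k; rewrite /A => ? ? ?; nra.
(* Radius 3 A 2^-k times perimeter 2 A 2^-k times [eta / 2^-k] scaled by the affine error gives 6
   eta A^2 / 4^k in all; with 20 this is below the bound e / 4^k that the k-th triangle violates. *)
pose eta := e / (20 * A ^+ 2).
have eta0 : 0 < eta by rewrite divr_gt0// mulr_gt0// exprn_gt0.
have [del del0 hdel] := zd _ eta0.
have [k hk] : exists k, 2^-1 ^+ k < del / (3 * A).
  by apply: half_exp_lt; rewrite divr_gt0// mulr_gt0.
rewrite ltr_pdivlMr ?mulr_gt0// mulrC in hk.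
set r := 3 * A * 2^-1 ^+ k in hk.
have r0 : 0 <= r by rewrite mulr_ge0// mulr_ge0// ltW.
have aff w : cabs (w - z) <= r -> cabs (h w - (h z + d * (w - z))) <= eta * r.
  move=> hw; have := hdel (w - z) (le_lt_trans hw hk).
  rewrite [z + _]addrC subrK -addrA -opprD => hwz.
  by apply: (le_trans hwz); rewrite ler_wpM2l// ltW.
have := st_bad k; rewrite /good; move: (sS k) (near k) (eS k); rewrite /X /Y /S.
case: (st k) => [[[x' y'] sg] e'] /= sgE nr e'E; apply; exists 0%N => n _.
have e1 : cabs (corner (x' + sg) y' - corner x' y') = `|sg| * cabs u.
  by rewrite -cabs_real -cabsM; congr cabs; rewrite /corner rmorphD /=; ring.
have e2 : cabs (corner x' y' - corner x' (y' + sg)) = `|sg| * cabs v.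
  by rewrite -cabs_real -cabsM -cabsN; congr cabs; rewrite /corner rmorphD /=; ring.
have e3 : cabs (corner x' (y' + sg) - corner (x' + sg) y') <= `|sg| * (cabs u + cabs v).
  have -> : corner x' (y' + sg) - corner (x' + sg) y' = sg%:C%C * (v - u).
    by rewrite /corner !rmorphD /=; ring.
  by rewrite cabsM cabs_real ler_wpM2l// [cabs u + _]addrC cabsB.
have adds t : t + sg - t = sg by rewrite addrC addKr.
have := triangle_affine n aff (nr x' y' _ _) (nr (x' + sg) y' _ _) (nr x' (y' + sg) _ _).
rewrite !adds !subrr normr0 => /(_ (normr_ge0 _) (normr_ge0 _) (lexx _) (normr_ge0 _)
  (normr_ge0 _) (lexx _)) /le_trans; apply.
rewrite e'E.
have -> : e / 4 ^+ k = e * (2^-1 ^+ k) ^+ 2.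
  by congr (_ * _); rewrite exprAC -exprVn; congr (_ ^+ _); field.
apply: (@le_trans _ _ (eta * r * (2 * A * 2^-1 ^+ k))).
  rewrite ler_wpM2l//; [by apply: mulr_ge0 => //; exact: ltW|].
  move: e3; rewrite e1 e2 sgE /A => e3; have := h0 k; nra.
rewrite /eta /r.
have -> : e / (20 * A ^+ 2) * (3 * A * 2^-1 ^+ k) * (2 * A * 2^-1 ^+ k) =
  6 / 20 * (e * 2^-1 ^+ k ^+ 2) by field; rewrite gt_eqF.
by rewrite ler_piMl ?mulr_ge0 ?exprn_ge0 ?(ltW e0)//; lra.
Qed.

End Bisection.
End Goursat.

(** * Rules for complex derivatives *)

Section Calculus.
Context {R : realType}.
Local Notation C := R[i].
Implicit Types (g : C -> C) (z w c d : C).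

Lemma cderiv_lipschitz g z d : complex_derivative g z d ->
  exists2 del : R, 0 < del & forall h, cabs h < del ->
    cabs (g (z + h) - g z) <= (cabs d + 1) * cabs h.
Proof.
move=> /(_ 1 ltr01)[del del0 hdel]; exists del => // h /hdel hh.
have -> : g (z + h) - g z = (g (z + h) - g z - d * h) + d * h by ring.
by rewrite (le_trans (cabsD _ _))// cabsM mulrDl addrC lerD2l.
Qed.

Lemma cdiff_continuous g z : complex_diff g z -> forall e : R, 0 < e ->
  exists2 del : R, 0 < del & forall h, cabs h < del -> cabs (g (z + h) - g z) <= e.
Proof.
move=> [d /cderiv_lipschitz[del del0 hdel]] e e0.
have K0 : 0 < cabs d + 1 by have := cabs_ge0 d; lra.
exists (Num.min del (e / (cabs d + 1))); first by rewrite lt_min del0 divr_gt0.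
move=> h; rewrite lt_min => /andP[/hdel hh].
by rewrite ltr_pdivlMr// mulrC => /ltW; exact: le_trans.
Qed.

Lemma cderiv_unique g z d d' :
  complex_derivative g z d -> complex_derivative g z d' -> d = d'.
Proof.
move=> hd hd'; apply/eqP; rewrite -subr_eq0 -cabs_eq0 eq_le cabs_ge0 andbT.
apply: eps_le => e e0; rewrite add0r.
have [|d1 d10 h1] := hd (e / 2); first by rewrite divr_gt0.
have [|d2 d20 h2] := hd' (e / 2); first by rewrite divr_gt0.
pose t := Num.min d1 d2 / 2.
have m0 : 0 < Num.min d1 d2 by rewrite lt_min d10.
have t0 : 0 < t by rewrite divr_gt0.
have tm : t < Num.min d1 d2 by rewrite /t; lra.
have ct : cabs t%:C%C = t by rewrite cabs_real gtr0_norm.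
have {}h1 := h1 t%:C%C; have {}h2 := h2 t%:C%C.
rewrite ct in h1 h2; move: tm; rewrite lt_min => /andP[/h1 {}h1 /h2 {}h2].
rewrite -(ler_pM2r t0) -[t in X in X <= _]ct -cabsM.
have -> : (d - d') * t%:C%C = (g (z + t%:C%C) - g z - d' * t%:C%C)
  - (g (z + t%:C%C) - g z - d * t%:C%C) by ring.
by rewrite (le_trans (cabsB _ _))//; lra.
Qed.

Lemma cderiv_cst c z : complex_derivative (fun=> c) z 0.
Proof.
by move=> e e0; exists 1 => // h _; rewrite subrr mul0r subr0 cabs0 mulr_ge0 ?cabs_ge0 ?ltW.
Qed.

Lemma cderivD g1 g2 z d1 d2 :
  complex_derivative g1 z d1 -> complex_derivative g2 z d2 ->
  complex_derivative (fun w => g1 w + g2 w) z (d1 + d2).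
Proof.
move=> h1 h2 e e0.
have [|a1 a10 {}h1] := h1 (e / 2); first by rewrite divr_gt0.
have [|a2 a20 {}h2] := h2 (e / 2); first by rewrite divr_gt0.
exists (Num.min a1 a2); first by rewrite lt_min a10.
move=> h; rewrite lt_min => /andP[/h1 {}h1 /h2 {}h2].
have -> : g1 (z + h) + g2 (z + h) - (g1 z + g2 z) - (d1 + d2) * h =
  (g1 (z + h) - g1 z - d1 * h) + (g2 (z + h) - g2 z - d2 * h) by ring.
by rewrite (le_trans (cabsD _ _))//; lra.
Qed.

Lemma cderivM g1 g2 z d1 d2 :
  complex_derivative g1 z d1 -> complex_derivative g2 z d2 ->
  complex_derivative (fun w => g1 w * g2 w) z (d1 * g2 z + g1 z * d2).
Proof.
move=> h1 h2 e e0.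
(* [A] dominates all moduli that occur, so each of the three terms below is at most a third of
   [e * cabs h]. *)
pose A := cabs (g2 z) + cabs (g1 z) + cabs d1 + 1.
have A1 : 1 <= A.
  by rewrite /A; have := cabs_ge0 (g2 z); have := cabs_ge0 (g1 z); have := cabs_ge0 d1; lra.
have A0 : 0 < A by lra.
have ea0 : 0 < e / (3 * A) by rewrite divr_gt0// mulr_gt0.
have [a1 a10 k1] := h1 _ ea0; have [a2 a20 k2] := h2 _ ea0.
have [|a3 a30 k3] := cdiff_continuous (ex_intro _ d2 h2) (e := Num.min 1 (e / (3 * A))).
  by rewrite lt_min ltr01.
exists (Num.min a1 (Num.min a2 a3)); first by rewrite !lt_min a10 a20.
move=> h; rewrite !lt_min => /and3P[/k1 {}k1 /k2 {}k2 /k3].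
rewrite le_min => /andP[{}k3 k4].
have -> : g1 (z + h) * g2 (z + h) - g1 z * g2 z - (d1 * g2 z + g1 z * d2) * h =
  (g1 (z + h) - g1 z - d1 * h) * g2 (z + h) + d1 * h * (g2 (z + h) - g2 z)
  + g1 z * (g2 (z + h) - g2 z - d2 * h) by ring.
have g2A : cabs (g2 (z + h)) <= A.
  have -> : g2 (z + h) = (g2 (z + h) - g2 z) + g2 z by ring.
  rewrite (le_trans (cabsD _ _))// /A; have := cabs_ge0 (g1 z); have := cabs_ge0 d1; lra.
have d1A : cabs d1 <= A.
  by rewrite /A; have := cabs_ge0 (g2 z); have := cabs_ge0 (g1 z); lra.
have g1A : cabs (g1 z) <= A.
  by rewrite /A; have := cabs_ge0 (g2 z); have := cabs_ge0 d1; lra.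
set E := e / (3 * A) in ea0 k1 k2 k4 *.
have AE : A * E = e / 3 by rewrite /E; field; rewrite gt_eqF.
have hh := cabs_ge0 h.
apply: (@le_trans _ _ (E * cabs h * A + A * cabs h * E + A * (E * cabs h))); last first.
  have -> : E * cabs h * A + A * cabs h * E + A * (E * cabs h) = 3 * (A * E) * cabs h by ring.
  by rewrite AE; lra.
apply: (le_trans (cabsD _ _)); apply: lerD; last first.
  by rewrite cabsM ler_pM ?cabs_ge0.
apply: (le_trans (cabsD _ _)); apply: lerD.
  by rewrite cabsM ler_pM ?cabs_ge0.
by rewrite !cabsM ler_pM ?mulr_ge0 ?cabs_ge0// ler_wpM2r.
Qed.

Lemma cderiv_affine c d g z e : complex_derivative g (c + d * z) e ->
  complex_derivative (fun w => g (c + d * w)) z (e * d).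
Proof.
move=> hg eps eps0.
have K0 : 0 < cabs d + 1 by have := cabs_ge0 d; lra.
have [|del del0 hdel] := hg (eps / (cabs d + 1)); first by rewrite divr_gt0.
exists (del / (cabs d + 1)); first by rewrite divr_gt0.
move=> h hh; have dh : cabs (d * h) <= (cabs d + 1) * cabs h.
  by rewrite cabsM ler_wpM2r ?cabs_ge0//; lra.
rewrite mulrDr addrA -mulrA.
rewrite ltr_pdivlMr// mulrC in hh.
apply: (le_trans (hdel _ (le_lt_trans dh hh))).
by rewrite -mulrA ler_pM2l// [_^-1 * _]mulrC ler_pdivrMr// [cabs h * _]mulrC.
Qed.

Lemma cderiv_inv z w : z != w ->
  complex_derivative (fun t => (t - w)^-1) z (- (z - w) ^- 2).
Proof.
move=> zw e e0; have zw0 : z - w != 0 by rewrite subr_eq0.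
pose r := cabs (z - w); have r0 : 0 < r by rewrite cabs_gt0.
(* [r / 2] keeps [z + h - w] away from 0; the other bound comes from the exact remainder, whose
   denominator is then at least [r ^+ 3 / 2]. *)
exists (Num.min (r / 2) (e * r ^+ 3 / 2)).
  by rewrite lt_min !divr_gt0 ?mulr_gt0// exprn_gt0.
move=> h; rewrite lt_min => /andP[h1 h2].
have rh : r / 2 <= cabs (z + h - w).
  have := cabsBr (z - w) (- h); rewrite cabsN opprK -/r.
  have -> : z - w + h = z + h - w by ring.
  by move=> ?; lra.
have rh0 : 0 < cabs (z + h - w) by rewrite (lt_le_trans _ rh)// divr_gt0.
have zhw0 : z + h - w != 0 by rewrite -cabs_gt0.
have -> : (z + h - w)^-1 - (z - w)^-1 - - (z - w) ^- 2 * h =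
  h * h / ((z - w) ^+ 2 * (z + h - w)) by field; rewrite zhw0 zw0.
rewrite !cabsM cabsV cabsM cabsX -/r ler_pdivrMr ?mulr_gt0 ?exprn_gt0//.
rewrite mulrAC; apply: ler_wpM2r; first exact: cabs_ge0.
apply: (le_trans (ltW h2)).
have -> : e * r ^+ 3 / 2 = e * (r ^+ 2 * (r / 2)) by field.
by rewrite ler_pM2l// ler_pM2l ?exprn_gt0.
Qed.

Lemma cdiff_prod (I : Type) (s : seq I) (G : I -> C -> C) z :
  (forall i, complex_diff (G i) z) -> complex_diff (fun w => \prod_(i <- s) G i w) z.
Proof.
move=> hG; elim: s => [|i s [d hd]].
  exists 0 => e /(cderiv_cst 1 z)[del del0 hdel]; exists del => // h /hdel.
  by rewrite !big_nil.
have [d' hd'] := hG i; exists (d' * \prod_(i <- s) G i z + G i z * d).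
move=> e /(cderivM hd' hd)[del del0 hdel]; exists del => // h /hdel.
by rewrite !big_cons.
Qed.

End Calculus.

(** * Compactness of closed discs *)

Section DiscCompactness.
Context {R : realType}.
Local Notation C := R[i].

(** A Lebesgue number argument: compactness of a square is applied to the filter of [del] tending to
    0 from the right. *)
Lemma disc_compact (r : R) (Q : C -> R -> Prop) :
  (forall z (del del' : R), 0 < del' -> del' <= del -> Q z del -> Q z del') ->
  (forall z, cabs z <= r -> exists2 del : R, 0 < del &
     forall z', cabs (z' - z) < del -> cabs z' <= r -> Q z' del) ->
  exists2 del : R, 0 < del & forall z, cabs z <= r -> Q z del.
Proof.
move=> Qmono Qloc.
pose toC (p : R * R) : C := Complex p.1 p.2.
pose K : set (R * R) := [set` `[- r, r]%R] `*` [set` `[- r, r]%R].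
have /compact_near_coveringP cK : compact K.
  by apply: compact_setX; exact: segment_compact.
have [p Kp|] := cK R (0^'+)%R (fun del p => cabs (toC p) <= r -> Q (toC p) del) _.
  have [del del0 hdel] : exists2 del : R, 0 < del &
     forall z', cabs (z' - toC p) < del -> cabs z' <= r -> Q z' del.
    have [pr|pr] := leP (cabs (toC p)) r; first exact: Qloc.
    (* At a point outside the disc, a neighbourhood that misses the disc makes the claim vacuous. *)
    exists (cabs (toC p) - r); first by rewrite subr_gt0.
    move=> z' h1 h2; exfalso.
    by have := cabs_tri (toC p) z' 0; rewrite !subr0 cabsC; lra.
  exists (ball p (del / 2), [set d : R | 0 < d <= del]).
    split; first by apply: nbhsx_ballx; rewrite divr_gt0.
    near=> d; rewrite /=; apply/andP; split; first by near: d; exact: nbhs_right_gt.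
    by near: d; exact: nbhs_right_le.
  move=> [q d] /= [[q1 q2] /andP[d0 dd]] qr.
  apply: Qmono d0 dd _; apply: hdel => //.
  apply: (le_lt_trans (cabs_le_ReIm _)).
  by move: q1 q2; rewrite /ball /= -![`|_ - q.1|]distrC -![`|_ - q.2|]distrC; lra.
move=> e /= e0 He; exists (e / 2); first by rewrite divr_gt0.
move=> z zr; case: z zr => a b ab; have := He (e / 2); rewrite /ball_ /= sub0r normrN.
rewrite gtr0_norm ?divr_gt0// => /(_ _ _ (a, b)); apply => //=; first by lra.
split => /=; rewrite in_itv /= -ler_norml.
- exact: le_trans (Re_le_cabs (Complex a b)) ab.
- exact: le_trans (Im_le_cabs (Complex a b)) ab.
Unshelve. all: by end_near. Qed.

(** For the property [cabs (g z) <= del^-1], a uniform [del] is a uniform bound. *)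
Lemma disc_bounded (r : R) (g : C -> C) :
  (forall z, cabs z <= r -> complex_diff g z) ->
  exists2 M : R, 0 < M & forall z, cabs z <= r -> cabs (g z) <= M.
Proof.
move=> hg; have [||del del0 hdel] := @disc_compact r (fun z del => cabs (g z) <= del^-1).
- by move=> z d d' d'0 dd /le_trans; apply; rewrite lef_pV2 ?posrE// (lt_le_trans d'0).
- move=> z /hg /cdiff_continuous /(_ 1 ltr01)[del del0 hdel].
  have K0 : 0 < cabs (g z) + 1 by have := cabs_ge0 (g z); lra.
  exists (Num.min del (cabs (g z) + 1)^-1); first by rewrite lt_min del0 invr_gt0.
  move=> z'; rewrite lt_min => /andP[/hdel]; rewrite [z + _]addrC subrK => h _ _.
  apply: (@le_trans _ _ (cabs (g z) + 1)).
    have -> : g z' = (g z' - g z) + g z by ring.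
    by rewrite (le_trans (cabsD _ _))//; lra.
  by rewrite -[X in X <= _]invrK lef_pV2 ?posrE ?lt_min ?del0 ?invr_gt0// ge_min lexx orbT.
- by exists del^-1 => //; rewrite invr_gt0.
Qed.

(* The annulus r' <= |z| <= r is used to stay away from an exceptional point. *)
Lemma annulus_uniformly_continuous (r' r : R) (g : C -> C) :
  (forall z, r' <= cabs z <= r -> complex_diff g z) ->
  forall e : R, 0 < e -> exists2 del : R, 0 < del & forall z z',
    r' <= cabs z <= r -> cabs (z' - z) < del -> cabs (g z' - g z) <= e.
Proof.
move=> hg e e0.
have [||del del0 hdel] := @disc_compact r (fun z del => r' <= cabs z ->
  forall z', cabs (z' - z) < del -> cabs (g z' - g z) <= e).
- by move=> z d d' d'0 dd h r'z z' z'z; apply: h => //; exact: lt_le_trans dd.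
- move=> z zr; have [r'z|r'z] := leP r' (cabs z); last first.
    exists (r' - cabs z); first by rewrite subr_gt0.
    move=> z' h _ h'; exfalso.
    by have := cabsBr z' z; lra.
  have [||del del0 hdel] := @cdiff_continuous _ g z _ (e / 2).
  + by apply: hg; rewrite r'z.
  + by rewrite divr_gt0.
  exists (del / 2); first by rewrite divr_gt0.
  move=> z' h1 _ _ z'' h2.
  have g1 : cabs (g z' - g z) <= e / 2.
    by have := hdel (z' - z); rewrite [z + _]addrC subrK; apply; lra.
  have g2 : cabs (g z'' - g z) <= e / 2.
    have := hdel (z'' - z); rewrite [z + _]addrC subrK; apply.
    by have := cabs_tri z'' z' z; lra.
  by have := cabs_tri (g z'') (g z) (g z'); rewrite (cabsC (g z)); lra.
- by exists del => // z z' /andP[z1 z2] h; exact: hdel.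
Qed.

End DiscCompactness.

(** * Goursat's theorem with an exceptional vertex *)

Section GoursatVertex.
Context {R : realType}.
Local Notation C := R[i].
Variable h : C -> C.

Lemma eventually_small_le (e e' : R) a b c :
  e <= e' -> eventually_small h e a b c -> eventually_small h e' a b c.
Proof. by move=> ee' [n0 H]; exists n0 => n /H /le_trans; apply. Qed.

(* At the vertex w itself h is only assumed to be bounded. *)
Lemma goursat_vertex (w u v : C) (M del : R) : 0 < del ->
  (forall x y : R, 0 <= x -> 0 <= y -> 0 < x + y -> x + y <= 1 ->
     complex_diff h (w + x%:C%C * u + y%:C%C * v)) ->
  (forall z, cabs (z - w) <= del -> cabs (h z) <= M) ->
  forall e, 0 < e -> eventually_small h e w (w + u) (w + v).
Proof.
move=> del0 hd hM.
pose T e (s : R) := eventually_small h e w (w + s%:C%C * u) (w + s%:C%C * v).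
(* Of the four quarters of the triangle of scale [s] only one contains [w]; [goursat] handles the
   other three at an arbitrarily small cost. *)
have step e1 (s : R) : 0 < s -> s <= 1 -> T e1 (s / 2) ->
    forall e, 0 < e -> T (e1 + e) s.
  move=> s0 s1 T1 e e0.
  rewrite /T (_ : e1 + e = e1 + e / 3 + e / 3 + e / 3); last by field.
  have e3 : 0 < e / 3 by rewrite divr_gt0.
  have sE : (s / 2)%:C%C = s%:C%C / 2 by rewrite rmorphM fmorphV rmorph_nat.
  have cE' (t : C) : s%:C%C * t / 2 = (s / 2)%:C%C * t by rewrite sE; field.
  apply: eventually_small_split.
  - by rewrite !cE'.
  - apply: goursat => // z [x [y [x0 y0 xy ->]]].
    have -> : w + s%:C%C * u / 2 + x%:C%C * (s%:C%C * u / 2) + y%:C%C * (s%:C%C * v / 2) =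
        w + ((1 + x) * (s / 2))%:C%C * u + (y * (s / 2))%:C%C * v.
      by rewrite !rmorphM !rmorphD !fmorphV !rmorph_nat rmorph1 /=; field.
    by apply: hd; nra.
  - apply: goursat => // z [x [y [x0 y0 xy ->]]].
    have -> : w + s%:C%C * v / 2 + x%:C%C * (s%:C%C * u / 2) + y%:C%C * (s%:C%C * v / 2) =
        w + (x * (s / 2))%:C%C * u + ((1 + y) * (s / 2))%:C%C * v.
      by rewrite !rmorphM !rmorphD !fmorphV !rmorph_nat rmorph1 /=; field.
    by apply: hd; nra.
  - apply: goursat => // z [x [y [x0 y0 xy ->]]].
    have -> : w + s%:C%C * u / 2 + s%:C%C * v / 2 +
        x%:C%C * (- (s%:C%C * u) / 2) + y%:C%C * (- (s%:C%C * v) / 2) =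
        w + ((1 - x) * (s / 2))%:C%C * u + ((1 - y) * (s / 2))%:C%C * v.
      by rewrite !rmorphM !rmorphB !fmorphV !rmorph_nat rmorph1 /=; field.
    by apply: hd; nra.
have h0 k : 0 < 2^-1 ^+ k :> R by rewrite exprn_gt0.
have h1 k : 2^-1 ^+ k <= 1 :> R by rewrite exprn_ile1//; lra.
(* From scale 2^-k back to scale 1 the costs are e / 2, e / 4 and so on, hence at most [e] in
   all. *)
have climb k : forall e1, T e1 (2^-1 ^+ k) -> forall e, 0 < e -> T (e1 + e) 1.
  elim: k => [|k IH] e1.
    by rewrite expr0 => T1 e e0; apply: eventually_small_le T1; lra.
  rewrite exprSr => /step H e e0; have e2 : 0 < e / 2 by rewrite divr_gt0.
  rewrite (_ : e1 + e = e1 + e / 2 + e / 2); last by field.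
  by apply: IH => //; apply: H.
move=> e e0.
pose A := cabs u + cabs v + 1.
have A0 : 0 < A by rewrite /A; have := cabs_ge0 u; have := cabs_ge0 v; lra.
have M0 : 0 <= M.
  by apply: le_trans (hM w _); rewrite ?cabs_ge0// subrr cabs0 ltW.
(* The first bound puts the triangle into the disc where [h] is bounded, the second makes [M] times
   its perimeter at most [e / 2]. *)
have [k hk] : exists k, 2^-1 ^+ k < Num.min (del / A) (e / (4 * A * (M + 1))).
  apply: half_exp_lt; rewrite lt_min !divr_gt0//= !mulr_gt0//; lra.
move: hk; rewrite lt_min !ltr_pdivlMr ?mulr_gt0//; last by lra.
move=> /andP[k1 k2].
set s := 2^-1 ^+ k in k1 k2; have s0 : 0 < s by exact: h0.
have aff z : cabs (z - w) <= del -> cabs (h z - (0 + 0 * (z - w))) <= M.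
  by move=> /hM; rewrite mul0r addr0 subr0.
have Tk : T (e / 2) s.
  exists 0%N => n _.
  have bu : cabs (w + s%:C%C * u - w) = s * cabs u.
    by rewrite addrAC subrr add0r cabsM cabs_real gtr0_norm.
  have bv : cabs (w + s%:C%C * v - w) = s * cabs v.
    by rewrite addrAC subrr add0r cabsM cabs_real gtr0_norm.
  have bvu : cabs (w + s%:C%C * v - (w + s%:C%C * u)) <= s * (cabs u + cabs v).
    have -> : w + s%:C%C * v - (w + s%:C%C * u) = s%:C%C * (v - u) by ring.
    by rewrite cabsM cabs_real gtr0_norm// ler_pM2l// [cabs u + _]addrC cabsB.
  have := cabs_ge0 u; have := cabs_ge0 v => v0 u0.
  apply: (le_trans (triangle_affine n aff _ _ _)).
  - by rewrite subrr cabs0 ltW.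
  - by rewrite bu; move: k1; rewrite /A; nra.
  - by rewrite bv; move: k1; rewrite /A; nra.
  rewrite bu (cabsC w) bv.
  apply: (@le_trans _ _ (M * (2 * s * A))).
    by rewrite ler_wpM2l//; move: bvu; rewrite /A; nra.
  by move: k2; nra.
have e2 : 0 < e / 2 by rewrite divr_gt0.
have := climb k (e / 2) Tk _ e2.
by rewrite -splitr /T rmorph1 !mul1r.
Qed.

End GoursatVertex.

(** * Roots of unity *)

Section RootsOfUnity.
Context {R : realType}.
Local Notation C := R[i].

Definition expi (t : R) : C := Complex (cos t) (sin t).
Definition rootu (N : nat) : C := expi (pi *+ 2 / N%:R).

Lemma expiD s t : expi (s + t) = expi s * expi t.
Proof.
rewrite /expi cosD sinD; apply/eqP; rewrite eq_complex /=; apply/andP.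
by split; apply/eqP; ring.
Qed.

Lemma expi0 : expi 0 = 1.
Proof. by rewrite /expi cos0 sin0. Qed.

Lemma expiX t n : expi t ^+ n = expi (t *+ n).
Proof. by elim: n => [|n IH]; rewrite ?expi0// exprS IH mulrS expiD. Qed.

Lemma cabs_expi t : cabs (expi t) = 1.
Proof. by rewrite /cabs /= cos2Dsin2 sqrtr1. Qed.

(** The half angle lies between 0 and pi, where the sine is positive, and cos t = 1 - 2 sin^2 (t /
    2). *)
Lemma expi_eq1 t : 0 < t < pi *+ 2 -> expi t != 1.
Proof.
move=> /andP[t0 t2]; apply/eqP => /(congr1 (@complex.Re R)) /= ct.
have : 0 < sin (t / 2) by apply: sin_gt0_pi; rewrite mulr2n in t2; apply/andP; split; lra.
have t2E : t / 2 *+ 2 = t by rewrite mulr2n -splitr.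
have := cos_mulr2n (t / 2); rewrite t2E ct cos2sin2 mulr2n.
by move=> h sp; have : 0 < sin (t / 2) ^+ 2 by [rewrite exprn_gt0]; lra.
Qed.

Lemma rootuX_eq1 N k : (0 < k < N)%N -> rootu N ^+ k != 1.
Proof.
move=> /andP[k0 kN]; rewrite expiX -[_ *+ k]mulr_natr; apply: expi_eq1.
have N0 : 0 < N%:R :> R by rewrite ltr0n (leq_trans _ kN).
rewrite mulrAC divr_gt0//=; last by rewrite mulr_gt0 ?ltr0n// mulrn_wgt0 ?pi_gt0.
by rewrite ltr_pdivrMr// ltr_pM2l ?ltr_nat// mulrn_wgt0// pi_gt0.
Qed.

Lemma rootuN1 N : (0 < N)%N -> rootu N ^+ N = 1.
Proof.
move=> N0; rewrite expiX -[_ *+ N]mulr_natr divfK ?pnatr_eq0 -?lt0n//.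
by rewrite /expi cos2pi sin2pi.
Qed.

Lemma cabs_rootu N : cabs (rootu N) = 1.
Proof. exact: cabs_expi. Qed.

Lemma cabs_rootuX N k : cabs (rootu N ^+ k) = 1.
Proof. by rewrite cabsX cabs_rootu expr1n. Qed.

(** The squared modulus of exp(it) - 1 is 2 (1 - cos t), so continuity of the cosine at 0
    suffices. *)
Lemma rootu_cvg (e : R) : 0 < e ->
  exists N0, forall N, (N0 <= N)%N -> cabs (rootu N - 1) < e.
Proof.
move=> e0.
have e20 : 0 < e ^+ 2 / 2 by rewrite divr_gt0// exprn_gt0.
have := @continuous_cos R 0; move/cvgrPdist_lt => /(_ _ e20).
move=> [del /= del0 hdel].
exists (Num.truncn (pi *+ 2 / del)).+1 => N hN.
have N0 : 0 < N%:R :> R by rewrite ltr0n (leq_trans _ hN).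
have : pi *+ 2 / N%:R < del.
  rewrite ltr_pdivrMr// [del * _]mulrC -ltr_pdivrMr//.
  by rewrite (lt_le_trans (truncnS_gt _))// ler_nat.
have p0 : 0 <= pi *+ 2 / N%:R :> R 
  by apply: divr_ge0; [apply: mulrn_wge0; exact: pi_ge0|exact: ltW].
move: (pi *+ 2 / N%:R) p0 (hdel (pi *+ 2 / N%:R)) => t t0.
rewrite /ball_ /= sub0r normrN ger0_norm// => /[swap] td /(_ td).
rewrite cos0 => ht; rewrite -(ltr_pXn2r (n := 2)) ?nnegrE ?cabs_ge0 ?(ltW e0)//.
have -> : cabs (Complex (cos t) (sin t) - 1) ^+ 2 = 2 * (1 - cos t).
  rewrite /cabs /= sqr_sqrtr ?addr_ge0 ?sqr_ge0// oppr0 addr0 sin2cos2; ring.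
by have := ler_norm (1 - cos t); lra.
Qed.

Lemma sum_root_eq0 (x : C) N : x ^+ N = 1 -> x != 1 -> \sum_(j < N) x ^+ j = 0.
Proof.
move=> xN x1; apply: (mulfI (x := x - 1)); first by rewrite subr_eq0.
by rewrite -subrX1 xN subrr mulr0.
Qed.

Lemma cabs_unit_pow (x : C) k : cabs x = 1 -> cabs (x ^+ k - 1) <= k%:R * cabs (x - 1).
Proof.
move=> x1; elim: k => [|k IH]; first by rewrite expr0 subrr cabs0 mul0r.
have -> : x ^+ k.+1 - 1 = x * (x ^+ k - 1) + (x - 1) by rewrite exprS; ring.
by rewrite (le_trans (cabsD _ _))// cabsM x1 mul1r -[k.+1%:R]natr1 mulrDl mul1r lerD2r.
Qed.

(* If x were closer to 1, the sum of its powers could not vanish. *)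
Lemma root_separation (x : C) N : (0 < N)%N -> cabs x = 1 -> x ^+ N = 1 -> x != 1 ->
  1 <= N%:R * cabs (x - 1).
Proof.
case: N => [//|N] _ ax xN x1.
have := sum_root_eq0 xN x1 => s0.
have : N.+1%:R = cabs (\sum_(j < N.+1) (1 - x ^+ j)).
  by rewrite sumrB s0 subr0 sumr_const card_ord cabs_nat.
move=> e1; have : N.+1%:R <= \sum_(j < N.+1) N.+1%:R * cabs (x - 1) :> R.
  rewrite {1}e1 (le_trans (cabs_sum _ _ _))//; apply: ler_sum => j _.
  rewrite cabsC (le_trans (cabs_unit_pow _ ax))// ler_wpM2r ?cabs_ge0// ler_nat.
  exact: ltnW.
by rewrite sumr_const card_ord -[X in _ <= X]mulr_natl ler_pMr ?ltr0n.
Qed.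

End RootsOfUnity.

(** * Cauchy's theorem on regular polygons *)

Section Polygon.
Context {R : realType}.
Local Notation C := R[i].
Variable h : C -> C.

Lemma eventually_all_lt (P : nat -> nat -> Prop) N :
  (forall j, (j < N)%N -> exists n0, forall n, (n0 <= n)%N -> P j n) ->
  exists n, forall j, (j < N)%N -> P j n.
Proof.
move=> H; suff [n0 Hn0] : exists n0, forall n, (n0 <= n)%N ->
    forall j, (j < N)%N -> P j n by exists n0; exact: Hn0.
elim: N H => [|N IH] H; first by exists 0%N.
have [|n1 h1] := IH; first by move=> j jN; apply: H; rewrite ltnS ltnW.
have [n2 h2] := H N (ltnSn N).
exists (maxn n1 n2) => n; rewrite geq_max => /andP[l1 l2] j.
rewrite ltnS leq_eqVlt => /orP[/eqP->|]; [exact: h2|exact: h1].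
Qed.

(* Up to the factor [rootu N - 1], the sum is a Riemann sum for the integral of h
   along the regular N-gon inscribed in the circle of radius rho. *)
Lemma polygon_sum (w : C) (rho del M eps : R) (N : nat) :
  (1 < N)%N -> 0 < rho -> 0 < del ->
  (forall z, cabs z <= rho -> z != w -> complex_diff h z) ->
  (forall z, cabs (z - w) <= del -> cabs (h z) <= M) ->
  rho * cabs (rootu N - 1 : C) < rho - cabs w ->
  (forall j z, cabs (z - rho%:C%C * rootu N ^+ j) <= rho * cabs (rootu N - 1 : C) ->
     cabs (h z - h (rho%:C%C * rootu N ^+ j)) <= eps) ->
  cabs (\sum_(j < N) rho%:C%C * rootu N ^+ j * h (rho%:C%C * rootu N ^+ j))
    <= N%:R * (rho * eps).
Proof.
move=> N1 rho0 del0 hd hM hw hosc.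
pose om : C := rootu N; pose p j : C := rho%:C%C * om ^+ j.
have cp j : cabs (p j) = rho.
  by rewrite cabsM cabs_rootuX mulr1 cabs_real gtr0_norm.
have pS j : p j.+1 - p j = p j * (om - 1) by rewrite /p exprS; ring.
have pN : p N = p 0%N by rewrite /p /om rootuN1 ?(ltn_trans _ N1)// expr0.
have {}hosc j z : cabs (z - p j) <= rho * cabs (om - 1) -> cabs (h z - h (p j)) <= eps.
  exact: hosc.
rewrite -/om in hw *.
rewrite -[leLHS]/(cabs (\sum_(j < N) p j * h (p j))).
have om1 : 0 < cabs (om - 1).
  by rewrite cabs_gt0 subr_eq0 -[om]expr1; apply: rootuX_eq1.
clearbody p om.
have cpS j : cabs (p j.+1 - p j) = rho * cabs (om - 1) by rewrite pS cabsM cp.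
have w_lt : cabs w < rho.
  by have : 0 <= rho * cabs (om - 1) by [rewrite mulr_ge0 ?cabs_ge0 ?ltW]; lra.
(* The polygon is cut into triangles with apex [w], the only point where [h] may fail to be
   differentiable. *)
have smallT j e : 0 < e -> eventually_small h e w (p j) (p j.+1).
  move=> e0; have := @goursat_vertex _ h w (p j - w) (p j.+1 - w) M del del0.
  rewrite ![w + _]addrC !subrK; apply => //.
  move=> x y x0 y0 xy0 xy1.
  have zE : p j - w + w = p j by rewrite subrK.
  apply: hd.
    have -> : w + x%:C%C * (p j - w) + y%:C%C * (p j.+1 - w) =
      (1 - x - y)%:C%C * w + x%:C%C * p j + y%:C%C * p j.+1.
      by rewrite !rmorphB rmorph1 /=; ring.
    apply: (le_trans (cabsD _ _)); apply: (le_trans (lerD (cabsD _ _) (lexx _))).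
    rewrite !cabsM !cp !cabs_real !ger0_norm//; last by lra.
    have : (1 - x - y) * cabs w <= (1 - x - y) * rho by rewrite ler_wpM2l ?(ltW w_lt)//; lra.
    by lra.
  (* The point differs from [w] because a side of the polygon is shorter than the distance
     [rho - cabs w] from [w] to the circle. *)
  rewrite -addrA addrC -subr_eq0 addrK -cabs_gt0.
  have -> : x%:C%C * (p j - w) + y%:C%C * (p j.+1 - w) =
    (x + y)%:C%C * (p j - w) - (- y%:C%C * (p j.+1 - p j)).
    by rewrite rmorphD /=; ring.
  apply: lt_le_trans (cabsBr _ _); rewrite subr_gt0 !cabsM cabsN !cabs_real cpS.
  rewrite !ger0_norm// ?addr_ge0//.
  have h1 := cabsBr (p j) w; rewrite cp in h1.
  apply: (@le_lt_trans _ _ ((x + y) * (rho * cabs (om - 1)))).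
    by rewrite ler_wpM2r ?mulr_ge0 ?cabs_ge0 ?(ltW rho0)//; lra.
  by rewrite ltr_pM2l// (lt_le_trans hw).
have N0 : 0 < N%:R :> R by rewrite ltr0n (ltn_trans _ N1).
have key e : 0 < e ->
    cabs (\sum_(j < N) h (p j) * (p j.+1 - p j)) <= N%:R * (eps * (rho * cabs (om - 1)) + e).
  move=> e0; have [n hn] := eventually_all_lt (N := N) (fun j _ => smallT j e e0).
  pose T := trapezoid h n.
  (* The spokes from [w] cancel in pairs, as [p N = p 0] closes the polygon. *)
  have tele : \sum_(j < N) triangle h n w (p j) (p j.+1) = \sum_(j < N) T (p j) (p j.+1).
    have E j : triangle h n w (p j) (p j.+1) =
        T (p j) (p j.+1) - (T w (p j.+1) - T w (p j)).
      by rewrite /triangle /T (trapezoid_sym h n w (p j.+1)); ring.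
    under eq_bigr do rewrite E.
    rewrite sumrB -[X in _ - X](big_mkord xpredT (fun j => T w (p j.+1) - T w (p j))).
    by rewrite telescope_sumr// pN subrr subr0.
  have -> : \sum_(j < N) h (p j) * (p j.+1 - p j) =
      \sum_(j < N) triangle h n w (p j) (p j.+1) -
      \sum_(j < N) (T (p j) (p j.+1) - h (p j) * (p j.+1 - p j)).
    by rewrite tele sumrB opprB addrC subrK.
  apply: (le_trans (cabsB _ _)); rewrite mulrDr addrC; apply: lerD.
    apply: (le_trans (cabs_sum _ _ _)).
    rewrite mulr_natl -[X in _ <= _ *+ X](card_ord N) -sumr_const; apply: ler_sum => j _.
    have aff z : cabs (z - p j) <= rho * cabs (om - 1) ->
        cabs (h z - (h (p j) + 0 * (z - p j))) <= eps.
      by move=> /hosc; rewrite mul0r addr0.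
    have := trapezoid_affine n aff (a := p j) (b := p j.+1).
    rewrite subrr cabs0 cpS mul0r mul0r addr0; apply => //.
    by rewrite mulr_ge0 ?cabs_ge0 ?ltW.
  apply: (le_trans (cabs_sum _ _ _)).
  rewrite mulr_natl -[X in _ <= _ *+ X](card_ord N) -sumr_const; apply: ler_sum => j _.
  exact: hn.
have {}key : cabs (\sum_(j < N) h (p j) * (p j.+1 - p j)) <=
    N%:R * (rho * eps) * cabs (om - 1).
  apply: eps_le => e e0; apply: (le_trans (key (e / N%:R) _)); first by rewrite divr_gt0.
  by rewrite mulrDr [N%:R * (_ / _)]mulrC divfK ?gt_eqF// lerD2r; lra.
(* Multiplication by [om - 1] turns the weights [p j] into the increments [p j.+1 - p j]. *)
rewrite -(ler_pM2r om1) -cabsM mulr_suml (le_trans _ key)//.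
under [in leRHS]eq_bigr do rewrite pS.
by rewrite le_eqVlt; apply/orP; left; apply/eqP; congr cabs; apply: eq_bigr => j _; ring.
Qed.

End Polygon.

(** * Cauchy's formula and Taylor expansion *)

Section CircleMean.
Context {R : realType}.
Local Notation C := R[i].
Implicit Types (phi psi : C -> C) (c : C).

(** An ultrafilter finer than the filter of cofinite tails: every bounded sequence has a limit along
    it. *)
Definition ultra : set_system nat :=
  projT1 (cid (ultraFilterLemma (eventually_filter))).

#[local] Instance ultra_ultra : UltraFilter ultra.
Proof. by rewrite /ultra; case: cid => U []. Qed.

Lemma ultra_eventually n0 : ultra [set n | (n0 <= n)%N].
Proof.
by rewrite /ultra; case: cid => U [? sub] /=; apply: sub; exists n0.
Qed.

Lemma ultra_real_limit (x : nat -> R) (M : R) : (forall n, `|x n| <= M) ->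
  exists l, forall e : R, 0 < e -> ultra [set n | `|x n - l| <= e].
Proof.
move=> xM; have cK : compact `[(- M), M]%classic by exact: segment_compact.
have [|l [_ cl]] := cK (x @ ultra) _.
  apply: (@filterS _ ultra _ setT _ _ filterT) => n _.
  by rewrite /= in_itv /= -ler_norml; exact: xM.
exists l => e e0.
(* Otherwise the ultrafilter contains the complement, where the sequence stays out of a ball around
   its cluster point. *)
have [//|nU] := in_ultra_setVsetC [set n | `|x n - l| <= e] ultra_ultra.
have /(_ (ball l e) nU)[|y []] := cl (~` [set y | `|y - l| <= e]).
  exact: nbhsx_ballx.
by rewrite /= /ball /= => h /ltW; rewrite distrC.
Qed.

Definition ultra_cvg (x : nat -> C) (l : C) :=
  forall e : R, 0 < e -> ultra [set n | cabs (x n - l) <= e].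

Lemma ultra_cvg_exists (x : nat -> C) (M : R) : (forall n, cabs (x n) <= M) ->
  exists l, ultra_cvg x l.
Proof.
move=> xM.
have [a ha] := ultra_real_limit (fun n => le_trans (Re_le_cabs (x n)) (xM n)).
have [b hb] := ultra_real_limit (fun n => le_trans (Im_le_cabs (x n)) (xM n)).
exists (Complex a b) => e e0.
have e2 : 0 < e / 2 by rewrite divr_gt0.
apply: filterS (filterI (ha _ e2) (hb _ e2)) => n [/= h1 h2].
rewrite (le_trans (cabs_le_ReIm _))//.
by case: (x n) h1 h2 => u v /=; lra.
Qed.

Lemma ultra_cvg_unique (x : nat -> C) l l' : ultra_cvg x l -> ultra_cvg x l' -> l = l'.
Proof.
move=> h1 h2.
apply/eqP; rewrite -subr_eq0 -cabs_eq0 eq_le cabs_ge0 andbT.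
apply: eps_le => e e0; have e2 : 0 < e / 2 by rewrite divr_gt0.
have [n [/= k1 k2]] := filter_ex (filterI (h1 _ e2) (h2 _ e2)).
by have := cabs_tri l (x n) l'; rewrite (cabsC l (x n)); lra.
Qed.

Definition ultralim (x : nat -> C) : C := xget 0 (ultra_cvg x).

Lemma ultralimP (x : nat -> C) (M : R) : (forall n, cabs (x n) <= M) ->
  ultra_cvg x (ultralim x).
Proof. by move=> /ultra_cvg_exists[l hl]; rewrite /ultralim; apply: (xgetPex 0); exists l. Qed.

Lemma ultralimE x l : ultra_cvg x l -> ultralim x = l.
Proof.
move=> xl; apply: (ultra_cvg_unique _ xl).
by rewrite /ultralim; apply: (xgetPex 0); exists l.
Qed.

Definition root_average (N : nat) (phi : C -> C) : C :=
  N%:R^-1 * \sum_(j < N) phi (rootu N ^+ j).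

(* An ultralimit of averages over roots of unity is a mean defined on all
   functions that are bounded on the unit circle, without any continuity. *)
Definition circle_mean (phi : C -> C) : C :=
  ultralim (fun N => root_average N.+1 phi).

Lemma root_average_le N phi (M : R) : 0 <= M ->
  (forall z, cabs z = 1 -> cabs (phi z) <= M) -> cabs (root_average N phi) <= M.
Proof.
move=> M0 hM; case: N => [|N]; first by rewrite /root_average big_ord0 mulr0 cabs0.
rewrite cabsM cabsV cabs_nat mulrC ler_pdivrMr ?ltr0n//.
rewrite (le_trans (cabs_sum _ _ _))//.
rewrite mulr_natr -[X in _ <= _ *+ X](card_ord N.+1) -sumr_const; apply: ler_sum => j _.
by rewrite hM// cabs_rootuX.
Qed.

Lemma circle_bound_ge0 phi (M : R) :
  (forall z, cabs z = 1 -> cabs (phi z) <= M) -> 0 <= M.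
Proof. by move=> h; exact: le_trans (cabs_ge0 _) (h 1 cabs1). Qed.

Lemma circle_meanP phi (M : R) : (forall z, cabs z = 1 -> cabs (phi z) <= M) ->
  ultra_cvg (fun N => root_average N.+1 phi) (circle_mean phi).
Proof.
move=> hM; apply: ultralimP => n.
exact: root_average_le (circle_bound_ge0 hM) hM.
Qed.

Lemma circle_mean_le phi (M : R) : (forall z, cabs z = 1 -> cabs (phi z) <= M) ->
  cabs (circle_mean phi) <= M.
Proof.
move=> hM; apply: eps_le => e e0.
have [n /= hn] := filter_ex (circle_meanP hM e0).
have := root_average_le n.+1 (circle_bound_ge0 hM) hM.
have := cabs_tri (circle_mean phi) (root_average n.+1 phi) 0.
by rewrite !subr0 (cabsC (circle_mean _)); lra.
Qed.

Lemma circle_meanD phi psi (M M' : R) :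
  (forall z, cabs z = 1 -> cabs (phi z) <= M) ->
  (forall z, cabs z = 1 -> cabs (psi z) <= M') ->
  circle_mean (fun z => phi z + psi z) = circle_mean phi + circle_mean psi.
Proof.
move=> h1 h2; apply: ultralimE => e e0.
have e2 : 0 < e / 2 by rewrite divr_gt0.
apply: filterS (filterI (circle_meanP h1 e2) (circle_meanP h2 e2)) => n [/= k1 k2].
have -> : root_average n.+1 (fun z => phi z + psi z) = 
  root_average n.+1 phi + root_average n.+1 psi.
  by rewrite /root_average big_split mulrDr.
set a := root_average _ _ in k1 *; set b := root_average _ _ in k2 *.
have -> : a + b - (circle_mean phi + circle_mean psi) =
  (a - circle_mean phi) + (b - circle_mean psi) by ring.
by rewrite (le_trans (cabsD _ _))//; lra.
Qed.

Lemma circle_meanZ c phi (M : R) :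
  (forall z, cabs z = 1 -> cabs (phi z) <= M) ->
  circle_mean (fun z => c * phi z) = c * circle_mean phi.
Proof.
move=> h1; apply: ultralimE => e e0.
have K0 : 0 < cabs c + 1 by have := cabs_ge0 c; lra.
have e2 : 0 < e / (cabs c + 1) by rewrite divr_gt0.
apply: filterS (circle_meanP h1 e2) => n /=; rewrite ler_pdivlMr//.
have -> : root_average n.+1 (fun z => c * phi z) = c * root_average n.+1 phi.
  by rewrite /root_average -mulr_sumr mulrCA.
rewrite -mulrBr cabsM; have := cabs_ge0 (root_average n.+1 phi - circle_mean phi).
by nra.
Qed.

Lemma circle_mean_cst c : circle_mean (fun=> c) = c.
Proof.
apply: ultralimE => e e0; apply: filterS filterT => n _ /=.
rewrite /root_average sumr_const card_ord -[c *+ _]mulr_natl mulKf ?pnatr_eq0//.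
by rewrite subrr cabs0 ltW.
Qed.

Lemma circle_mean_ext phi psi : (forall z, cabs z = 1 -> phi z = psi z) ->
  circle_mean phi = circle_mean psi.
Proof.
move=> h; congr ultralim; apply/funext => n; congr (_ * _).
by apply: eq_bigr => j _; rewrite h// cabs_rootuX.
Qed.

Lemma circle_mean_eq0 phi :
  (forall e : R, 0 < e -> exists n0, forall n, (n0 <= n)%N ->
     cabs (root_average n phi) <= e) -> circle_mean phi = 0.
Proof.
move=> h; apply: ultralimE => e /h[n0 hn].
by apply: filterS (ultra_eventually n0) => n /= nn; rewrite subr0 hn// ltnW.
Qed.

Lemma circle_mean_sum n (phi : nat -> C -> C) (M : nat -> R) :
  (forall k z, cabs z = 1 -> cabs (phi k z) <= M k) ->
  circle_mean (fun z => \sum_(k < n) phi k z) = \sum_(k < n) circle_mean (phi k).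
Proof.
move=> h; elim: n => [|n IH].
  rewrite big_ord0 -[RHS](circle_mean_cst 0).
  by apply: circle_mean_ext => z _; rewrite big_ord0.
rewrite big_ord_recr /= -IH -(@circle_meanD _ _ (\sum_(k < n) M k) (M n)).
- by apply: circle_mean_ext => z _; rewrite big_ord_recr.
- move=> z z1; rewrite (le_trans (cabs_sum _ _ _))//; apply: ler_sum => k _; exact: h.
- exact: h.
Qed.

(** For n > k the average over the n-th roots of unity is exactly 0, being a geometric sum of a
    nontrivial root. *)
Lemma circle_meanX k : (0 < k)%N -> circle_mean (fun z => z ^+ k) = 0.
Proof.
move=> k0; apply: circle_mean_eq0 => e e0; exists k.+1 => n kn.
rewrite /root_average (eq_bigr (fun j : 'I_n => (rootu n ^+ k) ^+ j)); last first.
  by move=> j _; rewrite exprAC.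
rewrite sum_root_eq0 ?mulr0 ?cabs0 ?ltW//.
  by rewrite exprAC rootuN1 ?expr1n// (leq_trans _ kn).
by rewrite rootuX_eq1// k0.
Qed.

Lemma circle_meanXV k : (0 < k)%N -> circle_mean (fun z => z ^- k) = 0.
Proof.
move=> k0; apply: circle_mean_eq0 => e e0; exists k.+1 => n kn.
rewrite /root_average (eq_bigr (fun j : 'I_n => (rootu n ^- k) ^+ j)); last first.
  by move=> j _; rewrite exprVn exprAC.
rewrite sum_root_eq0 ?mulr0 ?cabs0 ?ltW//.
  by rewrite exprVn exprAC rootuN1 ?expr1n ?invr1// (leq_trans _ kn).
by rewrite invr_eq1 rootuX_eq1// k0.
Qed.

End CircleMean.

Section Taylor.
Context {R : realType}.
Local Notation C := R[i].
Implicit Types (g phi : C -> C).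

(** Cauchy's coefficient: the integral of g(u) / u^(k+1) over the circle of radius [rho], divided by
    2 pi i, written as a mean. *)
Definition taylor_coef g (rho : R) (k : nat) : C :=
  circle_mean (fun z => g (rho%:C%C * z) * (rho%:C%C * z) ^- k).

Lemma cabs_circle (rho : R) (z : C) : 0 < rho -> cabs z = 1 -> cabs (rho%:C%C * z) = rho.
Proof. by move=> rho0 z1; rewrite cabsM z1 mulr1 cabs_real gtr0_norm. Qed.

Lemma taylor_coef_bound g (rho M : R) k : 0 < rho ->
  (forall z, cabs z = rho -> cabs (g z) <= M) ->
  cabs (taylor_coef g rho k) <= M * rho ^- k.
Proof.
move=> rho0 gM; apply: circle_mean_le => z z1.
rewrite cabsM cabsV cabsX cabs_circle// ler_wpM2r ?invr_ge0 ?exprn_ge0 ?(ltW rho0)//.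
by rewrite gM// cabs_circle.
Qed.

(** With u = rho z, the kernel u / (u - w) is the sum of (w / u)^k for k < n plus (w / u)^n u / (u -
    w). Finite additivity of the mean is enough for this finite identity. *)
Lemma cauchy_kernel_expansion g (rho M : R) (w : C) n : 0 < rho -> cabs w < rho ->
  (forall z, cabs z = rho -> cabs (g z) <= M) ->
  cabs (circle_mean (fun z => g (rho%:C%C * z) * (rho%:C%C * z / (rho%:C%C * z - w)))
        - \sum_(k < n) taylor_coef g rho k * w ^+ k)
    <= M * (cabs w / rho) ^+ n * (rho / (rho - cabs w)).
Proof.
move=> rho0 wr gM.
have rw0 : 0 < rho - cabs w by rewrite subr_gt0.
have u0 z : cabs z = 1 -> rho%:C%C * z != 0 by move=> z1; rewrite -cabs_gt0 cabs_circle.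
have uw z : cabs z = 1 -> rho - cabs w <= cabs (rho%:C%C * z - w).
  by move=> z1; rewrite -[rho in X in X <= _](cabs_circle rho0 z1) cabsBr.
have uw0 z : cabs z = 1 -> rho%:C%C * z - w != 0.
  by move=> z1; rewrite -cabs_gt0 (lt_le_trans _ (uw z z1)).
have M0 : 0 <= M by apply: le_trans (cabs_ge0 _) (gM rho%:C%C _); rewrite cabs_real gtr0_norm.
pose F k z := w ^+ k * (g (rho%:C%C * z) * (rho%:C%C * z) ^- k).
pose T z := g (rho%:C%C * z) * (w / (rho%:C%C * z)) ^+ n
  * (rho%:C%C * z / (rho%:C%C * z - w)).
have bT z : cabs z = 1 -> cabs (T z) <= M * (cabs w / rho) ^+ n * (rho / (rho - cabs w)).
  move=> z1; have := cabs_circle rho0 z1; have := uw z z1; rewrite /T.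
  move: (rho%:C%C * z) => u uw1 cu; rewrite !cabsM cabsX cabsM !cabsV cu.
  apply: ler_pM; [by nonneg|by nonneg| |].
  - by apply: ler_wpM2r; [nonneg|exact: gM].
  - by rewrite ler_pM2l// lef_pV2 ?posrE// (lt_le_trans rw0).
have bG k z : cabs z = 1 -> cabs (g (rho%:C%C * z) * (rho%:C%C * z) ^- k) <= M * rho ^- k.
  move=> z1; rewrite cabsM cabsV cabsX cabs_circle// ler_wpM2r ?invr_ge0 ?exprn_ge0 ?(ltW rho0)//.
  by rewrite gM// cabs_circle.
have bF k z : cabs z = 1 -> cabs (F k z) <= cabs w ^+ k * (M * rho ^- k).
  by move=> z1; rewrite /F cabsM cabsX ler_wpM2l ?exprn_ge0 ?cabs_ge0 ?bG.
have -> : circle_mean (fun z => g (rho%:C%C * z) * (rho%:C%C * z / (rho%:C%C * z - w))) =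
    circle_mean (fun z => \sum_(k < n) F k z + T z).
  apply: circle_mean_ext => z z1.
  have := u0 z z1; have := uw0 z z1; rewrite /F /T.
  move: (rho%:C%C * z) => u uw1 u1.
  have -> : \sum_(k < n) w ^+ k * (g u * u ^- k) = g u * \sum_(k < n) (w / u) ^+ k.
    rewrite mulr_sumr; apply: eq_bigr => k _.
    by rewrite mulrCA exprMn exprVn.
  have x1 : w / u - 1 != 0.
    rewrite -(mulfV u1) -mulrBl mulf_neq0 ?invr_eq0//.
    by rewrite -oppr_eq0 opprB.
  have -> : \sum_(k < n) (w / u) ^+ k = ((w / u) ^+ n - 1) / (w / u - 1).
    by rewrite subrX1 mulrAC mulfV// mul1r.
  have -> : w / u - 1 = - (u - w) / u by field.
  by move: (_ ^+ n) => E; field; rewrite uw1.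
rewrite (circle_meanD (M := \sum_(k < n) (cabs w ^+ k * (M * rho ^- k))) _ bT); last first.
  move=> z z1; apply: (le_trans (cabs_sum _ _ _)); apply: ler_sum => k _; exact: bF.
rewrite (circle_mean_sum _ bF).
under eq_bigr do rewrite (circle_meanZ _ (bG _)).
under [X in _ - X]eq_bigr do rewrite mulrC.
by rewrite addrAC subrr add0r; exact: circle_mean_le.
Qed.

Lemma taylor_coef1 (rho : R) k : 0 < rho ->
  taylor_coef (fun=> 1) rho k = (k == 0%N)%:R.
Proof.
move=> rho0; case: k => [|k].
  rewrite /taylor_coef (circle_mean_ext (psi := fun=> 1)) ?circle_mean_cst// => z _.
  by rewrite expr0 invr1 mulr1.
rewrite /taylor_coef (circle_mean_ext (psi := fun z => rho%:C%C ^- k.+1 * z ^- k.+1)).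
  have b1 (z : C) : cabs z = 1 -> cabs (z ^- k.+1) <= 1.
    by move=> z1; rewrite cabsV cabsX z1 expr1n invr1.
  by rewrite (circle_meanZ _ b1) circle_meanXV ?mulr0.
by move=> z _; rewrite mul1r exprMn invfM.
Qed.

Lemma geometric_small (a q e : R) : 0 <= q -> q < 1 -> 0 <= a -> 0 < e ->
  exists n, a * q ^+ n <= e.
Proof.
move=> q0 q1 a0 e0.
have a1 : 0 < a + 1 by lra.
have ea : 0 < e / (a + 1) by rewrite divr_gt0.
have := @cvg_expr R q; rewrite ger0_norm// => /(_ q1) /cvgrPdist_lt /(_ _ ea)[n _ hn].
exists n; have := hn n (leqnn n); rewrite /= sub0r normrN ger0_norm ?exprn_ge0//.
rewrite ltr_pdivlMr// => h; have : 0 <= q ^+ n by rewrite exprn_ge0.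
nra.
Qed.

(** The expansion for the constant function 1: only the coefficient of index 0 survives, and the
    remainder tends to 0. *)
Lemma cauchy_kernel_mean (rho : R) (w : C) : 0 < rho -> cabs w < rho ->
  circle_mean (fun z => rho%:C%C * z / (rho%:C%C * z - w)) = 1.
Proof.
move=> rho0 wr; apply/eqP; rewrite -subr_eq0 -cabs_eq0 eq_le cabs_ge0 andbT.
apply: eps_le => e e0; rewrite add0r.
have rw0 : 0 < rho - cabs w by rewrite subr_gt0.
have K0 : 0 <= rho / (rho - cabs w) by nonneg.
have [||||n hn] := @geometric_small (rho / (rho - cabs w)) (cabs w / rho) e.
- nonneg.
- by rewrite ltr_pdivrMr ?mul1r.
- exact: K0.
- exact: e0.
(* [n.+1] terms, so that the index 0 occurs in the sum. *)
have := @cauchy_kernel_expansion (fun=> 1) rho 1 w n.+1 rho0 wr _.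
rewrite big_ord_recl big1 => [|i _]; last by rewrite taylor_coef1// mul0r.
rewrite taylor_coef1// eqxx expr0 mulr1 addr0 mul1r.
under circle_mean_ext do rewrite mul1r.
move=> /(_ (fun _ _ => _))/le_trans; apply; first by rewrite cabs1.
rewrite mulrC (le_trans _ hn)//; apply: ler_wpM2l => //.
rewrite exprS ler_piMl//; first by nonneg.
by rewrite ler_pdivrMr// mul1r ltW.
Qed.

(* Cauchy's theorem for (g z - g w) / (z - w), continuous at w. *)
Lemma circle_mean_quotient g (r rho : R) (w : C) : 0 < rho -> rho < r -> cabs w < rho ->
  (forall z, cabs z < r -> complex_diff g z) ->
  circle_mean (fun z => rho%:C%C * z *
    ((g (rho%:C%C * z) - g w) / (rho%:C%C * z - w))) = 0.
Proof.
move=> rho0 rhor wr gd.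
have rw0 : 0 < rho - cabs w by rewrite subr_gt0.
pose h z := (g z - g w) / (z - w).
have hd z : cabs z < r -> z != w -> complex_diff h z.
  move=> /gd[d gz] zw.
  exists ((d + 0) * (z - w)^-1 + (g z - g w) * (- (z - w) ^- 2)).
  by apply: cderivM; [apply: cderivD => //; exact: cderiv_cst|exact: cderiv_inv].
have [d0 gw] := gd w (lt_trans wr rhor).
have [del del0 hdel] := cderiv_lipschitz gw.
have hM z : cabs (z - w) <= del / 2 -> cabs (h z) <= cabs d0 + 1.
  move=> zw; have K0 : 0 <= cabs d0 + 1 by rewrite addr_ge0 ?cabs_ge0.
  (* The quotient takes the value 0 at [w] itself, so the bound holds there too. *)
  have [->|zw0] := eqVneq z w; first by rewrite /h !subrr mul0r cabs0.
  rewrite /h cabsM cabsV ler_pdivrMr ?cabs_gt0 ?subr_eq0//.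
  by have := hdel (z - w); rewrite [w + _]addrC subrK; apply; lra.
(* The circle of radius [rho] lies inside the annulus from [r'] to [r''], which avoids [w]. *)
pose r' := (rho + cabs w) / 2; pose r'' := (rho + r) / 2.
apply: circle_mean_eq0 => e e0.
have erho : 0 < e / rho by rewrite divr_gt0.
have [|de de0 hde] := @annulus_uniformly_continuous R r' r'' h _ _ erho.
  move=> z /andP[z1 z2]; apply: hd; first by rewrite /r'' in z2; lra.
  apply/eqP => zw; move: z1; rewrite zw /r'; lra.
have m0 : 0 < Num.min (rho - cabs w) de / rho by rewrite divr_gt0// lt_min rw0.
have [n0 hn0] := rootu_cvg m0.
exists (maxn n0 2) => n; rewrite geq_max => /andP[/hn0 n1 n2].
move: n1; rewrite ltr_pdivlMr// mulrC lt_min => /andP[n1 n3].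
have n00 : 0 < n%:R :> R by rewrite ltr0n (leq_trans _ n2).
have del20 : 0 < del / 2 by rewrite divr_gt0.
have := @polygon_sum _ h w rho (del / 2) (cabs d0 + 1) (e / rho) n n2 rho0 del20
  (fun z zr => hd z (le_lt_trans zr rhor)) hM n1 _.
have rhoe : rho * (e / rho) = e by rewrite mulrC divfK ?gt_eqF.
rewrite rhoe => hsum.
rewrite /root_average cabsM cabsV cabs_nat mulrC ler_pdivrMr// mulrC.
apply: hsum => j z zj; apply: hde; last exact: le_lt_trans zj n3.
rewrite cabs_circle ?cabs_rootuX// /r' /r''; apply/andP; split; lra.
Qed.

(** Cauchy's formula comes from splitting g(u) into g(u) - g(w) and g(w) against the kernel u / (u -
    w): the first part has mean 0 and the kernel has mean 1. Expanding the kernel gives the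
    series. *)
Theorem taylor_expansion g (r rho M : R) (w : C) n :
  0 < rho -> rho < r -> cabs w < rho ->
  (forall z, cabs z < r -> complex_diff g z) ->
  (forall z, cabs z = rho -> cabs (g z) <= M) ->
  cabs (g w - \sum_(k < n) taylor_coef g rho k * w ^+ k)
    <= M * (cabs w / rho) ^+ n * (rho / (rho - cabs w)).
Proof.
move=> rho0 rhor wr gd gM.
have := cauchy_kernel_expansion n rho0 wr gM.
suff -> : circle_mean (fun z => g (rho%:C%C * z) *
  (rho%:C%C * z / (rho%:C%C * z - w))) = g w by [].
have rw0 : 0 < rho - cabs w by rewrite subr_gt0.
have uw z : cabs z = 1 -> rho - cabs w <= cabs (rho%:C%C * z - w).
  by move=> z1; rewrite -[rho in X in X <= _](cabs_circle rho0 z1) cabsBr.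
have bk z : cabs z = 1 -> cabs (rho%:C%C * z / (rho%:C%C * z - w)) <= rho / (rho - cabs w).
  move=> z1; have := cabs_circle rho0 z1; have := uw z z1.
  move: (rho%:C%C * z) => u uw1 cu; rewrite cabsM cabsV cu ler_pM2l//.
  by rewrite lef_pV2 ?posrE// (lt_le_trans rw0).
have bq z : cabs z = 1 -> cabs (rho%:C%C * z *
    ((g (rho%:C%C * z) - g w) / (rho%:C%C * z - w))) <=
    (M + cabs (g w)) * (rho / (rho - cabs w)).
  move=> z1; rewrite mulrCA cabsM ler_pM ?cabs_ge0 ?bk//.
  by rewrite (le_trans (cabsB _ _))// lerD2r gM// cabs_circle.
have bgw z : cabs z = 1 -> cabs (g w * (rho%:C%C * z / (rho%:C%C * z - w))) <=
    cabs (g w) * (rho / (rho - cabs w)).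
  by move=> z1; rewrite cabsM ler_wpM2l ?cabs_ge0 ?bk.
rewrite (circle_mean_ext (psi := fun z => rho%:C%C * z *
    ((g (rho%:C%C * z) - g w) / (rho%:C%C * z - w)) +
    g w * (rho%:C%C * z / (rho%:C%C * z - w)))); last by move=> z _; ring.
rewrite (circle_meanD bq bgw) (circle_mean_quotient rho0 rhor wr gd) add0r.
by rewrite (circle_meanZ _ bk) cauchy_kernel_mean// mulr1.
Qed.

End Taylor.

(** * Cauchy estimates and dependence of Taylor coefficients on parameters *)

Section CauchyEstimates.
Context {R : realType}.
Local Notation C := R[i].
Implicit Types (g : C -> C).

Lemma cderiv_shift g c z d :
  complex_derivative g (c + z) d -> complex_derivative (fun w => g (c + w)) z d.
Proof. by move=> h e /h[del del0 hdel]; exists del => // t /hdel; rewrite addrA. Qed.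

(** Expansion on the circle of radius [r / 2]: for [cabs h <= r / 4] the kernel factor is at most 2,
    so the remainder is at most [2 * M * (2 * cabs h / r) ^+ n], used for n = 1 and n = 2. *)
Lemma cauchy_estimates g (c d h : C) (r M : R) : 0 < r ->
  (forall z, cabs (z - c) < r -> complex_diff g z) ->
  (forall z, cabs (z - c) < r -> cabs (g z) <= M) ->
  complex_derivative g c d -> cabs h <= r / 4 ->
  [/\ cabs d <= 2 * M / r,
      cabs (g (c + h) - g c) <= 4 * M / r * cabs h &
      cabs (g (c + h) - g c - d * h) <= 8 * M / r ^+ 2 * cabs h ^+ 2].
Proof.
move=> r0 gd gM gcd hr.
pose rho := r / 2; pose f z := g (c + z).
have rho0 : 0 < rho by rewrite divr_gt0.
have rhor : rho < r by rewrite /rho; lra.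
have fd z : cabs z < r -> complex_diff f z.
  by move=> zr; have [|d' hd'] := gd (c + z); [rewrite addrAC subrr add0r|
     exists d'; exact: cderiv_shift].
have fM z : cabs z < r -> cabs (f z) <= M.
  by move=> zr; apply: gM; rewrite addrAC subrr add0r.
have fMrho z : cabs z = rho -> cabs (f z) <= M by move=> zr; apply: fM; rewrite zr.
have M0 : 0 <= M by apply: le_trans (fM 0 _); rewrite ?cabs0.
have T w n (hw : cabs w <= r / 4) : cabs (f w - \sum_(k < n) taylor_coef f rho k * w ^+ k)
    <= 2 * M * (cabs w / rho) ^+ n.
  have wrho : cabs w < rho by rewrite /rho; lra.
  apply: (le_trans (taylor_expansion n rho0 rhor wrho fd fMrho)).
  have : rho / (rho - cabs w) <= 2 by rewrite ler_pdivrMr ?subr_gt0// /rho; lra.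
  have q0 : 0 <= M * (cabs w / rho) ^+ n by nonneg.
  by move=> /(ler_wpM2l q0) /le_trans; apply; rewrite mulrC mulrA.
have c0 : taylor_coef f rho 0 = g c.
  have r40 : 0 <= r / 4 by nonneg.
  have := T 0 1%N; rewrite cabs0 => /(_ r40).
  rewrite big_ord1 expr0 mulr1 mul0r expr1 mulr0 => h0.
  apply/eqP; rewrite eq_sym -subr_eq0 -cabs_eq0 eq_le cabs_ge0 andbT.
  by move: h0; rewrite /f addr0.
have e1 w : cabs w <= r / 4 -> cabs (g (c + w) - g c) <= 4 * M / r * cabs w.
  move=> /(T w 1%N); rewrite big_ord1 c0 expr0 mulr1 expr1 => /le_trans; apply.
  by rewrite le_eqVlt; apply/orP; left; apply/eqP; rewrite /rho; field; rewrite gt_eqF.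
have e2 w : cabs w <= r / 4 ->
    cabs (g (c + w) - g c - taylor_coef f rho 1 * w) <= 8 * M / r ^+ 2 * cabs w ^+ 2.
  move=> /(T w 2%N); rewrite big_ord_recl big_ord1 c0 expr0 mulr1 expr1 opprD addrA.
  move=> /le_trans; apply.
  by rewrite le_eqVlt; apply/orP; left; apply/eqP; rewrite /rho; field; rewrite gt_eqF.
(* By its second order remainder the first coefficient is a derivative, and derivatives are
   unique. *)
have dE : d = taylor_coef f rho 1.
  apply: cderiv_unique gcd _ => e e0.
  have K0 : 0 < 8 * M / r ^+ 2 + 1.
    by have : 0 <= 8 * M / r ^+ 2 by [nonneg]; lra.
  exists (Num.min (r / 4) (e / (8 * M / r ^+ 2 + 1))).
    by rewrite lt_min !divr_gt0.
  move=> w; rewrite lt_min => /andP[w1]; rewrite ltr_pdivlMr// => w2.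
  apply: (le_trans (e2 w (ltW w1))); rewrite expr2 mulrA ler_wpM2r//.
  by have := cabs_ge0 w; lra.
split; [|exact: e1|by rewrite dE; exact: e2].
rewrite dE (le_trans (taylor_coef_bound 1 rho0 fMrho))// expr1 /rho.
by rewrite le_eqVlt; apply/orP; left; apply/eqP; field; rewrite gt_eqF.
Qed.

Lemma circle_mean_orthogonal (rho : R) (l k : nat) : 0 < rho ->
  circle_mean (fun z => (rho%:C%C * z) ^+ l * (rho%:C%C * z) ^- k) = (l == k)%:R.
Proof.
move=> rho0; have u0 z : cabs z = 1 -> rho%:C%C * z != 0.
  by move=> z1; rewrite -cabs_gt0 cabs_circle.
have [lk|kl|->] := ltngtP l k.
- rewrite (circle_mean_ext (psi := fun z => (rho%:C%C * z) ^- (k - l))).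
    have b1 (z : C) : cabs z = 1 -> cabs (z ^- (k - l)) <= 1.
      by move=> z1; rewrite cabsV cabsX z1 expr1n invr1.
    rewrite (circle_mean_ext (psi := fun z => rho%:C%C ^- (k - l) * z ^- (k - l))).
      by rewrite (circle_meanZ _ b1) circle_meanXV ?mulr0// subn_gt0.
    by move=> z _; rewrite exprMn invfM.
  move=> z /u0 z0; rewrite -{1}(subnK (ltnW lk)) exprD invfM mulrCA mulfV ?mulr1//.
  by rewrite expf_neq0.
- rewrite (circle_mean_ext (psi := fun z => (rho%:C%C * z) ^+ (l - k))).
    have b1 (z : C) : cabs z = 1 -> cabs (z ^+ (l - k)) <= 1.
      by move=> z1; rewrite cabsX z1 expr1n.
    rewrite (circle_mean_ext (psi := fun z => rho%:C%C ^+ (l - k) * z ^+ (l - k))).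
      by rewrite (circle_meanZ _ b1) circle_meanX ?mulr0// subn_gt0.
    by move=> z _; rewrite exprMn.
  by move=> z /u0 z0; rewrite -{1}(subnK (ltnW kl)) exprD mulfK// expf_neq0.
- rewrite (circle_mean_ext (psi := fun=> 1)) ?circle_mean_cst// => z /u0 z0.
  by rewrite mulfV// expf_neq0.
Qed.

(** Coefficients will be bounded uniformly on a small circle and estimated pointwise on a large one.
    Inserting the expansion at radius [rho] into the mean at radius [eta], orthogonality isolates
    the k-th term. *)
Lemma taylor_coef_radius g (r rho eta : R) k : 0 < eta -> eta < rho -> rho < r ->
  (forall z, cabs z < r -> complex_diff g z) ->
  taylor_coef g eta k = taylor_coef g rho k.
Proof.
move=> eta0 etarho rhor gd.
have rho0 : 0 < rho by lra.
have [M M0 gM] : exists2 M : R, 0 < M & forall z, cabs z <= rho -> cabs (g z) <= M.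
  by apply: disc_bounded => z zr; apply: gd; lra.
have gM' z : cabs z = rho -> cabs (g z) <= M by move=> zr; apply: gM; rewrite zr.
have re0 : 0 < rho - eta by rewrite subr_gt0.
pose K := M * (rho / (rho - eta)).
have K0 : 0 <= K by rewrite /K; nonneg.
pose a := taylor_coef g rho.
apply/eqP; rewrite -subr_eq0 -cabs_eq0 eq_le cabs_ge0 andbT.
apply: eps_le => e e0; rewrite add0r.
have [||||n hn] := @geometric_small R (K * eta ^- k) (eta / rho) e.
- by nonneg.
- by rewrite ltr_pdivrMr// mul1r.
- by nonneg.
- by [].
(* Large enough both to include the index [k] and to make the remainder small. *)
pose N := (n + k).+1.
pose u (z : C) := eta%:C%C * z.
have cu z : cabs z = 1 -> cabs (u z) = eta by exact: cabs_circle.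
have bF l z : cabs z = 1 -> cabs (u z ^+ l * u z ^- k) <= eta ^+ l * eta ^- k.
  by move=> /cu z1; rewrite cabsM cabsV !cabsX z1.
have bF' l z : cabs z = 1 -> cabs (a l * (u z ^+ l * u z ^- k)) <=
    cabs (a l) * (eta ^+ l * eta ^- k).
  by move=> z1; rewrite cabsM ler_wpM2l ?bF.
pose T z := (g (u z) - \sum_(l < N) a l * u z ^+ l) * u z ^- k.
have bT z : cabs z = 1 -> cabs (T z) <= K * (eta / rho) ^+ N * eta ^- k.
  move=> /cu z1; rewrite /T cabsM cabsV cabsX z1 ler_wpM2r; [|by nonneg|].
    by nonneg.
  have := @taylor_expansion _ g r rho M (u z) N rho0 rhor _ gd gM'.
  rewrite z1 => /(_ etarho) /le_trans; apply.
  by rewrite /K mulrAC.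
have -> : taylor_coef g eta k = circle_mean
    (fun z => \sum_(l < N) a l * (u z ^+ l * u z ^- k) + T z).
  apply: circle_mean_ext => z _; rewrite /T -/(u z) mulrBl mulr_suml.
  rewrite -[LHS]addr0 addrCA; congr (_ + _); apply/eqP; rewrite eq_sym subr_eq0.
  by apply/eqP; apply: eq_bigr => l _; rewrite mulrA.
rewrite (circle_meanD (M := \sum_(l < N) cabs (a l) * (eta ^+ l * eta ^- k)) _ bT); last first.
  move=> z z1; apply: (le_trans (cabs_sum _ _ _)); apply: ler_sum => l _; exact: bF'.
rewrite (circle_mean_sum _ bF').
under eq_bigr do rewrite (circle_meanZ _ (bF _)) circle_mean_orthogonal//.
have kN : (k < N)%N by rewrite /N ltnS leq_addl.
rewrite (bigD1 (Ordinal kN)) //= eqxx mulr1 big1 ?addr0; last first.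
  by move=> i ik; rewrite (_ : (i == k :> nat) = false) ?mulr0//; apply/negbTE.
rewrite addrAC -/(a k) subrr add0r.
rewrite (le_trans (circle_mean_le bT))// (le_trans _ hn)// mulrAC ler_wpM2l//.
  by nonneg.
rewrite /N -addnS exprD ler_piMr//; first by nonneg.
by rewrite exprn_ile1//; [nonneg|rewrite ler_pdivrMr// mul1r ltW].
Qed.

(** Differentiation under the mean: the second order Cauchy remainder is uniform in [w] on the
    circle. The derivative is the mean of chosen values [D w], which asks for no regularity in
    [w]. *)
Lemma taylor_coef_diff (F : C -> C -> C) (c : C) (r eta M : R) k :
  0 < r -> 0 < eta ->
  (forall w z, cabs w = eta -> cabs (z - c) < r -> complex_diff (F ^~ w) z) ->
  (forall w z, cabs w = eta -> cabs (z - c) < r -> cabs (F z w) <= M) ->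
  complex_diff (fun z => taylor_coef (F z) eta k) c.
Proof.
move=> r0 eta0 Fd FM.
have cc : cabs (c - c) < r by rewrite subrr cabs0.
have /choice[D hD] : forall w, exists d, cabs w = eta -> complex_derivative (F ^~ w) c d.
  move=> w; have [we|we] := eqVneq (cabs w) eta; last first.
    by exists 0 => we'; rewrite we' eqxx in we.
  by have [d hd] := Fd w c we cc; exists d.
have M0 : 0 <= M.
  have h : cabs (eta%:C%C : C) = eta by rewrite cabs_real gtr0_norm.
  exact: le_trans (cabs_ge0 _) (FM _ _ h cc).
have est w h : cabs w = eta -> cabs h <= r / 4 ->
    cabs (D w) <= 2 * M / r /\
    cabs (F (c + h) w - F c w - D w * h) <= 8 * M / r ^+ 2 * cabs h ^+ 2.
  move=> we hr; have [] := @cauchy_estimates (F ^~ w) c (D w) h r M r0 _ _ (hD w we) hr.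
  - by move=> z; exact: Fd.
  - by move=> z; exact: FM.
  - by [].
pose u (z : C) := eta%:C%C * z.
have cu z : cabs z = 1 -> cabs (u z) = eta by exact: cabs_circle.
have u_bound (G : C -> C) (A : R) : (forall w, cabs w = eta -> cabs (G w) <= A) ->
    forall z, cabs z = 1 -> cabs (G (u z) * u z ^- k) <= A * eta ^- k.
  move=> GA z /cu z1; rewrite cabsM cabsV cabsX z1 ler_wpM2r ?GA//; nonneg.
exists (taylor_coef D eta k) => e e0.
pose B := 8 * M / r ^+ 2 * eta ^- k.
have B0 : 0 <= B by rewrite /B; nonneg.
have B1 : 0 < B + 1 by lra.
exists (Num.min (r / 4) (e / (B + 1))); first by rewrite lt_min !divr_gt0.
move=> h; rewrite lt_min => /andP[h1 h2].
have hr : cabs (c + h - c) < r by rewrite addrAC subrr add0r; lra.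
have b1 := u_bound (F (c + h)) M (fun w we => FM w _ we hr).
have b2 := u_bound (F c) M (fun w we => FM w _ we cc).
have b3 := u_bound D _ (fun w we => (est w h we (ltW h1)).1).
have b2' z : cabs z = 1 -> cabs (-1 * (F c (u z) * u z ^- k)) <= M * eta ^- k.
  by move=> z1; rewrite mulN1r cabsN b2.
have b3' z : cabs z = 1 -> cabs (- h * (D (u z) * u z ^- k)) <= cabs h * (2 * M / r * eta ^- k).
  by move=> z1; rewrite cabsM cabsN ler_wpM2l ?b3.
have -> : taylor_coef (F (c + h)) eta k - taylor_coef (F c) eta k - taylor_coef D eta k * h =
   circle_mean (fun z => F (c + h) (u z) * u z ^- k + (-1 * (F c (u z) * u z ^- k) +
     - h * (D (u z) * u z ^- k))).
  rewrite (circle_meanD b1 (M' := M * eta ^- k + cabs h * (2 * M / r * eta ^- k))); last first.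
    by move=> z z1; rewrite (le_trans (cabsD _ _))// lerD ?b2' ?b3'.
  rewrite (circle_meanD b2' b3') (circle_meanZ _ b2) (circle_meanZ _ b3) /taylor_coef -/(u _).
  by ring.
apply: (@le_trans _ _ (B * cabs h ^+ 2)).
  apply: circle_mean_le => z z1.
  have -> : F (c + h) (u z) * u z ^- k + (-1 * (F c (u z) * u z ^- k) +
     - h * (D (u z) * u z ^- k)) =
     (F (c + h) (u z) - F c (u z) - D (u z) * h) * u z ^- k by ring.
  rewrite cabsM cabsV cabsX (cu z z1) /B mulrAC ler_wpM2r; [by []|nonneg|].
  exact: (est _ h (cu z z1) (ltW h1)).2.
rewrite expr2 mulrA ler_wpM2r//.
by move: h2; rewrite ltr_pdivlMr//; have := cabs_ge0 h; nra.
Qed.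

End CauchyEstimates.

(** * Hartogs' lemma *)

Section PlaneArea.
Context {R : realType}.

Definition box (p : R * R) (s : R) : set (R * R) :=
  [set q | `|q.1 - p.1| < s /\ `|q.2 - p.2| < s].

Let T2 := (measurableTypeR R * measurableTypeR R)%type.

Definition plane_area : {measure set T2 -> \bar R} :=
  ((@lebesgue_measure R) \x (@lebesgue_measure R))%E.

Lemma boxE p (s : R) : box p s =
  [set` `]p.1 - s, p.1 + s[%R] `*` [set` `]p.2 - s, p.2 + s[%R].
Proof.
apply/seteqP; split => -[x y] /=; rewrite /box /= !in_itv /= !ltr_distl => -[h1 h2].
  by split.
by split.
Qed.

Lemma measurable_box p (s : R) : measurable (box p s : set T2).
Proof. by rewrite boxE; apply: measurableX; exact: measurable_itv. Qed.

Lemma box_area p (s : R) : 0 < s -> plane_area (box p s) = ((2 * s) ^+ 2)%:E.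
Proof.
move=> s0; rewrite boxE /plane_area [LHS]product_measure1E; [|exact: measurable_itv|exact: measurable_itv].
rewrite /= !lebesgue_measure_itv /= !lte_fin !ltrD2l gtrN //= -!EFinD -EFinM.
by congr (_%:E); ring.
Qed.

(** [V] is the union of the rational boxes that it contains, a countable family. *)
Lemma open_plane_measurable (V : set (R * R)) :
  (forall p, V p -> exists2 d : R, 0 < d & box p d `<=` V) ->
  measurable (V : set T2).
Proof.
move=> Vo.
pose F (t : rat * rat * rat) : set T2 :=
  if `[< box (ratr t.1.1, ratr t.1.2) (ratr t.2) `<=` V >]
  then box (ratr t.1.1, ratr t.1.2) (ratr t.2) else set0.
have -> : V = \bigcup_t F t.
  apply/seteqP; split => [p Vp|p [t _]]; last by rewrite /F; case: asboolP => [h /h|].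
  have [d d0 hd] := Vo _ Vp.
  (* A box of half side below [d / 2] that contains [p] lies inside [box p d]. *)
  have [s] : exists s : rat, ratr s \in `]d / 4, d / 2[%R.
    by apply: rat_in_itvoo; lra.
  rewrite in_itv /= => /andP[s1 s2].
  have [a] : exists a : rat, ratr a \in `]p.1 - ratr s, p.1 + ratr s[%R.
    by apply: rat_in_itvoo; lra.
  have [b] : exists b : rat, ratr b \in `]p.2 - ratr s, p.2 + ratr s[%R.
    by apply: rat_in_itvoo; lra.
  rewrite !in_itv /= => /andP[b1 b2] /andP[a1 a2].
  exists (a, b, s) => //; rewrite /F /=; case: asboolP => [_|[]].
    by rewrite /box /= !ltr_distl; split; apply/andP; split; lra.
  move=> q; rewrite /box /= !ltr_distl => -[/andP[q1 q2] /andP[q3 q4]].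
  by apply: hd; rewrite /box /= !ltr_distl; split; apply/andP; split; lra.
apply: countable_bigcupT_measurable => [|t]; first exact: countableP.
by rewrite /F; case: asboolP => _; [exact: measurable_box|exact: measurable0].
Qed.

(** By continuity of the area from above some [V m] has area below [a], and disjoint boxes inside it
    have at most that total area. *)
Lemma packing_in_vanishing_open (V : nat -> set (R * R)) (r a : R) : 0 < r -> 0 < a ->
  (forall m p, V m p -> exists2 d : R, 0 < d & box p d `<=` V m) ->
  (forall m, V m.+1 `<=` V m) -> V 0%N `<=` box (0, 0) r ->
  (forall p, ~ forall m, V m p) ->
  exists m, forall N (p : 'I_N -> R * R) (s : R), 0 < s ->
    (forall i, box (p i) s `<=` V m) ->
    (forall i j, i != j -> box (p i) s `&` box (p j) s = set0) ->
    N%:R * (2 * s) ^+ 2 <= a.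
Proof.
move=> r0 a0 Vo VS Vr V0.
have mV m : measurable (V m : set T2) by apply: open_plane_measurable; exact: Vo.
have niV : nonincreasing_seq (V : (set T2)^nat).
  by apply/nonincreasing_seqP => m; apply/subsetPset; exact: VS.
have cap0 : \bigcap_m V m = set0 :> set T2.
  by apply/seteqP; split => // p Vp; apply: (V0 p) => m; exact: Vp.
have V0fin : (plane_area (V 0%N) < +oo)%E.
  apply: (@le_lt_trans _ _ (plane_area (box (0, 0) r))); last by rewrite box_area// ltry.
  by apply: le_measure => //; rewrite inE; [exact: mV|exact: measurable_box].
have mcap : measurable (\bigcap_m V m : set T2) by rewrite cap0; exact: measurable0.
have := nonincreasing_cvg_mu V0fin mV mcap niV.
rewrite cap0 measure0 => /fine_cvgP[_].
have Vfin m : plane_area (V m) \is a fin_num.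
  rewrite ge0_fin_numE// (le_lt_trans _ V0fin)//.
  by apply: le_measure; rewrite ?inE//; apply/subsetPset; exact: niV.
move=> /cvgrPdist_lt/(_ _ a0)[m _ /(_ m (leqnn m))] /=.
rewrite sub0r normrN ger0_norm ?fine_ge0// => hm.
exists m => N p s s0 sub disj.
have : (plane_area (\big[setU/set0]_(i < N) box (p i) s) <= plane_area (V m))%E.
  apply: le_measure; rewrite ?inE; [|exact: mV|].
    by apply: bigsetU_measurable => i _; exact: measurable_box.
  by elim/big_ind : _ => [//|A B hA hB q [/hA|/hB]//|i _]; exact: sub.
rewrite measure_bigsetU_ord; last 2 first.
- by move=> i; exact: measurable_box.
- apply/trivIsetP => i j _ _ ij; exact: disj.
rewrite (eq_bigr (fun=> ((2 * s) ^+ 2)%:E)) => [|i _]; last exact: box_area.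
rewrite sumEFin sumr_const card_ord -(fineK (Vfin m)) lee_fin => /le_trans h.
by rewrite mulr_natl; apply: h; exact: ltW.
Qed.

End PlaneArea.

Section HartogsLemma.
Context {R : realType}.
Local Notation C := R[i].

Lemma center_bound (g : C -> C) (r M : R) : 1 < r ->
  (forall z, cabs z < r -> complex_diff g z) ->
  (forall z, cabs z = 1 -> cabs (g z) <= M) -> cabs (g 0) <= M.
Proof.
move=> r1 gd gM; have z0 : cabs (0 : C) < 1 by rewrite cabs0.
have := taylor_expansion 1 ltr01 r1 z0 gd gM.
rewrite big_ord1 expr0 mulr1 cabs0 mul0r expr1 mulr0 mul0r => h0.
have -> : g 0 = taylor_coef g 1 0.
  by apply/eqP; rewrite -subr_eq0 -cabs_eq0 eq_le cabs_ge0 h0.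
by rewrite (le_trans (taylor_coef_bound 0 ltr01 gM))// expr0 invr1 mulr1.
Qed.

Lemma rootu_separation N i j : (i < N)%N -> (j < N)%N -> i != j ->
  1 <= N%:R * cabs (rootu N ^+ i - rootu N ^+ j : C).
Proof.
wlog ij : i j / (i < j)%N => [hw iN jN ij|iN jN _].
  by have [lt_ij|lt_ji|eq_ij] := ltngtP i j;
    [exact: hw|rewrite cabsC; apply: hw => //; rewrite eq_sym|rewrite eq_ij eqxx in ij].
rewrite cabsC -(subnK (ltnW ij)) exprD -{2}[rootu N ^+ i]mul1r -mulrBl cabsM cabs_rootuX mulr1.
apply: root_separation; first exact: leq_ltn_trans iN.
- exact: cabs_rootuX.
- by rewrite exprAC rootuN1 ?expr1n// (leq_ltn_trans _ iN).
- by apply: rootuX_eq1; rewrite subn_gt0 ij (leq_ltn_trans (leq_subr _ _)).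
Qed.

(* If |a| <= A everywhere but at most n^2/q of the n^2 points of a polar grid
   around w, where it is at most B, a Jensen type inequality follows from the
   maximum principle applied to the product of a over the rotated grid. *)
Lemma polar_grid_bound (a : C -> C) (w : C) (r A B B' : R) (n q k : nat) :
  0 < r -> (0 < n)%N -> 0 < B -> B <= A -> B <= B' -> A / B <= (B' / B) ^+ q ->
  (forall z, cabs (z - w) < 2 * r -> complex_diff a z) ->
  (forall z, cabs (z - w) <= r -> cabs (a z) <= A ^+ k) ->
  (forall z, cabs z = 1 ->
    (#|[pred x : 'I_n * 'I_n | ~~ `[< (cabs (a (w +
       (r * (1 + x.1%:R / n%:R) / 2)%:C%C * rootu n ^+ x.2 * z)) <= B ^+ k)%R >] ]|
      * q <= n * n)%N) ->
  cabs (a w) <= B' ^+ k.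
Proof.
move=> r0 n0 B0 BA BB' ABq ad aA few.
have nR0 : 0 < n%:R :> R by rewrite ltr0n.
pose t (l : 'I_n) : R := r * (1 + l%:R / n%:R) / 2.
have t0 l : 0 <= t l by rewrite /t; nonneg.
have tr l : t l <= r.
  have : l%:R / n%:R <= 1 :> R by rewrite ler_pdivrMr// mul1r ler_nat ltnW.
  by rewrite /t; nra.
pose P (x : 'I_n * 'I_n) (z : C) : C := w + (t x.1)%:C%C * rootu n ^+ x.2 * z.
(* At 0 every factor equals [a w], so a bound at the center is a bound for a power of [a w]. *)
pose g z := \prod_(x : 'I_n * 'I_n) a (P x z).
have PB x z : cabs (P x z - w) = t x.1 * cabs z.
  by rewrite /P addrAC subrr add0r !cabsM cabs_rootuX mulr1 cabs_real ger0_norm.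
have gd z : cabs z < 2 -> complex_diff g z.
  move=> z2; apply: cdiff_prod => x.
  have [|d hd] := ad (P x z).
    rewrite PB; have [->|tx] := eqVneq (t x.1) 0; first by rewrite mul0r mulr_gt0.
    have tx0 : 0 < t x.1 by rewrite lt_neqAle eq_sym tx t0.
    have : t x.1 * cabs z < t x.1 * 2 by rewrite ltr_pM2l.
    by have := tr x.1; lra.
  by exists (d * ((t x.1)%:C%C * rootu n ^+ x.2)); exact: cderiv_affine.
have Ak0 : 0 < A ^+ k by rewrite exprn_gt0// (lt_le_trans B0).
have Bk0 : 0 < B ^+ k by rewrite exprn_gt0.
have B'0 : 0 < B' by exact: lt_le_trans BB'.
have AB1 : 1 <= A / B by rewrite ler_pdivlMr// mul1r.
have BB1 : 1 <= B' / B by rewrite ler_pdivlMr// mul1r.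
have gM z : cabs z = 1 -> cabs (g z) <= (B' ^+ k) ^+ (n * n).
  move=> z1; rewrite cabs_prod.
  (* A bad point costs an extra factor [(A / B) ^+ k]. As [q] times their number is at most n^2, all
     of them together cost at most the power k n^2 of [B' / B]. *)
  pose bad (x : 'I_n * 'I_n) := ~~ `[< cabs (a (P x z)) <= B ^+ k >].
  apply: (@le_trans _ _ (\prod_x (B ^+ k * (if bad x then (A / B) ^+ k else 1)))).
    apply: ler_prod => x _; rewrite cabs_ge0 /= /bad; case: asboolP => [h|_] /=.
      by rewrite mulr1.
    rewrite -exprMn mulrC divfK ?gt_eqF//; apply: aA.
    by rewrite PB z1 mulr1.
  rewrite big_split /= prodr_const card_prod card_ord -big_mkcond /= prodr_const.
  have -> : B' ^+ k = B ^+ k * (B' / B) ^+ k by rewrite -exprMn mulrC divfK ?gt_eqF.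
  rewrite [leRHS]exprMn ler_pM2l ?exprn_gt0// exprAC [leRHS]exprAC.
  apply: lerXn2r; rewrite ?nnegrE ?exprn_ge0//; [by lra|by lra|].
  apply: (@le_trans _ _ ((B' / B) ^+ (q * #|bad|))).
    by rewrite exprM; apply: lerXn2r => //; rewrite ?nnegrE ?exprn_ge0//; lra.
  by apply: ler_weXn2l => //; rewrite mulnC; exact: few z z1.
have := center_bound (r := 2) _ gd gM.
have -> : cabs (g 0) = cabs (a w) ^+ (n * n).
  rewrite cabs_prod (eq_bigr (fun=> cabs (a w))) => [|x _]; last by rewrite /P mulr0 addr0.
  by rewrite prodr_const card_prod card_ord.
rewrite ler_pXn2r ?nnegrE//; [|by rewrite muln_gt0 n0|by rewrite exprn_ge0// ltW].
by apply; lra.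
Qed.

(* The uniformity in the index set I makes the lemma apply to one variable at a
   time of a function of several variables. *)
Lemma hartogs_lemma (I : Type) (a : nat -> I -> C -> C) (R0 r A B B' : R) :
  0 <= r -> r < R0 -> 0 < B -> B < B' ->
  (forall k i z, cabs z < R0 -> complex_diff (a k i) z) ->
  (forall k i z, cabs z < R0 -> cabs (a k i z) <= A ^+ k) ->
  (forall z, cabs z < R0 -> exists k0, forall k i, (k0 <= k)%N -> cabs (a k i z) <= B ^+ k) ->
  exists k0, forall k i z, (k0 <= k)%N -> cabs z <= r -> cabs (a k i z) <= B' ^+ k.
Proof.
move=> r0 rR B0 BB' ad aA aB.
(* The exceptional sets are defined with [B] but grid points are tested with [B1]; the gap leaves
   room for a box around each bad grid point. *)
have [B1 BB1 B1B'] : exists2 B1, B < B1 & B1 < B' by exists ((B + B') / 2); lra.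
have B10 : 0 < B1 by lra.
pose A1 := Num.max `|A| B'.
have B'0 : 0 < B' by lra.
have B'A1 : B' <= A1 by rewrite le_max lexx orbT.
have aA1 k i z : cabs z < R0 -> cabs (a k i z) <= A1 ^+ k.
  move=> /(aA k i)/le_trans; apply; rewrite (le_trans (ler_norm _))// normrX.
  by apply: lerXn2r; rewrite ?nnegrE ?le_max ?lexx ?normr_ge0.
pose rho := (R0 - r) / 2; have rho0 : 0 < rho by rewrite /rho; lra.
have [q hq] : exists q : nat, A1 / B1 <= (B' / B1) ^+ q.
  have [||||q hq] := @geometric_small R (A1 / B1) (B1 / B') 1.
  - nonneg.
  - by rewrite ltr_pdivrMr// mul1r.
  - by apply: divr_ge0; [exact: le_trans (ltW B'0) B'A1|exact: ltW].
  - by [].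
  exists q; rewrite -(invf_div B1 B') exprVn -[leRHS]mul1r.
  by rewrite ler_pdivlMr// exprn_gt0// divr_gt0.
have qS : A1 / B1 <= (B' / B1) ^+ q.+1.
  apply: (le_trans hq); rewrite exprS ler_peMl ?exprn_ge0 ?divr_ge0 ?ltW//.
  by rewrite ltr_pdivlMr// mul1r.
pose toC (p : R * R) : C := Complex p.1 p.2.
(* The eventual pointwise bound says exactly that these decreasing open sets have empty
   intersection. *)
pose V (m : nat) : set (R * R) := [set p | cabs (toC p) < R0 /\
   exists k i, [/\ (m <= k)%N & B ^+ k < cabs (a k i (toC p))] ].
have in_box (p p' : R * R) d : box p d p' -> cabs (toC p' - toC p) < 2 * d.
  move=> [/= h1 h2]; apply: (le_lt_trans (cabs_le_ReIm (toC p' - toC p))) => /=; lra.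
(* Disjoint boxes of half side rho / (8 n) with total area at most [area] number at most n^2 / (q +
   1). *)
pose area := rho ^+ 2 / (16 * q.+1%:R).
have R00 : 0 < R0 by lra.
have area0 : 0 < area by rewrite divr_gt0 ?exprn_gt0// mulr_gt0 ?ltr0n.
have [||||m hm] := @packing_in_vanishing_open _ V R0 area R00 area0.
- move=> m p [pR [k [i [mk ap]]]].
  have e0 : 0 < (cabs (a k i (toC p)) - B ^+ k) / 2 by rewrite divr_gt0// subr_gt0.
  have [d d0 hd] := cdiff_continuous (ad k i _ pR) e0.
  exists (Num.min d (R0 - cabs (toC p)) / 2); first by rewrite divr_gt0// lt_min d0 subr_gt0.
  move=> p' /in_box; rewrite mulrC divfK ?pnatr_eq0// lt_min => /andP[/hd h1 h2].
  rewrite [toC p + _]addrC subrK in h1.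
  split; first by have := cabsBr (toC p') (toC p); lra.
  exists k, i; split => //.
  by have := cabsBr (a k i (toC p)) (a k i (toC p')); rewrite cabsC; lra.
- by move=> m p [pR [k [i [mk ap]]]]; split => //; exists k, i; split => //; exact: ltnW.
- move=> p [pR _]; rewrite /box /= !subr0; split; apply: le_lt_trans pR.
    exact: Re_le_cabs (toC p).
  exact: Im_le_cabs (toC p).
- move=> p Vp; have [k0 hk0] := aB _ (Vp 0%N).1.
  have [_ [k [i [kk]]]] := Vp k0; rewrite ltNge => /negP; apply; exact: hk0.
(* [m] is independent of [k], [i] and [z], while the grid size [n] below depends on [k] and [i]. The
   successor makes [k] positive, so that [B ^+ k < B1 ^+ k]. *)
exists m.+1 => k i z mk zr.
have rhoR : r + 2 * rho = R0 by rewrite /rho; field.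
have kgt0 : (0 < k)%N by exact: leq_trans mk.
have e0 : 0 < B1 ^+ k - B ^+ k.
  by rewrite subr_gt0 ltrXn2r ?nnegrE ?gtn_eqF//; lra.
have e20 : 0 < (B1 ^+ k - B ^+ k) / 2 by rewrite divr_gt0.
have [|d d0 hd] := @annulus_uniformly_continuous R 0 (r + rho) (a k i) _ _ e20.
  by move=> z' /andP[_ z'r]; apply: ad; lra.
(* So fine a grid that [a k i] varies by at most half the gap on each box. *)
pose n := (Num.truncn (rho / d)).+1.
have nR0 : 0 < n%:R :> R by rewrite ltr0n.
have nd : rho / n%:R < d.
  by rewrite ltr_pdivrMr// mulrC -ltr_pdivrMr// truncnS_gt.
apply: (@polar_grid_bound (a k i) z rho A1 B1 B' n q.+1 k) => //.
- exact: le_trans (ltW B1B') B'A1.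
- exact: ltW.
- by move=> z' z'z; apply: ad; have := cabsBr z' z; lra.
- by move=> z' z'z; apply: aA1; have := cabsBr z' z; lra.
move=> u u1.
set t := fun l : 'I_n => rho * (1 + l%:R / n%:R) / 2 : R.
set bad := [pred x | _].
pose P (x : 'I_n * 'I_n) : C := z + (t x.1)%:C%C * rootu n ^+ x.2 * u.
pose s := rho / (8 * n%:R).
have s0 : 0 < s by rewrite divr_gt0// mulr_gt0.
have s8 : 8 * s = rho / n%:R by rewrite /s; field; rewrite gt_eqF.
pose toR (c : C) := (complex.Re c, complex.Im c).
have toRK c : toC (toR c) = c by case: c.
have t0 l : rho / 2 <= t l.
  have : 0 <= l%:R / n%:R :> R by nonneg.
  by rewrite /t; nra.
have tr l : t l <= rho.
  have : l%:R / n%:R <= 1 :> R by rewrite ler_pdivrMr// mul1r ler_nat ltnW.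
  by rewrite /t; nra.
have Pz x : cabs (P x - z) = t x.1.
  rewrite /P addrAC subrr add0r !cabsM cabs_rootuX u1 !mulr1 cabs_real ger0_norm//.
  by have := t0 x.1; lra.
(* Consecutive radii differ by rho / (2 n) = 4 s. On a circle of radius at least [rho / 2], distinct
   n-th roots of unity, at least 1 / n apart, give the same distance. *)
have sep x y : x != y -> 4 * s <= cabs (P x - P y).
  case: x y => [l j] [l' j'] xy; have [ll'|ll'] := eqVneq l l'; last first.
    have h1 : `|t l - t l'| <= cabs (P (l, j) - P (l', j')).
      have := Pz (l, j); have := Pz (l', j'); rewrite /= => <- <-.
      rewrite ler_norml; apply/andP; split.
        by have := cabs_tri (P (l', j')) (P (l, j)) z; rewrite (cabsC (P (l', j')) (P (l, j))); lra.
      by have := cabs_tri (P (l, j)) (P (l', j')) z; lra.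
    apply: le_trans h1.
    have -> : t l - t l' = 4 * s * (l%:R - l'%:R).
      by rewrite /t /s; field; rewrite gt_eqF.
    rewrite normrM gtr0_norm; last by rewrite mulr_gt0.
    apply: ler_peMr; [by nonneg|].
    rewrite -[l%:R]/((l%:Z)%:~R) -[l'%:R]/((l'%:Z)%:~R) -intrB -intr_norm.
    rewrite -[1]/(1%:~R) ler_int -gtz0_ge1 normr_gt0 subr_eq0 eqz_nat.
    by apply: contra ll' => /eqP ?; apply/eqP/val_inj.
  rewrite -{l'}ll' in xy *.
  have jj : (j : nat) != j' by apply: contra xy => /eqP/val_inj ->.
  have -> : P (l, j) - P (l, j') = (t l)%:C%C * (rootu n ^+ j - rootu n ^+ j') * u.
    by rewrite /P /=; ring.
  rewrite !cabsM u1 mulr1 cabs_real ger0_norm; last by have := t0 l; lra.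
  have := rootu_separation (ltn_ord j) (ltn_ord j') jj.
  have := cabs_ge0 (rootu n ^+ j - rootu n ^+ j' : C).
  move: (cabs (rootu n ^+ j - rootu n ^+ j')) => c c0 nc.
  have : rho / 2 * c <= t l * c by rewrite ler_wpM2r ?t0.
  apply: le_trans; have -> : 4 * s = rho / 2 / n%:R by rewrite /s; field; rewrite gt_eqF.
  by rewrite ler_pdivrMr//; have := ler_wpM2l (ltW rho0) nc; lra.
have badP x : x \in bad -> B1 ^+ k < cabs (a k i (P x)).
  by rewrite inE => /negP h; rewrite ltNge; apply/negP => h'; apply: h; apply/asboolP.
have := hm #|bad| (fun j => toR (P (enum_val j))) s s0 _ _.
move=> /(_ _ _)/wrap[||]; last first.
- rewrite /area /s => h.
  have : #|bad|%:R * q.+1%:R <= (n * n)%:R :> R.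
    move: h; rewrite ler_pdivlMr ?mulr_gt0 ?ltr0n//.
    have -> : #|bad|%:R * (2 * (rho / (8 * n%:R))) ^+ 2 * (16 * q.+1%:R) =
      rho ^+ 2 * (#|bad|%:R * q.+1%:R / (n%:R * n%:R)) by field; rewrite gt_eqF.
    rewrite -[leRHS]mulr1 ler_pM2l ?exprn_gt0// ler_pdivrMr ?mulr_gt0// mul1r.
    by rewrite natrM.
  by rewrite -natrM ler_nat.
- move=> j j' jj'; apply/seteqP; split => // p [[/= h1 h2] [/= h3 h4]].
  have := sep (enum_val j) (enum_val j'); rewrite (inj_eq enum_val_inj) => /(_ jj').
  rewrite leNgt => /negP; apply; apply: (le_lt_trans (cabs_le_ReIm _)).
  move: h1 h2 h3 h4; move: (P _) (P _) => [x y] [x' y'] /=.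
  have := ler_distD p.1 x' x; have := ler_distD p.2 y' y.
  by rewrite (distrC x' p.1) (distrC y' p.2); lra.
- move=> j p /in_box; rewrite toRK.
  have := badP _ (enum_valP j); move: (enum_val j) => x ax px.
  have xz := Pz x.
  have Pr : cabs (P x) <= r + rho by have := cabsBr (P x) z; have := tr x.1; lra.
  have pP : cabs (toC p - P x) < d by lra.
  have hp := hd (P x) (toC p); rewrite cabs_ge0 Pr /= in hp.
  have {hp} := hp isT pP => hp.
  have rn : rho / n%:R <= rho by rewrite ler_pdivrMr// ler_peMr ?ler1n// ltW.
  split; first by have := cabsBr (toC p) (P x); lra.
  exists k, i; split; first exact: ltnW.
  by have := cabsBr (a k i (P x)) (a k i (toC p)); rewrite cabsC; lra.
Qed.

End HartogsLemma.

(** * Hartogs' theorem *)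

Section BaireBound.
Context {R : realType}.
Local Notation C := R[i].

Lemma complex_ReB (z w : C) : complex.Re (z - w) = complex.Re z - complex.Re w.
Proof. by case: z w => [? ?] [? ?]. Qed.

Lemma complex_ImB (z w : C) : complex.Im (z - w) = complex.Im z - complex.Im w.
Proof. by case: z w => [? ?] [? ?]. Qed.

Lemma baire_bounded_disc (I : Type) (F : I -> C -> C) (r sg : R) :
  0 < sg -> sg < r ->
  (forall i z, cabs z < r -> complex_diff (F i) z) ->
  (forall z, cabs z < r -> exists M : R, forall i, cabs (F i z) <= M) ->
  exists w1 (eta M : R), [/\ cabs w1 < sg, 0 < eta &
    forall i w, cabs (w - w1) <= eta -> cabs (F i w) <= M].
Proof.
move=> sg0 sgr Fd FM; apply: contrapT => nb.
(* Otherwise nested discs, with |F i| > m for some i on the m-th one, shrink to a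
   point where the family is not bounded. *)
have step (m : nat) (p : C * R) : exists p' : C * R, cabs p.1 < sg -> 0 < p.2 ->
    [/\ cabs p'.1 < sg, 0 < p'.2, p'.2 <= p.2 / 2, cabs (p'.1 - p.1) <= p.2 / 2 &
    exists i, forall u, cabs (u - p'.1) <= p'.2 -> m%:R < cabs (F i u)].
  case: p => w d /=.
  have [[wsg d0]|h] := pselect (cabs w < sg /\ 0 < d); last by exists (w, d) => ? ?; case: h.
  (* The second term keeps the centers in the disc of radius [sg]; as [sg < r], their limit stays in
     the domain. *)
  pose eta := Num.min (d / 2) ((sg - cabs w) / 2).
  have eta0 : 0 < eta by rewrite lt_min !divr_gt0// subr_gt0.
  have [i [w' [w'w Fw']]] : exists i w', cabs (w' - w) <= eta /\ m%:R < cabs (F i w').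
    apply: contrapT => h; apply: nb; exists w, eta, m%:R; split => // i w' w'w.
    by rewrite leNgt; apply/negP => Fw; apply: h; exists i, w'.
  move: w'w; rewrite le_min => /andP[w'd w'sg].
  have w'sg' : cabs w' < sg by have := cabsBr w' w; lra.
  have e0 : 0 < (cabs (F i w') - m%:R) / 2 by rewrite divr_gt0// subr_gt0.
  have [t t0 ht] := cdiff_continuous (Fd i _ (lt_trans w'sg' sgr)) e0.
  exists (w', Num.min (t / 2) (d / 2)) => _ _ /=; split => //.
  - by rewrite lt_min !divr_gt0.
  - by rewrite ge_min lexx orbT.
  - exists i => u; rewrite le_min => /andP[ut _].
    have := ht (u - w'); rewrite [w' + _]addrC subrK => h.
    have {}h : cabs (F i u - F i w') <= (cabs (F i w') - m%:R) / 2 by apply: h; lra.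
    by have := cabsBr (F i w') (F i u); rewrite cabsC; lra.
have [G hG] := choice (fun mp : nat * (C * R) => step mp.1 mp.2).
pose p := fix p m := if m is k.+1 then G (k, p k) else ((0, 1) : C * R).
have p0 : p 0%N = (0, 1) by [].
have pS m : p m.+1 = G (m, p m) by [].
clearbody p.
have inv m : cabs (p m).1 < sg /\ 0 < (p m).2.
  elim: m => [|m [h1 h2]]; first by rewrite p0 cabs0.
  by rewrite pS; have [] := hG (m, p m) h1 h2.
have stp m := hG (m, p m) (inv m).1 (inv m).2.
rewrite /= in stp; have {}stp m := eq_ind_r (fun q => [/\ cabs q.1 < sg, 0 < q.2,
  q.2 <= (p m).2 / 2, cabs (q.1 - (p m).1) <= (p m).2 / 2 &
  exists i, forall u, cabs (u - q.1) <= q.2 -> m%:R < cabs (F i u)]) (stp m) (pS m).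
have r_le m : (p m).2 <= 2^-1 ^+ m.
  elim: m => [|m IH]; first by rewrite p0.
  by have [_ _ h _ _] := stp m; rewrite exprSr (le_trans h)//; lra.
have near_le m : cabs ((p m.+1).1 - (p m).1) <= 2^-1 ^+ m.
  have [_ _ _ h _] := stp m; apply: (le_trans h).
  by have := r_le m; have := (inv m).2; lra.
have [|x hx] := @geometric_cauchy_limit R (fun m => complex.Re (p m).1).
  by move=> m; rewrite -complex_ReB (le_trans (Re_le_cabs _)).
have [|y hy] := @geometric_cauchy_limit R (fun m => complex.Im (p m).1).
  by move=> m; rewrite -complex_ImB (le_trans (Im_le_cabs _)).
pose l : C := Complex x y.
have pl m : cabs ((p m).1 - l) <= 4 * 2^-1 ^+ m.
  apply: (le_trans (cabs_le_ReIm _)); have := hx m; have := hy m.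
  by rewrite complex_ReB complex_ImB /=; lra.
(* Each move is at most half the radius and the radius at least halves, so the discs are nested and
   all contain the limit. *)
have nested m n : cabs ((p (m + n)%N).1 - (p m).1) <= (p m).2 - (p (m + n)%N).2.
  elim: n => [|n IH]; first by rewrite addn0 !subrr cabs0.
  have [_ _ h1 h2 _] := stp (m + n)%N; rewrite addnS.
  by have := cabs_tri (p (m + n).+1).1 (p (m + n)%N).1 (p m).1; lra.
have lp m : cabs (l - (p m).1) <= (p m).2.
  apply: eps_le => e e0; have [n hn] : exists n, 2^-1 ^+ n < e / 4.
    by apply: half_exp_lt; rewrite divr_gt0.
  have := cabs_tri l (p (m + n)%N).1 (p m).1; have := nested m n.
  have := pl (m + n)%N; rewrite (cabsC l (p (m + n)%N).1); have := (inv (m + n)%N).2.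
  have : 2^-1 ^+ (m + n) <= 2^-1 ^+ n :> R.
    by rewrite exprD ler_piMl ?exprn_ge0// exprn_ile1//; lra.
  lra.
have lr : cabs l < r.
  apply: le_lt_trans sgr; apply: eps_le => e e0.
  have [n hn] : exists n, 2^-1 ^+ n < e / 4 by apply: half_exp_lt; rewrite divr_gt0.
  have := cabsBr l (p n).1; have := pl n; rewrite cabsC; have := (inv n).1; lra.
have [M hM] := FM _ lr.
have [_ _ _ _ [i hi]] := stp (Num.truncn M).+1.
have := hi l (lp _); rewrite ltNge => /negP; apply.
by rewrite (le_trans (hM i))// ltW// truncnS_gt.
Qed.

End BaireBound.

(** * Hartogs' lemma in several variables *)

Section SeveralVariables.
Context {R : realType} {I : finType}.
Local Notation C := R[i].
Implicit Types (y z : I -> C) (s : seq I).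

Definition upd z (j : I) (w : C) : I -> C := fun i => if i == j then w else z i.

Definition separately_holomorphic (f : (I -> C) -> C) (r : R) :=
  forall z j, (forall i, cabs (z i) < r) -> complex_diff (fun w => f (upd z j w)) (z j).

Lemma upd_upd z j w w' : upd (upd z j w) j w' = upd z j w'.
Proof. by apply/funext => i; rewrite /upd; case: eqP. Qed.

Lemma upd_id z j : upd z j (z j) = z.
Proof. by apply/funext => i; rewrite /upd; case: eqP => [->|]. Qed.

Lemma updC z j k w w' : j != k -> upd (upd z j w) k w' = upd (upd z k w') j w.
Proof.
move=> jk; apply/funext => i; rewrite /upd.
by have [->|//] := eqVneq i k; rewrite eq_sym (negbTE jk).
Qed.

Lemma upd_lt z j w (r : R) : (forall i, cabs (z i) < r) -> cabs w < r ->
  forall i, cabs (upd z j w i) < r.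
Proof. by move=> zr wr i; rewrite /upd; case: eqP. Qed.

Lemma separately_holomorphic_upd f r z j w : separately_holomorphic f r ->
  (forall i, cabs (z i) < r) -> cabs w < r ->
  complex_diff (fun w => f (upd z j w)) w.
Proof.
move=> hf zr wr; have := hf _ j (upd_lt j zr wr).
have -> : upd z j w j = w by rewrite /upd eqxx.
by under eq_fun do rewrite upd_upd.
Qed.

(** Induction on the list [s] of moving variables, the others being frozen at [y]. The
    configurations of the variables already treated form the index set of [hartogs_lemma] for the
    next one, and the induction hypothesis is its pointwise assumption. Each step spends part of the
    gap between [B] and [B'], hence the quantification over [B']. *)
Lemma hartogs_lemma_several (a : nat -> (I -> C) -> C) (R0 r A B B' : R) :
  0 <= r -> r < R0 -> 0 < B -> B < B' ->
  (forall k, separately_holomorphic (a k) R0) ->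
  (forall k z, (forall i, cabs (z i) < R0) -> cabs (a k z) <= A ^+ k) ->
  (forall z, (forall i, cabs (z i) < R0) ->
     exists k0, forall k, (k0 <= k)%N -> cabs (a k z) <= B ^+ k) ->
  exists k0, forall k z, (k0 <= k)%N -> (forall i, cabs (z i) <= r) ->
    cabs (a k z) <= B' ^+ k.
Proof.
move=> r0 rR B0 + ad aA aB.
suff H s : forall B', B < B' -> forall y, (forall i, cabs (y i) < R0) ->
    exists k0, forall k z, (k0 <= k)%N ->
    (forall i, i \in s -> cabs (z i) <= r) -> (forall i, i \notin s -> z i = y i) ->
    cabs (a k z) <= B' ^+ k.
  move=> BB'; have [|k0 hk0] := H (enum I) B' BB' (fun=> 0).
    by move=> i; rewrite cabs0 (le_lt_trans r0).
  exists k0 => k z kk zr; apply: hk0 => // i.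
  by rewrite mem_enum.
elim: s => [|j s IH] {}B' BB' y yR.
  have [k0 hk0] := aB y yR; exists k0 => k z kk _ zy.
  have -> : z = y by apply/funext => i; exact: zy.
  by rewrite (le_trans (hk0 k kk))//; apply: lerXn2r; rewrite ?nnegrE; lra.
have [js|js] := boolP (j \in s).
  have [k0 hk0] := IH B' BB' y yR; exists k0 => k z kk z1 z2; apply: hk0 => // i h.
    by apply: z1; rewrite inE h orbT.
  by apply: z2; rewrite inE negb_or h andbT; apply: contraNneq h => ->.
have [B1 BB1 B1B'] : exists2 B1, B < B1 & B1 < B' by exists ((B + B') / 2); lra.
pose T := {z : I -> C | [/\ forall i, cabs (z i) < R0,
  forall i, i \in s -> cabs (z i) <= r & forall i, i \notin j :: s -> z i = y i]}.
have [|||||||k0 hk0] := @hartogs_lemma _ T (fun k (z : T) w => a k (upd (sval z) j w)) R0 r A B1 B'.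
- by [].
- by [].
- by lra.
- by [].
- by move=> k [z [z1 z2 z3]] w wR; exact: separately_holomorphic_upd.
- by move=> k [z [z1 z2 z3]] w wR; apply: aA; exact: upd_lt.
- move=> w wR; have [|k0 hk0] := IH B1 BB1 (upd y j w); first exact: upd_lt.
  exists k0 => k [z [z1 z2 z3]] kk; apply: hk0 => //= i h; rewrite /upd.
    by case: eqP => [ij|_]; [rewrite -ij h in js|exact: z2].
  by case: eqP => // /eqP ij; apply: z3; rewrite inE negb_or ij.
exists k0 => k z kk z1 z2.
have zT : [/\ forall i, cabs (z i) < R0,
  forall i, i \in s -> cabs (z i) <= r & forall i, i \notin j :: s -> z i = y i].
  split => // [i|i h]; last by apply: z1; rewrite inE h orbT.
  have [h|h] := boolP (i \in j :: s); first exact: le_lt_trans (z1 _ h) rR.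
  by rewrite z2.
have := hk0 k (exist _ z zT) (z j) kk; rewrite /= upd_id; apply.
by apply: z1; rewrite inE eqxx.
Qed.

End SeveralVariables.

(** * Local boundedness of separately holomorphic functions *)

Section HartogsTheorem.
Context {R : realType} {I : finType}.
Local Notation C := R[i].
Implicit Types (y z : I -> C) (s : seq I).

Lemma cdiff_cst (c z : C) : complex_diff (fun=> c) z.
Proof. by exists 0; exact: cderiv_cst. Qed.

Lemma cdiffZ (c : C) (g : C -> C) (z : C) : complex_diff g z -> complex_diff (fun w => c * g w) z.
Proof. by move=> [d hd]; exists (0 * g z + c * d); apply: cderivM => //; exact: cderiv_cst. Qed.

Lemma cdiff_shift (g : C -> C) (c z : C) :
  complex_diff g (c + z) -> complex_diff (fun w => g (c + w)) z.
Proof. by move=> [d hd]; exists d; exact: cderiv_shift. Qed.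

(* Power series coefficients that are geometrically bounded from some rank on
   give a bound for the sum that does not depend on the function. *)
Lemma power_series_bound (W x eta : R) (k0 : nat) :
  0 < W -> 0 < x -> x < 1 -> 0 < eta ->
  exists K, forall (g : C -> C) (rho r M : R) (w : C),
    0 < rho -> rho < r -> W < rho -> cabs w <= W ->
    (forall z : C, cabs z < r -> complex_diff g z) ->
    (forall z : C, cabs z = rho -> cabs (g z) <= M) ->
    (forall k, cabs (taylor_coef g rho k) <= eta ^- k) ->
    (forall k, (k0 <= k)%N -> cabs (taylor_coef g rho k) <= (x / W) ^+ k) ->
    cabs (g w) <= K.
Proof.
move=> W0 x0 x1 eta0.
(* The sum covers the indices below [k0], bounded only by [eta ^- k]; the 1 covers all others. *)
pose A := \sum_(k < k0) (W / eta / x) ^+ k + 1.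
have term0 k : 0 <= (W / eta / x) ^+ k by nonneg.
have A1 : 1 <= A by rewrite /A lerDr sumr_ge0.
exists (A / (1 - x)) => g rho r M w rho0 rhor Wrho wW gd gM small_eta small_x.
have wrho : cabs w < rho by exact: le_lt_trans Wrho.
have M0 : 0 <= M by apply: le_trans (cabs_ge0 _) (gM rho%:C%C _); rewrite cabs_real gtr0_norm.
have termle k : cabs (taylor_coef g rho k * w ^+ k) <= A * x ^+ k.
  rewrite cabsM cabsX; have wk : cabs w ^+ k <= W ^+ k.
    by apply: lerXn2r; rewrite ?nnegrE// ltW.
  apply: (@le_trans _ _ (cabs (taylor_coef g rho k) * W ^+ k)).
    by rewrite ler_wpM2l.
  have Wk0 : 0 <= W ^+ k by nonneg.
  have [kk|kk] := leqP k0 k.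
    apply: (le_trans (ler_wpM2r Wk0 (small_x k kk))).
    rewrite -exprMn divfK ?gt_eqF// ler_peMl//; nonneg.
  apply: (le_trans (ler_wpM2r Wk0 (small_eta k))).
  have -> : eta ^- k * W ^+ k = (W / eta / x) ^+ k * x ^+ k.
    by rewrite -exprMn divfK ?gt_eqF// exprMn exprVn mulrC.
  rewrite ler_wpM2r//; [by nonneg|].
  rewrite /A (bigD1 (Ordinal kk)) //= -addrA lerDl addr_ge0// sumr_ge0//.
apply: eps_le => e e0.
pose K := M * (rho / (rho - cabs w)).
have rw0 : 0 < rho - cabs w by rewrite subr_gt0.
have K0 : 0 <= K by rewrite /K; nonneg.
have [||||n hn] := @geometric_small R K (cabs w / rho) e.
- nonneg.
- by rewrite ltr_pdivrMr ?mul1r.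
- exact: K0.
- exact: e0.
have T := taylor_expansion n rho0 rhor wrho gd gM.
have {T} T : cabs (g w - \sum_(k < n) taylor_coef g rho k * w ^+ k) <= e.
  by apply: (le_trans T); rewrite mulrAC.
have sumle : cabs (\sum_(k < n) taylor_coef g rho k * w ^+ k) <= A / (1 - x).
  apply: (le_trans (cabs_sum _ _ _)).
  apply: (@le_trans _ _ (\sum_(k < n) A * x ^+ k)).
    by apply: ler_sum => k _; exact: termle.
  rewrite -mulr_sumr ler_wpM2l//; first by lra.
  have x1' : 0 < 1 - x by rewrite subr_gt0.
  rewrite -[leRHS]mul1r ler_pdivlMr//.
  have -> : (\sum_(i < n) x ^+ i) * (1 - x) = 1 - x ^+ n.
    by have := subrX1 x n; set S := \sum_(i < n) _; lra.
  by have : 0 <= x ^+ n by [nonneg]; lra.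
have -> : g w = (g w - \sum_(k < n) taylor_coef g rho k * w ^+ k) +
  \sum_(k < n) taylor_coef g rho k * w ^+ k by rewrite subrK.
by rewrite (le_trans (cabsD _ _))// addrC lerD.
Qed.

(** Induction on the list of moving variables. For a new variable [j] the induction hypothesis
    bounds the family of slices at each fixed value of [j], which is what Baire's argument asks
    for. *)
Theorem hartogs_bounded (f : (I -> C) -> C) (R0 : R) : separately_holomorphic f R0 ->
  forall r, 0 <= r -> r < R0 ->
  exists M, forall z, (forall i, cabs (z i) <= r) -> cabs (f z) <= M.
Proof.
move=> fhol.
suff H s : forall r, 0 <= r -> r < R0 -> forall y, (forall i, cabs (y i) < R0) ->
    exists M, forall z, (forall i, i \in s -> cabs (z i) <= r) ->
    (forall i, i \notin s -> z i = y i) -> cabs (f z) <= M.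
  move=> r r0 rR; have [|M hM] := H (enum I) r r0 rR (fun=> 0).
    by move=> i; rewrite cabs0 (le_lt_trans r0).
  by exists M => z zr; apply: hM => // i; rewrite mem_enum.
elim: s => [|j s IH] r r0 rR y yR.
  exists (cabs (f y)) => z _ zy.
  by have -> : z = y by apply/funext => i; exact: zy.
have [js|js] := boolP (j \in s).
  have [M hM] := IH r r0 rR y yR; exists M => z z1 z2; apply: hM => // i h.
    by apply: z1; rewrite inE h orbT.
  by apply: z2; rewrite inE negb_or h andbT; apply: contraNneq h => ->.
(* Eight steps lead from [r] to [R0]; all radii below are spaced by them. *)
pose de := (R0 - r) / 8; have de0 : 0 < de by rewrite /de; lra.
have R0E : R0 = r + 8 * de by rewrite /de; lra.
pose r1 := r + 4 * de.
have r10 : 0 <= r1 by rewrite /r1; lra.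
have r1R : r1 < R0 by rewrite /r1; lra.
pose mg z : I -> C := fun i => if i \in s then z i else y i.
pose T := {z : I -> C | forall i, cabs (z i) <= r1}.
have mgR z : (forall i, cabs (z i) <= r1) -> forall i, cabs (mg z i) < R0.
  by move=> zr i; rewrite /mg; case: ifP => // _; exact: le_lt_trans (zr i) r1R.
have [|||w1 [eta0 [M0 [w1de eta00 hM0]]]] :=
  @baire_bounded_disc R T (fun (z : T) w => f (upd (mg (sval z)) j w)) R0 de de0.
- by lra.
- by move=> [z zr] w wR; exact: (separately_holomorphic_upd (z := mg z) j fhol (mgR z zr) wR).
- move=> w wR; have [|M hM] := IH r1 r10 r1R (upd y j w); first exact: upd_lt.
  exists M => -[z zr]; apply: hM => /= i h.
    rewrite /upd /mg h; case: eqP => [ij|_]; [by rewrite -ij h in js|exact: zr].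
  by rewrite /upd /mg (negbTE h).
pose eta := Num.min eta0 de; pose M := Num.max M0 1.
have eta_gt0 : 0 < eta by rewrite lt_min eta00.
have etade : eta <= de by rewrite ge_min lexx orbT.
have etaeta0 : eta <= eta0 by rewrite ge_min lexx.
have M1 : 1 <= M by rewrite le_max lexx orbT.
have M00 : M0 <= M by rewrite le_max lexx.
have Mgt0 : 0 < M by lra.
clearbody eta M.
(* Recentred at the point from Baire's argument and divided by the bound: the coefficients are then
   at most [eta ^- k] with no factor in front, the form [A ^+ k] of Hartogs' lemma. *)
pose G z w := (M^-1)%:C%C * f (upd (mg z) j (w1 + w)).
have GM z w : (forall i, cabs (z i) <= r1) -> cabs w <= eta -> cabs (G z w) <= 1.
  move=> zr we; rewrite cabsM cabs_real gtr0_norm ?invr_gt0// mulrC ler_pdivrMr// mul1r.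
  apply: le_trans M00; apply: (hM0 (exist _ z zr)).
  by rewrite addrAC subrr add0r (le_trans we).
pose R2 := r + 7 * de; pose r2 := r + 5 * de; pose r3 := r + 4 * de; pose r4 := r + 3 * de.
have w1R w : cabs w < R2 -> cabs (w1 + w) < R0.
  by move=> wR; rewrite (le_lt_trans (cabsD _ _))// R0E; move: wR; rewrite /R2; lra.
have Gd z : (forall i, cabs (z i) <= r1) -> forall w, cabs w < R2 -> complex_diff (G z) w.
  move=> zr w wR; apply: cdiffZ; apply: (@cdiff_shift (fun v => f (upd (mg z) j v))).
  exact: (separately_holomorphic_upd j fhol (mgR z zr) (w1R w wR)).
have r2_gt0 : 0 < r2 by rewrite /r2; lra.
have r3_gt0 : 0 < r3 by rewrite /r3; lra.
have r4_gt0 : 0 < r4 by rewrite /r4; lra.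
have r2R2 : r2 < R2 by rewrite /r2 /R2; lra.
have etar2 : eta < r2 by rewrite /r2; lra.
pose a k z := taylor_coef (G z) eta k.
have aE k z : (forall i, cabs (z i) <= r1) -> a k z = taylor_coef (G z) r2 k.
  by move=> zr; rewrite /a; apply: taylor_coef_radius r2R2 (Gd z zr).
have a_eta k z : (forall i, cabs (z i) <= r1) -> cabs (a k z) <= (eta^-1) ^+ k.
  move=> zr; rewrite exprVn -[leRHS]mul1r; apply: taylor_coef_bound => // w we.
  by apply: GM => //; rewrite we.
have [||||||k0 hk0] := @hartogs_lemma_several R I a r1 r eta^-1 r3^-1 r4^-1 r0.
- by rewrite /r1; lra.
- by rewrite invr_gt0.
- by rewrite ltf_pV2 ?posrE// /r3 /r4; lra.
- move=> k z i zr.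
  have zi0 : 0 < r1 - cabs (z i) by rewrite subr_gt0.
  apply: (@taylor_coef_diff _ (fun t => G (upd z i t)) (z i) (r1 - cabs (z i)) eta 1) => //.
    move=> w t we ht; have tr1 : cabs t < r1 by have := cabsBr t (z i); lra.
    have wR2 : cabs w < R2 by rewrite we /R2; lra.
    (* [mg] ignores a variable outside [s], so that slice is constant. *)
    apply: cdiffZ; have [si|si] := boolP (i \in s); last first.
      have mgE t' : mg (upd z i t') = mg z.
        apply/funext => l; rewrite /mg /upd; case: ifP => // ls.
        by case: eqP => // li; rewrite -li ls in si.
      by under eq_fun do rewrite mgE; exact: cdiff_cst.
    have ji : j != i by apply: contraNneq js => ->.
    have mgE t' : upd (mg (upd z i t')) j (w1 + w) = upd (upd (mg z) j (w1 + w)) i t'.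
      rewrite updC//; congr (upd _ j _); apply/funext => l; rewrite /mg /upd.
      by case: (eqVneq l i) => [->|//]; rewrite si.
    under eq_fun do rewrite mgE.
    have vR : forall l, cabs (upd (mg z) j (w1 + w) l) < R0.
      by apply: upd_lt; [apply: mgR => l; exact: ltW|exact: w1R].
    exact: (separately_holomorphic_upd i fhol vR (lt_trans tr1 r1R)).
  move=> w t we ht; have tr1 : cabs t < r1 by have := cabsBr t (z i); lra.
  by apply: GM; [move=> l; apply/ltW; exact: upd_lt|rewrite we].
- by move=> k z zr; apply: a_eta => i; exact: ltW.
- move=> z zr; have {}zr i : cabs (z i) <= r1 by exact: ltW.
  have [Mz Mz0 hMz] : exists2 Mz : R, 0 < Mz & forall w, cabs w <= r2 -> cabs (G z w) <= Mz.
    by apply: disc_bounded => w wr; apply: Gd => //; exact: le_lt_trans r2R2.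
  (* The factor [Mz], which depends on [z], is absorbed by passing from the rate [r2^-1] to
     [r3^-1]. *)
  have [||||k0 hk0] := @geometric_small R Mz (r3 / r2) 1.
  + nonneg.
  + by rewrite ltr_pdivrMr// mul1r /r2 /r3; lra.
  + exact: ltW.
  + by [].
  exists k0 => k kk; rewrite aE//.
  have hMz' w : cabs w = r2 -> cabs (G z w) <= Mz by move=> wr; apply: hMz; rewrite wr.
  apply: (le_trans (taylor_coef_bound k r2_gt0 hMz')).
  rewrite exprVn -[leRHS]mul1r ler_pdivlMr ?exprn_gt0//.
  have -> : Mz * r2 ^- k * r3 ^+ k = Mz * (r3 / r2) ^+ k by rewrite exprMn exprVn mulrAC mulrA.
  apply: le_trans hk0; rewrite ler_wpM2l ?(ltW Mz0)//.
  apply: ler_wiXn2l => //; first by nonneg.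
  by rewrite ler_pdivrMr// mul1r /r2 /r3; lra.
have W0 : 0 < r + de by lra.
have x0 : 0 < (r + de) / r4 by rewrite divr_gt0.
have x1 : (r + de) / r4 < 1 by rewrite ltr_pdivrMr// mul1r /r4; lra.
have [K hK] := power_series_bound k0 W0 x0 x1 eta_gt0.
exists (M * K) => z z1 z2.
(* The value 0 outside [s] serves to meet the bound [r1]; [mg] replaces it by [y]. *)
pose z' i := if i \in s then z i else 0.
have z'r i : cabs (z' i) <= r.
  by rewrite /z'; case: ifP => [h|]; [apply: z1; rewrite inE h orbT|rewrite cabs0].
have z'r1 i : cabs (z' i) <= r1 by rewrite (le_trans (z'r i))// /r1; lra.
have zE : f z = M%:C%C * G z' (z j - w1).
  rewrite /G mulrA -rmorphM mulfV ?gt_eqF// rmorph1 mul1r addrC subrK; congr f.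
  apply/funext => i; rewrite /upd /mg /z'; case: eqP => [->//|/eqP ij].
  by case: ifP => [->//|si]; apply: z2; rewrite inE negb_or ij si.
rewrite zE cabsM cabs_real gtr0_norm// ler_pM2l//.
have [Mz Mz0 hMz] : exists2 Mz : R, 0 < Mz & forall w, cabs w <= r2 -> cabs (G z' w) <= Mz.
  by apply: disc_bounded => w wr; apply: Gd => //; exact: le_lt_trans r2R2.
apply: (hK (G z') r2 R2 Mz (z j - w1)) => //.
- by rewrite /r2; lra.
- have : cabs (z j) <= r by apply: z1; rewrite inE eqxx.
  by have := cabsB (z j) w1; lra.
- exact: Gd.
- by move=> w wr; apply: hMz; rewrite wr.
- by move=> k; rewrite -aE// -exprVn; exact: a_eta.
- move=> k kk; rewrite -aE// mulrAC mulfV ?gt_eqF// mul1r; exact: hk0.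
Qed.

End HartogsTheorem.

(** * Second order estimates for bounded separately holomorphic functions *)

Section SeveralVariablesTaylor.
Context {R : realType} {I : finType}.
Local Notation C := R[i].
Variables (F : (I -> C) -> C) (D : I -> (I -> C) -> C) (r M : R).
Hypotheses (r0 : 0 < r)
  (FD : forall z j, (forall i, cabs (z i) < r) ->
    complex_derivative (fun w => F (upd z j w)) (z j) (D j z))
  (FM : forall z, (forall i, cabs (z i) < r) -> cabs (F z) <= M).

Let N : R := #|I|%:R.
(** The constant [4 * M / r] of [cauchy_estimates], for discs of radius [r / 2]. *)
Let L := 8 * M / r.

Let M0 : 0 <= M.
Proof. by apply: le_trans (cabs_ge0 _) (FM (z := fun=> 0) _) => i; rewrite cabs0. Qed.

Let L0 : 0 <= L. Proof. by rewrite /L; nonneg. Qed.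

Let FD_upd z j w : (forall i, cabs (z i) < r) -> cabs w < r ->
  complex_derivative (fun w => F (upd z j w)) w (D j (upd z j w)).
Proof.
move=> zr wr; have := FD j (upd_lt j zr wr).
have -> : upd z j w j = w by rewrite /upd eqxx.
by under eq_fun do rewrite upd_upd.
Qed.

Lemma one_variable_estimates z j h : (forall i, cabs (z i) <= r / 2) -> cabs h <= r / 8 ->
  cabs (F (upd z j (z j + h)) - F z) <= L * cabs h /\
  cabs (F (upd z j (z j + h)) - F z - D j z * h) <= 32 * M / r ^+ 2 * cabs h ^+ 2.
Proof.
have r_gt0 := r0; move=> zr hr; have r20 : 0 < r / 2 by rewrite divr_gt0.
have zr' i : cabs (z i) < r by rewrite (le_lt_trans (zr i))//; lra.
have wr w : cabs (w - z j) < r / 2 -> cabs w < r.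
  by have := cabsBr w (z j); have := zr j; lra.
have hr' : cabs h <= r / 2 / 4 by lra.
have [||_] := @cauchy_estimates _ (fun w => F (upd z j w)) (z j) (D j z) h (r / 2) M
  r20 _ _ (FD j zr') hr'.
- by move=> w /wr wr'; exists (D j (upd z j w)); exact: FD_upd.
- by move=> w /wr wr'; apply: FM; exact: upd_lt.
rewrite upd_id /L => h1 h2; split.
  by have -> : 8 * M / r = 4 * M / (r / 2) by field; rewrite gt_eqF.
by have -> : 32 * M / r ^+ 2 = 8 * M / (r / 2) ^+ 2 by field; rewrite gt_eqF.
Qed.

(** A path from [q] to [p] that changes one coordinate at a time, so that one-variable estimates add
    up. *)
Let mix (s : seq I) (p q : I -> C) : I -> C := fun i => if i \in s then p i else q i.

Let mix_cons s p q j : mix (j :: s) p q = upd (mix s p q) j (p j).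
Proof.
apply/funext => i; rewrite /mix /upd inE.
by have [->|] := eqVneq i j.
Qed.

Let mix_le s p q (a : R) : (forall i, cabs (p i) <= a) -> (forall i, cabs (q i) <= a) ->
  forall i, cabs (mix s p q i) <= a.
Proof. by move=> pa qa i; rewrite /mix; case: ifP. Qed.

Let mix_enum p q : mix (enum I) p q = p.
Proof. by apply/funext => i; rewrite /mix mem_enum. Qed.

Lemma several_lipschitz p q (t : R) : (forall i, cabs (p i) <= r / 2) ->
  (forall i, cabs (q i) <= r / 2) -> t <= r / 8 ->
  (forall i, cabs (p i - q i) <= t) -> cabs (F p - F q) <= N * (L * t).
Proof.
have r_gt0 := r0; move=> pr qr tr pq.
have Ht (j : I) : 0 <= t by exact: (le_trans (cabs_ge0 (p j - q j)) (pq j)).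
suff H s : uniq s -> cabs (F (mix s p q) - F q) <= (size s)%:R * (L * t).
  by have := H (enum I) (enum_uniq I); rewrite mix_enum -cardE.
elim: s => [|j s IH] /=.
  by move=> _; rewrite (_ : mix [::] p q = q) ?subrr ?cabs0 ?mul0r//; apply/funext.
move=> /andP[js us]; rewrite mix_cons.
have mj : mix s p q j = q j by rewrite /mix (negbTE js).
have := one_variable_estimates (h := p j - q j) j (mix_le s pr qr) (le_trans (pq j) tr).
rewrite mj [q j + _]addrC subrK => -[h1 _].
apply: (le_trans (cabs_tri _ (F (mix s p q)) _)).
rewrite -[(size s).+1%:R]natr1 [leRHS]mulrDl mul1r [leRHS]addrC lerD ?IH//.
by apply: (le_trans h1); rewrite ler_wpM2l.
Qed.

(** The bound [2 * M / r] of [cauchy_estimates], for a function at most [N * (L * t)] on a disc of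
    radius [r / 4], divided by [t]. *)
Let K1 := 8 * N * L / r.

(** The difference of the two derivatives is the derivative at 0 of [phi], a difference of two
    slices of [F]. By [several_lipschitz] it is of order [t], and Cauchy's estimate passes this on
    to its derivative. *)
Lemma derivative_lipschitz z j (t : R) : t <= r / 8 ->
  (forall i, cabs (z i) <= t) -> cabs (D j z - D j (fun=> 0)) <= K1 * t.
Proof.
have r_gt0 := r0; move=> tr zt; have t0 : 0 <= t by exact: (le_trans (cabs_ge0 (z j)) (zt j)).
pose zero : I -> C := fun=> 0.
have zero_lt i : cabs (zero i) < r by rewrite cabs0.
have zr i : cabs (z i) < r by rewrite (le_lt_trans (zt i))//; lra.
pose phi h := F (upd z j (z j + h)) + -1 * F (upd zero j h).
have r40 : 0 < r / 4 by rewrite divr_gt0.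
have dphi h : cabs h < r / 4 ->
    complex_derivative phi h (D j (upd z j (z j + h)) + (0 * F (upd zero j h) +
      -1 * D j (upd zero j h))).
  move=> hr; apply: cderivD.
    apply: (@cderiv_shift _ (fun w => F (upd z j w))); apply: FD_upd => //.
    by rewrite (le_lt_trans (cabsD _ _))//; have := zt j; lra.
  apply: (@cderivM _ (fun=> -1)); first exact: cderiv_cst.
  by apply: FD_upd => //; lra.
have phiM h : cabs (h - 0) < r / 4 -> cabs (phi h) <= N * (L * t).
  rewrite subr0 => hr; rewrite /phi mulN1r; apply: several_lipschitz => // i; rewrite /upd.
  - case: eqP => _; last by have := zt i; lra.
    by rewrite (le_trans (cabsD _ _))//; have := zt j; lra.
  - by case: eqP => _; rewrite ?cabs0; lra.
  - by case: eqP => _; rewrite ?addrK ?subr0.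
have d0 := dphi 0; rewrite cabs0 in d0; have {}d0 := d0 r40.
have h0 : cabs (0 : C) <= r / 4 / 4 by rewrite cabs0; lra.
have [|h1 _ _] := @cauchy_estimates _ phi 0 _ 0 (r / 4) (N * (L * t)) r40 _ phiM d0 h0.
  by move=> h; rewrite subr0 => /dphi hh; eexists; exact: hh.
move: h1; rewrite mul0r add0r mulN1r addr0 upd_id.
rewrite (_ : upd zero j 0 = zero); last by rewrite -[RHS](upd_id zero j).
move=> /le_trans; apply; rewrite /K1 le_eqVlt; apply/orP; left; apply/eqP.
by field; rewrite gt_eqF.
Qed.

(** Each change of a coordinate uses the derivative at the current intermediate point;
    [derivative_lipschitz] replaces it by the one at 0, at a cost of order [t] times
    [cabs (z j)]. *)
Lemma several_taylor z (t : R) : t <= r / 8 -> (forall i, cabs (z i) <= t) ->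
  cabs (F z - F (fun=> 0) - \sum_j D j (fun=> 0) * z j) <=
  N * ((32 * M / r ^+ 2 + K1) * t ^+ 2).
Proof.
have r_gt0 := r0; move=> tr zt; pose zero : I -> C := fun=> 0.
suff H s : uniq s -> cabs (F (mix s z zero) - F zero - \sum_(j <- s) D j zero * z j) <=
    (size s)%:R * ((32 * M / r ^+ 2 + K1) * t ^+ 2).
  by have := H (enum I) (enum_uniq I); rewrite mix_enum -cardE big_enum.
elim: s => [|j s IH] /=.
  move=> _; rewrite (_ : mix [::] z zero = zero); last exact/funext.
  by rewrite big_nil !subrr cabs0 mul0r.
move=> /andP[js us]; rewrite mix_cons big_cons.
have t0 : 0 <= t by exact: (le_trans (cabs_ge0 (z j)) (zt j)).
set y := mix s z zero; have yt i : cabs (y i) <= t.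
  by apply: mix_le => // k; rewrite cabs0.
have yr i : cabs (y i) <= r / 2 by rewrite (le_trans (yt i))//; lra.
have yj : y j = 0 by rewrite /y /mix (negbTE js).
have := one_variable_estimates j yr (le_trans (zt j) tr).
rewrite yj add0r => -[_ h1].
have h2 := derivative_lipschitz j tr yt.
have -> : F (upd y j (z j)) - F zero - (D j zero * z j + \sum_(k <- s) D k zero * z k) =
  (F (upd y j (z j)) - F y - D j y * z j) + (D j y - D j zero) * z j +
  (F y - F zero - \sum_(k <- s) D k zero * z k) by ring.
rewrite (le_trans (cabsD _ _))// -[(size s).+1%:R]natr1 [leRHS]mulrDl mul1r [leRHS]addrC lerD ?IH//.
rewrite (le_trans (cabsD _ _))// [leRHS]mulrDl lerD//.
  apply: (le_trans h1); rewrite ler_wpM2l//; first by nonneg.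
  by apply: lerXn2r; rewrite ?nnegrE.
by rewrite cabsM expr2 mulrA ler_pM ?zt.
Qed.

End SeveralVariablesTaylor.

(** * A square root of -1 in the even part *)

Section ImaginaryUnit.
Context {R : rcfType} {A : comNzRingType} (iota : {rmorphism R -> A}).
Hypothesis integral : forall a : A,
  exists2 p : {poly R}, p != 0 & (map_poly iota p).[a] = 0.
(** A measure that makes the splitting of idempotents terminate. *)
Variable rk : A -> nat.
Hypothesis rk_idempotent : forall e e' : A, e * e = e -> e' * e' = e' -> e' * e = e' ->
  e' != e -> (rk e' < rk e)%N.
Implicit Types (x y e : A).

Local Notation ev p x := (map_poly iota p).[x].

Definition nilp x := exists n, x ^+ n = 0.

Lemma nilp_mul x y : nilp x -> nilp (x * y).
Proof. by move=> [n xn]; exists n; rewrite exprMn xn mul0r. Qed.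

Lemma nilp_add x y : nilp x -> nilp y -> nilp (x + y).
Proof.
move=> [n xn] [m ym]; exists (n + m)%N; rewrite exprDn big1// => i _.
have [mi|im] := leqP m i; first by rewrite -(subnK mi) exprD ym !mulr0 mul0rn.
have ni : (n <= n + m - i)%N by rewrite -addnBA ?leq_addr// ltnW.
by rewrite -(subnK ni) exprD xn mulr0 mul0r mul0rn.
Qed.

Lemma nilp_sum (I : Type) (s : seq I) (F : I -> A) :
  (forall i, nilp (F i)) -> nilp (\sum_(i <- s) F i).
Proof.
by move=> h; elim/big_ind : _ => //; [exists 1%N; rewrite expr1|exact: nilp_add].
Qed.

Definition primitive_idempotent e := [/\ e * e = e, e != 0 &
  forall e', e' * e' = e' -> e' * e = e' -> e' = 0 \/ e' = e].

(** Write an annihilating polynomial as q X^m with q(0) nonzero: solving for the constant term of q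
    shows that x^(m+1) divides x^m, and this iterates. The product [x ^+ m.+1 * y] is then
    idempotent. *)
Lemma fitting x : exists m y, x ^+ m.+1 = x ^+ m.+1 * x ^+ m.+1 * y.
Proof.
have [p p0 px] := integral x.
have [m [q]] := multiplicity_XsubC p 0; rewrite p0 /= => q0 pE.
have c0 : q.[0] != 0 by exact: q0.
have [s sE] : exists s, q - q.[0]%:P = s * ('X - 0%:P).
  by apply/factor_theorem; rewrite rootE !hornerE subrr.
have {}sE : q = q.[0]%:P + s * 'X by rewrite -[X in s * X]subr0 -sE addrC subrK.
pose y := - iota (q.[0])^-1 * ev s x.
have xm : x ^+ m = x ^+ m * x * y.
  move: px; rewrite pE subr0 rmorphM rmorphXn /= map_polyX hornerM hornerXn sE.
  rewrite rmorphD /= map_polyC /= rmorphM /= map_polyX hornerD hornerC hornerM hornerX => h.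
  have : iota (q.[0])^-1 * ((iota q.[0] + ev s x * x) * x ^+ m) = 0 by rewrite h mulr0.
  rewrite mulrA mulrDr -rmorphM mulVf// rmorph1 mulrDl mul1r => /eqP.
  by rewrite addr_eq0 => /eqP {1}->; rewrite /y; ring.
have step k : x ^+ m = x ^+ (m + k) * y ^+ k.
  elim: k => [|k IH]; first by rewrite addn0 expr0 mulr1.
  by rewrite addnS !exprS {1}IH exprD {1}xm; ring.
exists m, (y ^+ m.+1); rewrite {1}exprS (step m.+1) -exprD !addnS addSn !exprS.
by ring.
Qed.

(** The idempotent obtained from [fitting] lies below [e], so it is 0 or [e]: either [x] is
    nilpotent or it is a unit of the ring Ae. *)
Lemma primitive_local e x : primitive_idempotent e -> x * e = x ->
  nilp x \/ exists y, x * y = e.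
Proof.
move=> [ee e0 eprim] xe; have [m [y hm]] := fitting x.
set u := x ^+ m.+1 in hm.
have ue : u * e = u by rewrite /u exprSr -mulrA xe.
have [||u0|ue'] := eprim (u * y).
- by rewrite [RHS](congr1 ( *%R^~ y) hm); ring.
- by rewrite mulrAC ue.
- by left; exists m.+1; rewrite -/u hm -mulrA u0 mulr0.
- by right; exists (x ^+ m * y); rewrite -ue' /u exprS mulrA.
Qed.

Lemma quadratic_nilpotent e a : primitive_idempotent e -> a * e = a ->
  exists l m : R, nilp ((a - iota l * e) ^+ 2 + iota m ^+ 2 * e).
Proof.
move=> he ae; have [ee e0 _] := he; have [p p0 pa] := integral a.
have {}pa : e * ev p a = 0 by rewrite pa mulr0.
elim: {p}(size p) {-2}p (leqnn (size p)) p0 pa => [|k IH] p pk p0 pa.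
  by move: p0; rewrite -size_poly_eq0 -leqn0 pk.
have descend (q s : {poly R}) : p = q * s -> (1 < size s)%N -> s != 0 ->
    nilp (e * ev s a) \/ exists l m : R, nilp ((a - iota l * e) ^+ 2 + iota m ^+ 2 * e).
  move=> pE s1 s0; have q0 : q != 0 by apply: contraNneq p0 => q0; rewrite pE q0 mul0r.
  have [|h|[y hy]] := @primitive_local e (e * ev s a) he; [by rewrite mulrAC ee|by left|].
  right; apply: (IH q) => //.
    move: pk; rewrite pE size_mul//; case: (size s) s1 => [//|[//|t]] _.
    by rewrite !addnS /= ltnS => /(leq_trans (leq_addr _ _)).
  have -> : e * ev q a = e * ev p a * y.
    have -> : e * ev p a * y = ev q a * (e * ev s a * y).
      by rewrite pE rmorphM hornerM; ring.
    by rewrite hy mulrC.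
  by rewrite pa mul0r.
pose pC := map_poly (real_complex R) p.
have [s1|s1] := eqVneq (size p) 1%N.
  have /size_poly1P[c c0 pE] : size p == 1%N by apply/eqP.
  exfalso; move: pa; rewrite pE map_polyC hornerC => /(congr1 ( *%R^~ (iota c^-1))).
  by rewrite mul0r -mulrA -rmorphM mulfV// rmorph1 mulr1 => /eqP; exact/negP.
have /closed_rootP[z pz] : size pC != 1%N by rewrite size_map_poly.
case: z pz => l m pz.
have [m0|m0] := eqVneq m 0.
  have pl : root p l.
    by move: pz; rewrite m0 -[Complex l 0]/(real_complex R l) fmorph_root.
  have [q pE] := factor_theorem _ _ pl.
  have [||h|//] := descend _ _ pE; [by rewrite size_XsubC|by rewrite polyXsubC_eq0|].
  exists l, 0; rewrite rmorph0 expr0n /= mul0r addr0 expr2; apply: nilp_mul.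
  move: h; rewrite rmorphB /= map_polyX map_polyC hornerD hornerN hornerX hornerC /=.
  by rewrite mulrBr [e * a]mulrC ae [e * _]mulrC.
pose z := Complex l m; pose zb := Complex l (- m).
have zzb : z != zb.
  by apply/eqP => -[] mm; move/eqP: m0; apply; lra.
pose Q : {poly R} := ('X - l%:P) ^+ 2 + (m ^+ 2)%:P.
have QE : map_poly (real_complex R) Q = ('X - z%:P) * ('X - zb%:P).
  rewrite /Q rmorphD rmorphXn rmorphB /= map_polyX !map_polyC /=.
  have e1 : (real_complex R l)%:P * 2 = (z%:P + zb%:P : {poly R[i]}).
    rewrite -polyCD mulr_natr -polyCMn; congr (_%:P).
    by rewrite mulr2n; apply/eqP; rewrite eq_complex /= addrN addr0 !eqxx.
  have e2 : (real_complex R l)%:P ^+ 2 + (real_complex R (m ^+ 2))%:P = z%:P * zb%:P.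
    rewrite -polyC_exp -polyCD -polyCM; congr (_%:P).
    by apply/eqP; rewrite eq_complex /=; apply/andP; split; apply/eqP; ring.
  have -> : ('X - z%:P) * ('X - zb%:P) = 'X^2 - (z%:P + zb%:P) * 'X + z%:P * zb%:P by ring.
  by rewrite -e1 -e2; ring.
(* A real polynomial also vanishes at the conjugate root, so the real quadratic [Q] divides it. *)
have pzb : root pC zb.
  have -> : zb = conjc z by [].
  rewrite -complex_root_conj (_ : map_poly _ pC = pC)// /pC -map_poly_comp.
  by apply: eq_map_poly => t /=; rewrite oppr0.
have /dvdpP[q pE] : Q %| p.
  rewrite -(dvdp_map (real_complex R)) QE.
  have [q1 q1E] := factor_theorem _ _ pz.
  have : root (q1 * ('X - z%:P)) zb by rewrite -q1E.
  rewrite rootM root_XsubC eq_sym (negbTE zzb) orbF => /factor_theorem[q2 q2E].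
  by apply/dvdpP; exists q2; rewrite -/pC q1E q2E; ring.
have sQ : size Q = 3%N.
  by rewrite -(size_map_poly (real_complex R)) QE size_mul ?polyXsubC_eq0// !size_XsubC.
have [||h|//] := descend _ _ pE; [by rewrite sQ|by rewrite -size_poly_eq0 sQ|].
exists l, m; move: h; rewrite /Q rmorphD rmorphXn rmorphB /= map_polyX !map_polyC /=.
rewrite hornerD horner_exp hornerD hornerN hornerX !hornerC rmorphXn mulrDr.
rewrite [e * iota m ^+ 2]mulrC; congr (nilp (_ + _)).
have -> : a - iota l * e = (a - iota l) * e by rewrite mulrBl ae.
by rewrite exprMn [e ^+ 2]expr2 ee mulrC.
Qed.

(* Newton's iteration for j^2 = -e is u |-> u + u (u^2 + e) / 2. *)
Lemma newton_sqrt n u e : e * e = e -> u * e = u -> (exists h : A, h + h = 1) ->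
  (u ^+ 2 + e) ^+ (2 ^ n) = 0 -> exists2 j, j * e = j & j ^+ 2 = - e.
Proof.
move=> ee + [h hh]; elim: n u => [|n IH] u ue.
  by rewrite expn0 expr1 => /eqP; rewrite addr_eq0 => /eqP ?; exists u.
move=> N0; pose N := u ^+ 2 + e.
have Ne : N * e = N by rewrite /N mulrDl ee expr2 -mulrA ue.
have u2 : u ^+ 2 = N - e by rewrite /N addrK.
apply: (IH (u * (1 + h * N))); first by rewrite mulrAC ue.
(* The new error is a multiple of [N ^+ 2], so the exponent of nilpotency halves. *)
have -> : (u * (1 + h * N)) ^+ 2 + e = N ^+ 2 * ((h + h) - h ^+ 2 + h ^+ 2 * N).
  have -> : (u * (1 + h * N)) ^+ 2 + e =
    (N - e) * (1 + (h + h) * N + h ^+ 2 * N ^+ 2) + e by rewrite -u2; ring.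
  rewrite hh.
  have -> : (N - e) * (1 + 1 * N + h ^+ 2 * N ^+ 2) + e =
    N + N ^+ 2 + h ^+ 2 * N ^+ 3 - (N * e) - h ^+ 2 * N * (N * e) by ring.
  by rewrite Ne; ring.
by rewrite exprMn -exprM -expnS N0 mul0r.
Qed.

(** Induction on the rank of an idempotent [e], for a square root of [- e] in Ae. If [e] is not
    primitive, it splits into two orthogonal idempotents whose roots are added. If it is, some
    [a k * e] must have a non-real residue. *)
Lemma imaginary_unit (n : nat) (a : 'I_n -> A) : 1 + \sum_k a k ^+ 2 = 0 ->
  exists j : A, j ^+ 2 = -1.
Proof.
move=> asum.
suff H e : e * e = e -> exists2 j, j * e = j & j ^+ 2 = - e.
  by have [|j _] := H 1; [rewrite mulr1|exists j].
have [m] := ubnP (rk e); elim: m e => // m IH e; rewrite ltnS => em ee.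
have [->|e0] := eqVneq e 0; first by exists 0; rewrite ?mul0r// expr0n oppr0.
have [prim|nprim] := pselect (primitive_idempotent e); last first.
  have [e' [e'e' e'e e'0 e'ne]] : exists e', [/\ e' * e' = e', e' * e = e', e' != 0 & e' != e].
    apply: contrapT => h; apply: nprim; split => // e' h1 h2.
    have [->|h3] := eqVneq e' 0; first by left.
    have [->|h4] := eqVneq e' e; first by right.
    by exfalso; apply: h; exists e'.
  have [j' j'e' j'2] := IH e' (leq_trans (rk_idempotent ee e'e' e'e e'ne) em) e'e'.
  pose e'' := e - e'.
  have e''e'' : e'' * e'' = e''.
    have -> : e'' * e'' = e * e - e' * e - e' * e + e' * e' by rewrite /e''; ring.
    by rewrite ee e'e e'e' /e''; ring.
  have e''e : e'' * e = e'' by rewrite /e'' mulrBl ee e'e.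
  have e''ne : e'' != e by rewrite /e'' -subr_eq0 addrAC subrr add0r oppr_eq0.
  have [j'' j''e'' j''2] := IH e'' (leq_trans (rk_idempotent ee e''e'' e''e e''ne) em) e''e''.
  have e'e'' : e' * e'' = 0 by rewrite /e'' mulrBr e'e e'e' subrr.
  have jj : j' * j'' = 0.
    have -> : j' * j'' = (j' * e') * (j'' * e'') by rewrite j'e' j''e''.
    have -> : (j' * e') * (j'' * e'') = j' * j'' * (e' * e'') by ring.
    by rewrite e'e'' mulr0.
  exists (j' + j'').
    by rewrite mulrDl -{1}j'e' -mulrA e'e j'e' -{1}j''e'' -mulrA e''e j''e''.
  have -> : (j' + j'') ^+ 2 = j' ^+ 2 + j'' ^+ 2 + (j' * j'') *+ 2 by ring.
  by rewrite jj mul0rn addr0 j'2 j''2 /e''; ring.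
have half : exists h : A, h + h = 1.
  by exists (iota 2^-1); rewrite -rmorphD (_ : 2^-1 + 2^-1 = 1) ?rmorph1//; field.
pose b k := a k * e.
have be k : b k * e = b k by rewrite /b -mulrA ee.
have /choice[l hl] : forall k, exists lm : R * R,
    nilp ((b k - iota lm.1 * e) ^+ 2 + iota lm.2 ^+ 2 * e).
  by move=> k; have [l0 [m0 h]] := quadratic_nilpotent prim (be k); exists (l0, m0).
have [[k mk]|allreal] := pselect (exists k, (l k).2 != 0).
  have [n0 hn0] := hl k.
  (* Normalised so that [u ^+ 2 + e] is nilpotent, the start of Newton's iteration. *)
  pose c := iota (l k).2^-1; pose u := c * (b k - iota (l k).1 * e).
  apply: (@newton_sqrt n0 u e ee) => //.
    by rewrite /u -mulrA mulrBl be -mulrA ee.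
  have -> : u ^+ 2 + e = c ^+ 2 * ((b k - iota (l k).1 * e) ^+ 2 + iota (l k).2 ^+ 2 * e).
    rewrite mulrDr mulrA -!exprMn -rmorphM mulVf// rmorph1 expr1n mul1r.
    by rewrite /u.
  rewrite exprMn -(subnK (ltnW (ltn_expl n0 (ltnSn 1)))) [X in _ * X]exprD hn0.
  by rewrite !mulr0.
(* With all residues real, [b k] is a real multiple of [e] up to a nilpotent; summing squares makes
   [iota S * e] nilpotent for a real S > 0, against [e != 0]. *)
exfalso; have l2 k : (l k).2 = 0.
  by apply/eqP; apply: contrapT => h; apply: allreal; exists k; apply/negP.
have nil1 k : nilp (b k - iota (l k).1 * e).
  by have [m0] := hl k; rewrite l2 rmorph0 expr0n /= mul0r addr0 -exprM => h; exists (2 * m0)%N.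
pose S := 1 + \sum_k (l k).1 ^+ 2.
have S0 : 0 < S by rewrite /S ltr_wpDr// sumr_ge0// => k _; rewrite sqr_ge0.
have : nilp (iota S * e).
  have -> : iota S * e = - \sum_k ((b k - iota (l k).1 * e) * (b k + iota (l k).1 * e)).
    have -> : \sum_k ((b k - iota (l k).1 * e) * (b k + iota (l k).1 * e)) =
      (\sum_k a k ^+ 2) * e - iota (\sum_k (l k).1 ^+ 2) * e.
      rewrite rmorph_sum !mulr_suml -sumrB; apply: eq_bigr => k _.
      have -> : (b k - iota (l k).1 * e) * (b k + iota (l k).1 * e) =
        a k ^+ 2 * (e * e) - iota (l k).1 ^+ 2 * (e * e) by rewrite /b; ring.
      by rewrite ee rmorphXn.
    move/eqP: asum; rewrite addrC addr_eq0 => /eqP ->.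
    by rewrite /S rmorphD rmorph1; ring.
  rewrite -mulrN1; apply: nilp_mul; apply: nilp_sum => k; exact: nilp_mul.
move=> /(nilp_mul (iota S^-1))[m0].
rewrite mulrAC -rmorphM mulfV ?gt_eqF// rmorph1 mul1r => h.
have em0 q : e ^+ q.+1 = e by elim: q => [|q IHq]; rewrite ?expr1// exprS IHq ee.
by move: h e0; case: m0 => [/eqP|q]; [rewrite expr0 oner_eq0|rewrite em0 => ->; rewrite eqxx].
Qed.

End ImaginaryUnit.

(** * The even part as a commutative ring *)

Section EvenRing.
Context {R : realType} {L : falgType R} {L0 L1 : {vspace L}} (hL : csa L0 L1).

(* The dummy dependence on hL lets the structure instances recover hL from [even_pred]. *)
Definition even_pred : pred L := let _ := hL in fun x => x \in L0.

Fact even_subring_closed : subring_closed even_pred.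
Proof.
split; rewrite /even_pred /= ?unfold_in.
- exact: csa_one hL.
- by move=> x y xL yL; rewrite unfold_in rpredB.
- move=> x y xL yL; rewrite unfold_in.
  by apply: (subvP (csa_mul00 hL)); exact: memv_mul.
Qed.

HB.instance Definition _ := GRing.isSubringClosed.Build L even_pred even_subring_closed.

Record even_ring := EvenRing { even_val : L; _ : even_pred even_val }.

HB.instance Definition _ := [isSub for even_val].
HB.instance Definition _ := [Choice of even_ring by <:].
HB.instance Definition _ := [SubChoice_isSubNzRing of even_ring by <:].

Fact even_mulC : @commutative even_ring even_ring *%R.
Proof.
move=> x y; apply: val_inj; rewrite !rmorphM /=.
by apply: (csa_comm hL); case: x.
Qed.

HB.instance Definition _ := GRing.PzRing_hasCommutativeMul.Build even_ring even_mulC.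

Fact even_alg_subproof (c : R) : even_pred (c%:A).
Proof. by rewrite /even_pred rpredZ// (csa_one hL). Qed.

Definition even_alg (c : R) : even_ring := EvenRing (even_alg_subproof c).

Fact even_alg_is_zmod_morphism : zmod_morphism even_alg.
Proof. by move=> x y; apply: val_inj; rewrite rmorphB /= scalerBl. Qed.

Fact even_alg_is_monoid_morphism : monoid_morphism even_alg.
Proof.
split; first by apply: val_inj; rewrite rmorph1 /= scale1r.
by move=> x y; apply: val_inj; rewrite rmorphM /= -scalerAl mul1r scalerA.
Qed.

HB.instance Definition _ := GRing.isZmodMorphism.Build R even_ring even_alg
  even_alg_is_zmod_morphism.
HB.instance Definition _ := GRing.isMonoidMorphism.Build R even_ring even_alg
  even_alg_is_monoid_morphism.

(** The powers of [a] with exponents up to the dimension of [L] are too many to be independent. *)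
Lemma even_ring_integral (a : even_ring) :
  exists2 p : {poly R}, p != 0 & (map_poly even_alg p).[a] = 0.
Proof.
pose n := (\dim {: L}).+1; pose X := [tuple (val a) ^+ i | i < n].
have nfree : ~~ free X.
  apply/negP => /eqP fX; have := dimvS (subvf <<X>>%VS).
  by rewrite fX size_tuple /n ltnn.
have [k [k0 [i ki]]] : exists k : 'I_n -> R, \sum_(i < n) k i *: X`_i = 0 /\ exists i, k i != 0.
  apply: contrapT => h; move/negP: nfree; apply; apply/freeP => k k0 i.
  by apply/eqP; apply: contrapT => ki; apply: h; exists k; split=> //; exists i; apply/negP.
pose p := \poly_(j < n) k (inord j).
have pE j : p`_j = if (j < n)%N then k (inord j) else 0 by rewrite coef_poly.
exists p.
  apply/eqP => p0; have := pE i; rewrite p0 coef0 ltn_ord inord_val => ki0.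
  by rewrite -ki0 eqxx in ki.
apply: val_inj; rewrite rmorph0 -k0 (@horner_coef_wide _ n); last first.
  by rewrite (leq_trans (size_poly _ _)) ?size_poly.
rewrite rmorph_sum; apply: eq_bigr => j _.
rewrite coef_map pE ltn_ord inord_val rmorphM rmorphXn /= -scalerAl mul1r.
by congr (_ *: _); rewrite nth_mktuple.
Qed.

Lemma even_valM (x y : even_ring) : even_val (x * y) = even_val x * even_val y.
Proof. exact: (rmorphM (val : even_ring -> L)). Qed.

Definition even_rank (x : even_ring) := \dim (amull (val x) @: L0)%VS.

(** The ideal of [e'] lies in that of [e]; equality would put [e] into the ideal of [e'] and give e
    = e' e = e'. *)
Lemma even_rank_idempotent (e e' : even_ring) : e * e = e -> e' * e' = e' ->
  e' * e = e' -> e' != e -> (even_rank e' < even_rank e)%N.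
Proof.
move=> ee e'e' e'e e'ne.
have sub : (amull (val e') @: L0 <= amull (val e) @: L0)%VS.
  apply/subvP => x /memv_imgP[y yL ->]; apply/memv_imgP; exists (val e' * y).
    by apply: (subvP (csa_mul00 hL)); apply: memv_mul => //; case: (e').
  by rewrite !lfunE /= mulrA -even_valM mulrC e'e.
rewrite ltn_neqAle (dimv_leqif_sup sub) (dimv_leqif_sup sub).1 andbT.
apply: contra e'ne => /subvP sub'; apply/eqP; apply: val_inj.
have /sub'/memv_imgP[y yL] : val e \in (amull (val e) @: L0)%VS.
  by apply/memv_imgP; exists 1; [exact: csa_one hL|rewrite lfunE /= mulr1].
by rewrite lfunE /= => eE; rewrite -[in LHS]e'e even_valM eE mulrA -even_valM e'e'.
Qed.

Lemma csa_imaginary_unit (p : nat) (e : p.+1.-tuple L) : A0_basis L0 e ->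
  exists2 j, j \in L0 & j * j = -1.
Proof.
move=> [eb e0 es].
have eL i : even_pred (tnth e i) by apply: (basis_mem eb); exact: mem_tnth.
have [|j j2] := @imaginary_unit _ _ even_alg even_ring_integral even_rank
    even_rank_idempotent p (fun k => EvenRing (eL (lift ord0 k))).
  apply: val_inj; rewrite rmorphD rmorph1 rmorph_sum rmorph0; apply: etrans es.
  (* The basis vector e_0 = 1 provides the summand 1. *)
  rewrite big_ord_recl e0 expr1n.
  by congr (_ + _); apply: eq_bigr => k _; rewrite rmorphXn.
exists (val j); first by case: (j).
by rewrite -expr2 -rmorphXn j2 rmorphN rmorph1.
Qed.

End EvenRing.

(** * Superdifferentiability and the complex structure *)

Section NormedVect.
Context {R : realType}.

Lemma coord_le_norm (V : vectType R) (v : normed_vect V) i :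
  `|coord (vbasis (fullv : {vspace V})) i (v : V)| <= `|v|.
Proof.
rewrite [leRHS]/Num.norm /= /vect_norm [leRHS]/Num.norm /= mx_normrE.
set w := \row_j _.
rewrite (_ : coord _ i (v : V) = w ord0 i); last by rewrite mxE.
exact: (le_bigmax _ (fun ij => `|w ij.1 ij.2|) (ord0, i)).
Qed.

Lemma norm_le_coord (V : vectType R) (v : normed_vect V) (c : R) : 0 <= c ->
  (forall i, `|coord (vbasis (fullv : {vspace V})) i (v : V)| <= c) -> `|v| <= c.
Proof.
move=> c0 vc; rewrite [leLHS]/Num.norm /= /vect_norm [leLHS]/Num.norm /= mx_normrE.
by apply: bigmax_le => // -[k i] _; rewrite /= mxE.
Qed.

Lemma linear_norm_bounded (V W : vectType R) (phi : {linear V -> W}) :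
  exists2 K : R, 0 <= K & forall v : V,
    `|(phi v : normed_vect W)| <= K * `|(v : normed_vect V)|.
Proof.
pose b := vbasis (fullv : {vspace V}).
exists (\sum_(i < \dim (fullv : {vspace V})) `|(phi b`_i : normed_vect W)|); first by rewrite sumr_ge0.
move=> v; rewrite {1}(coord_vbasis (memvf v)) linear_sum mulr_suml.
rewrite (le_trans (ler_norm_sum _ _ _))//; apply: ler_sum => i _.
rewrite linearZ /= (normrZ _ (phi b`_i : normed_vect W)) mulrC.
by rewrite ler_wpM2l// coord_le_norm.
Qed.

Lemma coord_norm_bounded (V : vectType R) (phi : {linear V -> R^o}) :
  exists2 K : R, 0 <= K & forall v : V, `|phi v : R| <= K * `|(v : normed_vect V)|.
Proof.
pose b := vbasis (fullv : {vspace V}).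
exists (\sum_(i < \dim (fullv : {vspace V})) `|phi b`_i : R|); first by rewrite sumr_ge0.
move=> v; rewrite {1}(coord_vbasis (memvf v)) linear_sum mulr_suml.
rewrite (le_trans (ler_norm_sum _ _ _))//; apply: ler_sum => i _.
rewrite linearZ /= normrM mulrC.
by rewrite ler_wpM2l// coord_le_norm.
Qed.

End NormedVect.

Section SDifferentiability.
Context {R : realType} {L : falgType R} {L0 : {vspace L}}.

Lemma littleo_epsilonP (V W : normedModType R) (f g : V -> W) :
  (forall h, f h = g h +o_(h \near 0) h) <->
  (forall e : R, 0 < e -> exists2 d : R, 0 < d &
     forall h, `|h| < d -> `|f h - g h| <= e * `|h|).
Proof.
split=> [fg e e0|fg].
  have /eqaddoP/(_ _ e0) : f = g +o_ 0 id by apply/funext.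
  by move=> /nbhs_norm0P[d /= d0 hd]; exists d => // h hh; exact: (hd h hh).
have : f = g +o_ 0 id.
  apply/eqaddoP => e /fg[d d0 hd]; apply/nbhs_norm0P; exists d => // h; exact: hd.
by rewrite funeqE.
Qed.

End SDifferentiability.

Section LinearBounds.
Context {R : realType}.

Lemma linear_norm_bound (V W : vectType R) (phi : V -> W) : linear phi ->
  exists2 K : R, 0 <= K & forall v : V,
    `|(phi v : normed_vect W)| <= K * `|(v : normed_vect V)|.
Proof.
move=> hphi; pose phi' : {linear V -> W} := HB.pack phi (GRing.isLinear.Build R V W *:%R phi hphi).
exact: (linear_norm_bounded phi').
Qed.

Lemma scalar_norm_bound (V : vectType R) (phi : V -> R) : scalar phi ->
  exists2 K : R, 0 <= K & forall v : V, `|phi v| <= K * `|(v : normed_vect V)|.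
Proof.
move=> hphi; pose phi' : {linear V -> R^o} :=
  HB.pack (phi : V -> R^o) (GRing.isLinear.Build R V R^o *:%R phi hphi).
exact: (coord_norm_bounded phi').
Qed.

Lemma uniform_bound (I : finType) (P : I -> R -> Prop) :
  (forall i K K', K <= K' -> P i K -> P i K') ->
  (forall i, exists K, P i K) -> exists2 K, 0 <= K & forall i, P i K.
Proof.
move=> mono /choice[K hK]; exists (\sum_i `|K i|); first by rewrite sumr_ge0.
move=> i; apply: mono (hK i); rewrite (bigD1 i)//= (le_trans (ler_norm _))// lerDl.
by rewrite sumr_ge0.
Qed.

End LinearBounds.

(** * A complex chart of the even space *)

Section ComplexStructure.
Context {R : realType} {L : falgType R} {L0 L1 : {vspace L}} (hL : csa L0 L1).
Context {p : nat} (e : p.+1.-tuple L) (eb : basis_of L0 e).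
Context (J : L) (JL : J \in L0) (JJ : J * J = -1).
Context {n : nat}.
Local Notation C := R[i].
Local Notation V := (even_space L0 n).
Local Notation I := ('I_n * 'I_p.+1)%type.

Let eL k : tnth e k \in L0. Proof. by apply: (basis_mem eb); exact: mem_tnth. Qed.

Let JeL k : J * tnth e k \in L0.
Proof. by apply: (subvP (csa_mul00 hL)); exact: memv_mul. Qed.

Definition single (j : 'I_n) (h : subvs_of L0) : V := [ffun i => if i == j then h else 0].

Definition direction (q : I) (w : C) : subvs_of L0 :=
  complex.Re w *: vsproj L0 (tnth e q.2) + complex.Im w *: vsproj L0 (J * tnth e q.2).

(** The real dimension of the source is 2n(p + 1), twice the number of real coordinates of a vector:
    this avoids the choice of a complex basis. *)
Definition complex_chart (z : I -> C) : V := \sum_q single q.1 (direction q (z q)).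

(* [complex_coord i] is the complex linear functional, for the complex structure
   given by multiplication by J, whose real part is the i-th coordinate. *)
Definition complex_coord (i : 'I_(\dim (fullv : {vspace L}))) (v : L) : C :=
  Complex (coord (vbasis fullv) i v) (- coord (vbasis fullv) i (J * v)).

Lemma singleD j h h' : single j (h + h') = single j h + single j h'.
Proof. by apply/ffunP => i; rewrite !ffunE; case: eqP; rewrite ?addr0. Qed.

Lemma singleZ j (a : R) h : single j (a *: h) = a *: single j h.
Proof. by apply/ffunP => i; rewrite !ffunE; case: eqP; rewrite ?scaler0. Qed.

Lemma directionD q w w' : direction q (w + w') = direction q w + direction q w'.
Proof. by case: w w' => [a b] [c d]; rewrite /direction /= !scalerDl addrACA. Qed.

Lemma single_direction_bound : exists2 K : R, 0 <= K &
  forall q w, `|single q.1 (direction q w)| <= K * cabs w.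
Proof.
apply: uniform_bound => [q K K' KK' h w|q].
  by rewrite (le_trans (h w))// ler_wpM2r.
exists (`|single q.1 (vsproj L0 (tnth e q.2))| + `|single q.1 (vsproj L0 (J * tnth e q.2))|).
move=> w; rewrite /direction singleD !singleZ mulrDl (le_trans (ler_normD _ _))//.
rewrite !normrZ [leRHS]addrC addrC.
by apply: lerD; rewrite mulrC ler_wpM2l// ?Re_le_cabs ?Im_le_cabs.
Qed.

Lemma complex_chart_upd z q w :
  complex_chart (upd z q w) = complex_chart z + single q.1 (direction q (w - z q)).
Proof.
rewrite /complex_chart (bigD1 q)//= [in RHS](bigD1 q)//= {1}/upd eqxx.
rewrite [RHS]addrAC -singleD -directionD [z q + _]addrC subrK; congr (_ + _).
by apply: eq_bigr => q' /negbTE q'q; rewrite /upd q'q.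
Qed.

Lemma direction_val q w : vsval (direction q w) =
  (complex.Re w *: 1 + complex.Im w *: J) * tnth e q.2.
Proof.
rewrite /direction linearD !linearZ /= !vsprojK ?eL ?JeL// mulrDl -!scalerAl mul1r.
by [].
Qed.

Lemma complex_coordB i u v : complex_coord i (u - v) = complex_coord i u - complex_coord i v.
Proof.
apply/eqP; rewrite eq_complex /= mulrBr !linearB /=.
by apply/andP; split; apply/eqP; ring.
Qed.

Lemma complex_coordM i (w : C) v :
  complex_coord i ((complex.Re w *: 1 + complex.Im w *: J) * v) = w * complex_coord i v.
Proof.
rewrite /complex_coord; set l := coord _ i.
have lD x y : l (x + y) = l x + l y by exact: linearD.
have lZ c x : l (c *: x) = c * l x by exact: linearZ.
have lN x : l (- x) = - l x by exact: linearN.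
apply/eqP; rewrite eq_complex; case: w => a b /=.
rewrite mulrDl -!scalerAl mul1r mulrDr -!scalerAr mulrA JJ mulN1r !lD !lZ lN.
by apply/andP; split; apply/eqP; ring.
Qed.

Lemma complex_coord_bound i : exists2 K : R, 0 <= K &
  forall v : L, cabs (complex_coord i v) <= K * `|(v : normed_vect L)|.
Proof.
have [|K K0 hK] := @linear_norm_bound R L L ( *%R J).
  by move=> a u v; rewrite mulrDr scalerAr.
exists (1 + K) => [|v]; first by lra.
apply: (le_trans (cabs_le_ReIm _)); rewrite /= normrN mulrDl mul1r.
apply: lerD; first exact: (coord_le_norm (v : normed_vect L)).
exact: le_trans (coord_le_norm (J * v : normed_vect L) i) (hK v).
Qed.

Lemma complex_chart_bound : exists2 K : R, 0 <= K & forall z (t : R),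
  (forall q, cabs (z q) <= t) -> `|complex_chart z| <= K * t.
Proof.
have [K K0 hK] := single_direction_bound.
exists (\sum_(q : I) K) => [|z t zt]; first by rewrite sumr_ge0.
rewrite mulr_suml /complex_chart (le_trans (ler_norm_sum _ _ _))//.
by apply: ler_sum => q _; rewrite (le_trans (hK q _))// ler_wpM2l.
Qed.

Definition real_coord (q : I) (v : V) : R := coord e q.2 (vsval (even_coord v q.1)).

(** For a real parameter [direction] is a real multiple of the basis vector, so the real coordinates
    form a right inverse of the chart. *)
Lemma real_coordK v : complex_chart (fun q => (real_coord q v)%:C%C) = v.
Proof.
apply/ffunP => i; apply: val_inj => /=.
rewrite /complex_chart sum_ffunE linear_sum /= -(pair_bigA _ (fun a b =>
  vsval (single a (direction (a, b) (real_coord (a, b) v)%:C%C) i))) /=.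
rewrite (bigD1 i)//= [X in _ + X]big1 ?addr0 => [|a ai]; last first.
  by apply: big1 => b _; rewrite ffunE eq_sym (negbTE ai).
rewrite [RHS](coord_basis eb) ?subvsP//; apply: eq_bigr => k _.
rewrite ffunE eqxx direction_val /= scale0r addr0 -scalerAl mul1r /real_coord /=.
by rewrite (tnth_nth 0).
Qed.

Lemma real_coord_bound : exists2 K : R, 0 <= K & forall q (v : V), `|real_coord q v| <= K * `|v|.
Proof.
apply: uniform_bound => [q K K' KK' h v|q].
  by rewrite (le_trans (h v))// ler_wpM2r.
have [|K K0 hK] := @scalar_norm_bound R {ffun 'I_n -> subvs_of L0}
    (fun v => coord e q.2 (vsval (v q.1))); last by exists K.
by move=> a u v; rewrite !ffunE !linearP.
Qed.

End ComplexStructure.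

(** * From separate S-differentiability to second order estimates *)

Section Transfer.
Context {R : realType} {L : falgType R} {L0 L1 : {vspace L}} (hL : csa L0 L1).
Context {p : nat} (e : p.+1.-tuple L) (eb : basis_of L0 e).
Context (J : L) (JL : J \in L0) (JJ : J * J = -1).
Context {n : nat} (D : set (even_space L0 n)) (Dopen : open D).
Context (f : even_space L0 n -> normed_vect L).
Hypothesis hf : separately_S_differentiable D f.
Local Notation C := R[i].
Local Notation V := (even_space L0 n).
Local Notation W := (normed_vect L).
Local Notation I := ('I_n * 'I_p.+1)%type.

(** Moves the one-variable hypothesis to increments [single j h] measured in the norm of the whole
    space; [K] compares the two norms. *)
Lemma slice_derivative (j : 'I_n) (y : V) : D y -> exists d : L,
  forall eps : R, 0 < eps -> exists2 del : R, 0 < del &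
  forall h : subvs_of L0, `|single j h : V| < del ->
    `|f (y + single j h) - f y - (d * vsval h : W)| <= eps * `|single j h : V|.
Proof.
move=> Dy; pose t : even_space L0 1 := [ffun=> even_coord y j].
have tE : even_coord t ord0 = even_coord y j by rewrite /even_coord ffunE.
have yE : replace_coord y j (even_coord t ord0) = y.
  by rewrite tE; apply/ffunP => i; rewrite ffunE; case: eqP => [->|].
have [|dF /littleo_epsilonP hdF] := hf (j := j) (y := y) (t := t); first by rewrite yE.
exists (dF ord0) => eps eps0.
have [|K K0 hK] := @linear_norm_bound R {ffun 'I_n -> subvs_of L0} {ffun 'I_1 -> subvs_of L0}
    (fun v => [ffun=> v j]).
  by move=> a u v; apply/ffunP => i; rewrite !ffunE.
have [del del0 hdel] := hdF (eps / (K + 1)) (divr_gt0 eps0 (ltr_wpDl K0 ltr01)).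
have K1 : 0 < K + 1 by lra.
exists (del / (K + 1)) => [|h]; first by rewrite divr_gt0.
rewrite ltr_pdivlMr// => hh.
pose u : even_space L0 1 := [ffun=> h].
have us : `|u| <= K * `|single j h : V|.
  have := hK (single j h); congr (`| _ | <= _).
  by apply/ffunP => i; rewrite !ffunE eqxx.
have s0 : 0 <= `|single j h : V| by [].
have udel : `|u| < del by apply: (le_lt_trans us); lra.
have uE : even_coord u ord0 = h by rewrite /even_coord ffunE.
have tuE : even_coord (t + u) ord0 = even_coord y j + h by rewrite /even_coord !ffunE.
have := hdel u udel; rewrite big_ord1 tuE uE yE.
have -> : replace_coord y j (even_coord y j + h) = y + single j h.
  apply/ffunP => i; rewrite !ffunE /even_coord.
  by case: eqP => [->//|_]; rewrite addr0.
rewrite opprD addrA => /le_trans; apply.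
rewrite mulrAC ler_pdivrMr// -mulrA ler_pM2l//; lra.
Qed.

Lemma slice_derivative_choice : exists dS : 'I_n -> V -> L, forall j y, D y ->
  forall eps : R, 0 < eps -> exists2 del : R, 0 < del &
  forall h : subvs_of L0, `|single j h : V| < del ->
    `|f (y + single j h) - f y - (dS j y * vsval h : W)| <= eps * `|single j h : V|.
Proof.
have /choice[dS hdS] : forall jy : 'I_n * V, exists d : L, D jy.2 ->
  forall eps : R, 0 < eps -> exists2 del : R, 0 < del &
  forall h : subvs_of L0, `|single jy.1 h : V| < del ->
    `|f (jy.2 + single jy.1 h) - f jy.2 - (d * vsval h : W)| <= eps * `|single jy.1 h : V|.
  move=> [j y]; have [Dy|nDy] := pselect (D y); last by exists 0.
  by have [d hd] := slice_derivative j Dy; exists d.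
by exists (fun j y => dS (j, y)) => j y Dy; exact: (hdS (j, y) Dy).
Qed.

Variable dS : 'I_n -> V -> L.
Hypothesis hdS : forall j y, D y ->
  forall eps : R, 0 < eps -> exists2 del : R, 0 < del &
  forall h : subvs_of L0, `|single j h : V| < del ->
    `|f (y + single j h) - f y - (dS j y * vsval h : W)| <= eps * `|single j h : V|.

Let chart := @complex_chart R L L0 p e J n.
Let F i (y : V) z := complex_coord J i (f (y + chart z)).
Let DF i (y : V) (q : I) z := complex_coord J i (dS q.1 (y + chart z) * tnth e q.2).

(** The increment of the variable is (a + bJ) e_k. The even element a + bJ commutes with the
    S-derivative, so the main part of the increment of [f] is complex linear in a + ib. *)
Lemma chart_complex_derivative i (y : V) q z : D (y + chart z) ->
  complex_derivative (fun w => F i y (upd z q w)) (z q) (DF i y q z).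
Proof.
move=> Dyz eps eps0.
have [Kg Kg0 hKg] := @complex_coord_bound R L J i.
have [Ks Ks0 hKs] := @single_direction_bound R L L0 p e J n.
have K0 : 0 < Kg * Ks + 1 by rewrite ltr_wpDl// mulr_ge0.
have Ks1 : 0 < Ks + 1 by lra.
have [del del0 hdel] := hdS q.1 Dyz (divr_gt0 eps0 K0).
exists (del / (Ks + 1)) => [|h]; first by rewrite divr_gt0.
rewrite ltr_pdivlMr// => hh.
have h0 := cabs_ge0 h.
have sdel : `|single q.1 (direction e J q h) : V| < del.
  by apply: (le_lt_trans (hKs q h)); lra.
have := hdel _ sdel.
rewrite /F upd_id /chart complex_chart_upd [z q + h]addrC addrK addrA -/chart.
rewrite /DF [complex_coord _ _ _ * h]mulrC; set s := single _ _.
move=> hs; rewrite -complex_coordB -(complex_coordM JJ) -complex_coordB.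
have comm : (complex.Re h *: 1 + complex.Im h *: J) * (dS q.1 (y + chart z) * tnth e q.2) =
    dS q.1 (y + chart z) * vsval (direction e J q h : subvs_of L0).
  rewrite (direction_val hL eb JL) !mulrA; congr (_ * _); apply: (csa_comm hL).
  by rewrite rpredD// rpredZ// (csa_one hL).
rewrite comm (le_trans (hKg _))//.
apply: (le_trans (ler_wpM2l Kg0 hs)).
apply: (@le_trans _ _ (Kg * (eps / (Kg * Ks + 1) * (Ks * cabs h)))).
  by rewrite ler_wpM2l// ler_wpM2l ?hKs// divr_ge0 ?ltW.
have -> : Kg * (eps / (Kg * Ks + 1) * (Ks * cabs h)) =
  (eps * cabs h) * (Kg * Ks / (Kg * Ks + 1)) by ring.
rewrite ler_piMr ?mulr_ge0 ?(ltW eps0)// ler_pdivrMr// mul1r; lra.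
Qed.

Definition total_differential (y v : V) : W :=
  (\sum_j dS j y * vsval (even_coord v j) : L).

(** The first bound identifies the differential at [y0], the second gives its continuity. *)
Lemma local_estimates (y0 : V) : D y0 -> exists K del : R, [/\ 0 <= K, 0 < del &
  forall v : V, `|v| <= del ->
    `|f (y0 + v) - f y0 - total_differential y0 v| <= K * `|v| ^+ 2 /\
    forall w : V, `|total_differential (y0 + v) w - total_differential y0 w| <= K * `|v| * `|w| ].
Proof.
move=> Dy0.
have [rho rho0 hrho] : exists2 rho : R, 0 < rho & forall v : V, `|v| < rho -> D (y0 + v).
  have : nbhs y0 D by exact: open_nbhs_nbhs.
  move=> /nbhs0P/nbhs_norm0P[rho /= rho0 hrho]; exists rho => // v vr; exact: hrho.
have [Kc Kc0 hKc] := @complex_chart_bound R L L0 p e J n.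
have [Kx Kx0 hKx] := @real_coord_bound R L L0 p e n.
have Kc1 : 0 < Kc + 1 by lra.
(* The chart maps the polydisc of radius [R0] into the ball of radius [rho]. *)
pose R0 := rho / (Kc + 1); have R00 : 0 < R0 by rewrite divr_gt0.
have DR0 z : (forall q : I, cabs (z q) < R0) -> D (y0 + chart z).
  move=> zR; apply: hrho; apply: (@le_lt_trans _ _ (Kc * R0)).
    by apply: hKc => q; exact: ltW.
  by rewrite /R0 mulrA ltr_pdivrMr// mulrC ltr_pM2l//; lra.
(* [hartogs_bounded] gives a bound on strictly smaller polydiscs. *)
pose r := R0 / 2; have r0 : 0 < r by rewrite divr_gt0.
have rR0 : r < R0 by rewrite /r; lra.
have FD i z q : (forall q : I, cabs (z q) < r) ->
    complex_derivative (fun w => F i y0 (upd z q w)) (z q) (DF i y0 q z).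
  by move=> zr; apply: chart_complex_derivative; apply: DR0 => q'; exact: lt_trans rR0.
have FM i : exists M, forall z, (forall q : I, cabs (z q) < r) -> cabs (F i y0 z) <= M.
  have [|||M hM] := @hartogs_bounded R I (F i y0) R0 _ r.
  - by move=> z q zR; exists (DF i y0 q z); apply: chart_complex_derivative; exact: DR0.
  - exact: ltW.
  - exact: rR0.
  by exists M => z zr; apply: hM => q; exact: ltW.
pose zero : I -> C := fun=> 0.
have chart0 : y0 + chart zero = y0.
  rewrite /chart /complex_chart big1 ?addr0// => q _.
  rewrite /direction /= !scale0r addr0.
  by apply/ffunP => k; rewrite !ffunE; case: ifP.
have [K K0 hK] : exists2 K : R, 0 <= K & forall i (t : R) z, t <= r / 8 ->
    (forall q, cabs (z q) <= t) ->
    cabs (F i y0 z - F i y0 zero - \sum_q DF i y0 q zero * z q) <= K * t ^+ 2 /\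
    forall q, cabs (DF i y0 q z - DF i y0 q zero) <= K * t.
  apply: uniform_bound => [i K K' KK' h t z tr zt|i].
    have [h1 h2] := h t z tr zt; split.
      by rewrite (le_trans h1)// ler_wpM2r// sqr_ge0.
    move=> q; rewrite (le_trans (h2 q))// ler_wpM2r//.
    exact: (le_trans (cabs_ge0 (z q)) (zt q)).
  have [M hM] := FM i.
  have T := several_taylor r0 (FD i) hM; have T' := derivative_lipschitz r0 (FD i) hM.
  pose K1 := 8 * #|{: I}|%:R * (8 * M / r) / r.
  pose K2 := #|{: I}|%:R * (32 * M / r ^+ 2 + K1).
  exists (Num.max K1 K2) => t z tr zt; split.
    apply: (le_trans (T z t tr zt)); rewrite mulrA -/K1 -/K2.
    by rewrite ler_wpM2r ?sqr_ge0// le_max lexx orbT.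
  move=> q; apply: (le_trans (T' z q t tr zt)); rewrite -/K1.
  rewrite ler_wpM2r ?le_max ?lexx//.
  exact: (le_trans (cabs_ge0 (z q)) (zt q)).
(* The estimates are specialised to real parameters, and real parts of the complex coordinates of
   [L] give back the ordinary ones. *)
pose x (v : V) : I -> C := fun q => (real_coord e q v)%:C%C.
have chartx v : chart (x v) = v by exact: (real_coordK hL eb JL).
have xle v q : cabs (x v q) <= Kx * `|v| by rewrite cabs_real.
pose ell i (v : L) := coord (vbasis (fullv : {vspace L})) i v.
have ellE i v : complex.Re (complex_coord J i v) = ell i v by [].
have tdE y v : total_differential y v =
    \sum_(q : I) real_coord e q v *: (dS q.1 y * tnth e q.2) :> L.
  rewrite /total_differential -(pair_bigA _ (fun a b =>
    real_coord e (a, b) v *: (dS a y * tnth e b))) /=.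
  apply: eq_bigr => j _; rewrite (coord_basis eb (subvsP (even_coord v j))) mulr_sumr.
  by apply: eq_bigr => k _; rewrite -scalerAr (tnth_nth 0).
have Kx1 : 0 < Kx + 1 by lra.
(* Ensures [Kx * |v| <= r / 8], the range of the estimates in several variables. *)
pose del := r / 8 / (Kx + 1).
have del0 : 0 < del by rewrite !divr_gt0.
pose N : R := #|{: I}|%:R.
have N0 : 0 <= N by rewrite /N ler0n.
(* The first summand is for the remainder of [f]. The second is for the differential: [N] terms,
   each with a coordinate of [w] and a derivative increment of size [K * Kx * |v|]. *)
exists (K * Kx ^+ 2 + N * (Kx * (K * Kx))), del; split => //.
  by rewrite addr_ge0// !mulr_ge0// sqr_ge0.
move=> v vdel; have v0 : 0 <= `|v| by [].
have tr : Kx * `|v| <= r / 8.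
  by move: vdel; rewrite /del ler_pdivlMr//; lra.
have KK0 : 0 <= N * (Kx * (K * Kx)) by rewrite !mulr_ge0.
split.
  rewrite mulrDl (@le_trans _ _ (K * Kx ^+ 2 * `|v| ^+ 2))//; last first.
    by rewrite lerDl mulr_ge0// sqr_ge0.
  apply: norm_le_coord => [|i]; first by rewrite !mulr_ge0// sqr_ge0.
  have [h1 _] := hK i _ (x v) tr (xle v).
  rewrite -mulrA -exprMn (le_trans _ h1)// (le_trans _ (Re_le_cabs _))//.
  rewrite le_eqVlt; apply/orP; left; apply/eqP; congr (`| _ |).
  rewrite /F chartx chart0 !complex_ReB !ellE tdE /ell !linearB linear_sum /=; congr (_ - _).
  have -> : forall G : I -> C, complex.Re (\sum_q G q) = \sum_q complex.Re (G q).
    by move=> G; apply: (big_morph (@complex.Re R)) => // -[? ?] [? ?].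
  apply: eq_bigr => q _; rewrite linearZ /= /DF chart0 /x.
  by rewrite mulr0 subr0 mulrC.
move=> w.
rewrite (@le_trans _ _ (N * (Kx * (K * Kx)) * `|v| * `|w|))//; last first.
  by rewrite mulrDl mulrDl lerDr !mulr_ge0// sqr_ge0.
apply: norm_le_coord => [|i]; first by rewrite !mulr_ge0.
rewrite !tdE -sumrB linear_sum (le_trans (ler_norm_sum _ _ _))//.
have -> : N * (Kx * (K * Kx)) * `|v| * `|w| = \sum_(q : I) (Kx * `|w|) * (K * (Kx * `|v|)).
  by rewrite sumr_const -mulr_natl -/N; ring.
apply: ler_sum => q _; rewrite -scalerBr linearZ normrM ler_pM//.
have [_ h2] := hK i _ (x v) tr (xle v).
apply: le_trans (h2 q); rewrite /DF chartx chart0 -complex_coordB.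
exact: (Re_le_cabs (complex_coord J i _)).
Qed.

Lemma total_differential_linear y : linear (total_differential y).
Proof.
move=> a u v; rewrite /total_differential scaler_sumr -big_split /=.
apply: eq_bigr => j _; rewrite /even_coord !ffunE linearP /= mulrDr scalerAr.
by [].
Qed.

Lemma local_littleo y0 : D y0 ->
  forall h, f (y0 + h) = f y0 + total_differential y0 h +o_(h \near 0) h.
Proof.
move=> Dy0; have [K [del [K0 del0 est]]] := local_estimates Dy0.
apply/littleo_epsilonP => eps eps0; have K1 : 0 < K + 1 by lra.
exists (Num.min del (eps / (K + 1))); first by rewrite lt_min del0 divr_gt0.
move=> h; rewrite lt_min ltr_pdivlMr// => /andP[hdel heps].
have [h1 _] := est h (ltW hdel).
rewrite opprD addrA (le_trans h1)// expr2 mulrA ler_wpM2r//.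
by have := normr_ge0 h; lra.
Qed.

Lemma diff_total_differential y0 : D y0 ->
  differentiable f y0 /\ 'd f y0 = total_differential y0 :> (V -> W).
Proof.
move=> Dy0.
pose T : {linear V -> W} := HB.pack (total_differential y0)
  (GRing.isLinear.Build R V W *:%R (total_differential y0) (total_differential_linear y0)).
have Tc : continuous T.
  have [K K0 hK] := @linear_norm_bound R {ffun 'I_n -> subvs_of L0} L
    (total_differential y0) (total_differential_linear y0).
  apply: bounded_linear_continuous; apply/linear_boundedP; near=> r => x.
  by rewrite (le_trans (hK x))// ler_wpM2r.
have oT : f \o shift y0 = cst (f y0) + T +o_ 0 id.
  apply: eqaddoE; rewrite funeqE => h; rewrite /= [h + y0]addrC.
  exact: local_littleo.
have dE := diff_unique Tc oT.
split; last exact: dE.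
by apply/diff_locallyP; rewrite dE.
Unshelve. all: by end_near. Qed.

End Transfer.

(** * Continuity of the differential and the theorem *)

Lemma frechet_C1_by_differential (R : realType) (V W : normedModType R)
    (D : set V) (f : V -> W) (T : V -> V -> W) : open D ->
  (forall x, D x -> differentiable f x /\ 'd f x = T x :> (V -> W)) ->
  (forall x, D x -> forall eps : R, 0 < eps -> exists2 del : R, 0 < del &
    forall u, `|u| < del -> forall v, `|T (x + u) v - T x v| <= eps * `|v|) ->
  frechet_C1 D f.
Proof.
move=> Do dT cT; split=> [x /dT[]//|x Dx eps eps0].
have [del del0 hdel] := cT x Dx eps eps0.
have : nbhs x D by exact: open_nbhs_nbhs.
rewrite -[X in _ -> X]/(\near x, _) => Dnear.
near=> y => v.
have Dy : D y by near: y.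
have dv z : D z -> 'd f z v = T z v by move=> /dT[_ ->].
rewrite (dv y Dy) (dv x Dx).
have yx : `|y - x| < del.
  by near: y; apply/nbhs_normP; exists del => //= y; rewrite /= distrC.
by have := hdel _ yx v; rewrite [x + _]addrC subrK.
Unshelve. all: by end_near. Qed.

Theorem mainTheorem4 (R : realType) (L : falgType R) (L0 L1 : {vspace L})
    (hL : csa L0 L1)
    (p q : nat) (e : p.+1.-tuple L) (s : q.-tuple L)
    (he : A0_basis L0 e) (hs : basis_of L1 s) (hP : condP e s)
    (n : nat) (hn : (1 <= n)%N)
    (D : set (even_space L0 n)) (hDo : open D) (hDc : connected D)
    (f : even_space L0 n -> normed_vect L)
    (hf : separately_S_differentiable D f) :
  frechet_C1 D f /\ (forall y, D y -> S_differentiable f y).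
Proof.
have [eb _ _] := he; have [J JL JJ] := csa_imaginary_unit hL he.
have [dS hdS] := slice_derivative_choice hf.
have dE y (Dy : D y) := diff_total_differential hL eb JL JJ hDo hdS Dy.
split; last first.
  by move=> y Dy; exists (fun j => dS j y); exact: (local_littleo hL eb JL JJ hDo hdS Dy).
apply: (frechet_C1_by_differential hDo dE) => x Dx eps eps0.
have [K [del [K0 del0 est]]] := local_estimates hL eb JL JJ hDo hdS Dx.
have K1 : 0 < K + 1 by lra.
exists (Num.min del (eps / (K + 1))); first by rewrite lt_min del0 divr_gt0.
move=> u; rewrite lt_min ltr_pdivlMr// => /andP[udel ueps] v.
have [_ /(_ v)] := est _ (ltW udel); move=> /le_trans; apply.
by rewrite ler_wpM2r//; have := normr_ge0 u; lra.
Qed.
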